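(* Let $p\in[1,\infty)$. Let $(\rho_{st})_{0\le s\le t\le T}$ be a strong time-consistent fully-dynamic convex risk measure on $(L_p(\mathcal F_t))_t$ such that $\rho_{0T}$ is dominated and sensitive. 1. For all $s\le t$, the risk measure $\rho_{st}$ admits a unique extension $\tilde\rho_{st}:L^c_t\to L^c_s$ such that $$c\big(|\tilde\rho_{st}(X)-\tilde\rho_{st}(Y)|\big)\le c(|X-Y|),\qquad X,Y\in L^c_t.$$ 2. The extension $\tilde\rho_{st}$ admits the representation $$\tilde\rho_{st}(X)=\operatorname*{ess\,sup}_{R\in\widetilde{\mathcal P}_{st}}\big(E_R(-X|\mathcal F_s)-\alpha_{st}(R)\big),\qquad X\in L^c_t.$$
   Context: Let $T\in(0,\infty)$ and let $(\Omega,\mathcal F,(\mathcal F_t)_{t\in[0,T]},P)$ be a complete filtered probability space with $\mathcal F_0$ trivial; $L_p(\mathcal F_t)=L_p(\Omega,\mathcal F_t,P)$, $E_Q$ is expectation under $Q$. Relations between random variables hold $P$-a.s. A fully-dynamic convex risk measure on $(L_p(\mathcal F_t))_t$ ($p<\infty$) is a family of mappings $\rho_{st}:L_p(\mathcal F_t)\to L_p(\mathcal F_s)$, $0\le s\le t\le T$, each monotone ($\rho_{st}(X')\le\rho_{st}(X'')$ if $X'\ge X''$), convex, and $\mathcal F_s$-translation invariant ($\rho_{st}(X+f)=\rho_{st}(X)-f$, $f\in L_p(\mathcal F_s)$). It is strong time-consistent if $\rho_{rt}(X)=\rho_{rs}(-\rho_{st}(X))$ for all $r\le s\le t$, $X\in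 L_p(\mathcal F_t)$. Minimal penalty: $\alpha_{st}(Q)=\operatorname{ess\,sup}_{X\in L_p(\mathcal F_t)}\big(E_Q(-X|\mathcal F_s)-\rho_{st}(X)\big)$. $\rho_{0T}:L_p(\mathcal F_T)\to\mathbb R$ is dominated if there is a sublinear (coherent) risk measure $\bar\rho:L_p(\mathcal F_T)\to\mathbb R$ with $\rho_{0T}(X)-\rho_{0T}(0)\le\bar\rho(X)$ for all $X$ (equivalently, there are $K>0$, $C\in\mathbb R$ with $\rho_{0T}(X)\le K\|X\|_p+C$ for all $X$). It is sensitive if there is a probability measure $\tilde Q\sim P$ on $\mathcal F_T$ with $\alpha_{0T}(\tilde Q)<\infty$. $\mathcal Q=\{Q\sim P:\ \alpha_{0T}(Q)<\infty\}$ (on $\mathcal F_T$); $c(X)=\sup_{Q\in\mathcal Q}E_Q(|X|)$ for $\mathcal F_T$-measurable $X$. $L^c_t$ is the Banach space obtained by completing the set of essentially bounded $\mathcal F_t$-measurable random variables with respect to the seminorm $c$ and passing to the quotient by the equivalence relation $c(X-Y)=0$ (note $c(X)=0$ iff $X=0$ $P$-a.s.). For every $Q\in\mathcal Q$ one has $L_p(\mathcal F_t,P)\subseteq L^c_t\subseteq L_1(\mathcal F_t,Q)$. For $s\le t$, on $(\Omega,\mathcal F_t)$, $\widetilde{\mathcal P}_{st}=\{R\sim P:\ R_{|\mathcal F_s}=P,\ \sup_{Q\in\mathcal Q}E_Q(\alpha_{st}(R))<\infty\}$. *)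

(* Defs.v *)
From HB Require Import structures.
From mathcomp Require Import all_boot all_order all_algebra.
From mathcomp Require Import all_classical all_reals all_analysis.
From mathcomp Require Import measurable_realfun.
Import numFieldNormedType.Exports.

Set Implicit Arguments.
Unset Strict Implicit.
Unset Printing Implicit Defensive.

Import Order.TTheory GRing.Theory Num.Theory.
Local Open Scope classical_set_scope.
Local Open Scope ring_scope.

(* A sub-sigma-algebra is a set system G on Omega; its measurable space is
   g_sigma_algebraType G, so a probability measure on (Omega, G) has type
   probability (g_sigma_algebraType G) R.  Random variables are functions on
   Omega, identified when they agree P-a.s. *)

Definition rv_measurable d (Omega : measurableType d) (R : realType)
    (G : set_system Omega) (X : Omega -> R) : Prop :=
  measurable_fun setT (X : g_sigma_algebraType G -> R).

Definition erv_measurable d (Omega : measurableType d) (R : realType)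
    (G : set_system Omega) (X : Omega -> \bar R) : Prop :=
  measurable_fun setT (X : g_sigma_algebraType G -> \bar R).

(* Only the restriction of F to [0, T] is meaningful.  Completeness of the
   filtered space: F_0 contains every subset of a P-null set. *)
Record complete_filtration d (Omega : measurableType d) (R : realType)
    (P : probability Omega R) (T : R) (F : R -> set_system Omega) : Prop := {
  filtration_sigma : forall t, 0 <= t <= T -> sigma_algebra setT (F t) ;
  filtration_sub : forall t, 0 <= t <= T -> F t `<=` measurable ;
  filtration_mono : forall s t, 0 <= s -> s <= t -> t <= T -> F s `<=` F t ;
  filtration_complete : measure_is_complete P ;
  filtration_null : forall A : set Omega, P.-negligible A -> F 0 A }.

Definition trivial_sigma_algebra d (Omega : measurableType d) (R : realType)
    (P : probability Omega R) (G : set_system Omega) : Prop :=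
  forall A, G A -> P A = 0%E \/ P A = 1%E.

Definition equivalent_on d (Omega : measurableType d) (R : realType)
    (P : probability Omega R) (G : set_system Omega)
    (Q : probability (g_sigma_algebraType G) R) : Prop :=
  forall A, G A -> (Q A = 0%E <-> P A = 0%E).

Definition Lp_space d (Omega : measurableType d) (R : realType)
    (P : probability Omega R) (p : R) (G : set_system Omega) :
    set (Omega -> R) :=
  [set X | rv_measurable G X /\ finite_norm P p%:E X].

(* Conditional expectation given G under a measure Q on (Omega, H), first for
   f valued in [0, +oo], where it always exists and is Q-a.s. unique. *)
Definition is_cond_exp_nneg d (Omega : measurableType d) (R : realType)
    (H : set_system Omega) (Q : probability (g_sigma_algebraType H) R)
    (G : set_system Omega) (f g : Omega -> \bar R) : Prop :=
  [/\ erv_measurable G g,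
      (forall x, 0 <= g x)%E &
      forall A, G A -> (\int[Q]_(x in A) g x = \int[Q]_(x in A) f x)%E].

Definition cond_exp_nneg d (Omega : measurableType d) (R : realType)
    (H : set_system Omega) (Q : probability (g_sigma_algebraType H) R)
    (G : set_system Omega) (f : Omega -> \bar R) : Omega -> \bar R :=
  xget (cst 0%E) [set g | is_cond_exp_nneg Q G f g].

(* E_Q(X|G) = E_Q(X^+|G) - E_Q(X^-|G), which does not require X to be
   Q-integrable.  The indeterminate value +oo - +oo is -oo; this leaves the
   penalty below unchanged, since where E_Q(|X| | G) = +oo the variable -|X|
   already contributes +oo to the essential supremum. *)
Definition cond_exp d (Omega : measurableType d) (R : realType)
    (H : set_system Omega) (Q : probability (g_sigma_algebraType H) R)
    (G : set_system Omega) (X : Omega -> R) : Omega -> \bar R :=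
  fun x => (cond_exp_nneg Q G ((EFin \o X)^\+)%E x
            - cond_exp_nneg Q G ((EFin \o X)^\-)%E x)%E.

Definition is_ess_sup d (Omega : measurableType d) (R : realType)
    (P : probability Omega R) (G : set_system Omega)
    (U : set (Omega -> \bar R)) (Y : Omega -> \bar R) : Prop :=
  [/\ erv_measurable G Y,
      (forall Z, U Z -> \forall x \ae P, (Z x <= Y x)%E) &
      forall Y', erv_measurable G Y' ->
        (forall Z, U Z -> \forall x \ae P, (Z x <= Y' x)%E) ->
        \forall x \ae P, (Y x <= Y' x)%E].

Definition family_ess_sup d (Omega : measurableType d) (R : realType)
    (P : probability Omega R) (G : set_system Omega)
    (U : set (Omega -> \bar R)) : Omega -> \bar R :=
  xget (cst -oo%E) [set Y | is_ess_sup P G U Y].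

(* rho s t stands for rho_{st}; only its values on L_p(F_t) with
   0 <= s <= t <= T matter.  Monotonicity makes it compatible with P-a.s.
   equality. *)
Record fully_dynamic_crm d (Omega : measurableType d) (R : realType)
    (P : probability Omega R) (T : R) (F : R -> set_system Omega) (p : R)
    (rho : R -> R -> (Omega -> R) -> Omega -> R) : Prop := {
  crm_maps : forall s t, 0 <= s -> s <= t -> t <= T ->
    forall X, Lp_space P p (F t) X -> Lp_space P p (F s) (rho s t X) ;
  crm_monotone : forall s t, 0 <= s -> s <= t -> t <= T ->
    forall X' X'', Lp_space P p (F t) X' -> Lp_space P p (F t) X'' ->
    (\forall x \ae P, X'' x <= X' x) ->
    \forall x \ae P, rho s t X' x <= rho s t X'' x ;
  crm_convex : forall s t, 0 <= s -> s <= t -> t <= T ->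
    forall X Y, Lp_space P p (F t) X -> Lp_space P p (F t) Y ->
    forall l : R, 0 <= l <= 1 ->
    \forall x \ae P, rho s t (fun y => l * X y + (1 - l) * Y y) x
                     <= l * rho s t X x + (1 - l) * rho s t Y x ;
  crm_translation : forall s t, 0 <= s -> s <= t -> t <= T ->
    forall X f, Lp_space P p (F t) X -> Lp_space P p (F s) f ->
    \forall x \ae P, rho s t (X \+ f) x = rho s t X x - f x }.

Definition strong_time_consistent d (Omega : measurableType d) (R : realType)
    (P : probability Omega R) (T : R) (F : R -> set_system Omega) (p : R)
    (rho : R -> R -> (Omega -> R) -> Omega -> R) : Prop :=
  forall r s t, 0 <= r -> r <= s -> s <= t -> t <= T ->
  forall X, Lp_space P p (F t) X ->
  \forall x \ae P, rho r t X x = rho r s (\- rho s t X) x.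

Record coherent_risk_measure d (Omega : measurableType d) (R : realType)
    (P : probability Omega R) (p : R) (G : set_system Omega)
    (rhobar : (Omega -> R) -> R) : Prop := {
  coh_monotone : forall X' X'', Lp_space P p G X' -> Lp_space P p G X'' ->
    (\forall x \ae P, X'' x <= X' x) -> rhobar X' <= rhobar X'' ;
  coh_translation : forall X (a : R), Lp_space P p G X ->
    rhobar (X \+ cst a) = rhobar X - a ;
  coh_subadditive : forall X Y, Lp_space P p G X -> Lp_space P p G Y ->
    rhobar (X \+ Y) <= rhobar X + rhobar Y ;
  coh_homogeneous : forall X (l : R), Lp_space P p G X -> 0 <= l ->
    rhobar (fun x => l * X x) = l * rhobar X }.

(* rho_{0T}(X) is F_0-measurable, hence a.s. constant when F_0 is trivial. *)
Definition dominated d (Omega : measurableType d) (R : realType)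
    (P : probability Omega R) (T : R) (F : R -> set_system Omega) (p : R)
    (rho : R -> R -> (Omega -> R) -> Omega -> R) : Prop :=
  exists2 rhobar, coherent_risk_measure P p (F T) rhobar &
  forall X, Lp_space P p (F T) X ->
  \forall x \ae P, rho 0 T X x - rho 0 T (cst 0) x <= rhobar X.

(* The minimal penalty alpha_{st}(Q) of a measure Q on (Omega, F_t). *)
Definition min_penalty d (Omega : measurableType d) (R : realType)
    (P : probability Omega R) (F : R -> set_system Omega) (p : R)
    (rho : R -> R -> (Omega -> R) -> Omega -> R) (s t : R)
    (Q : probability (g_sigma_algebraType (F t)) R) : Omega -> \bar R :=
  family_ess_sup P (F s)
    [set (fun x => (cond_exp Q (F s) (\- X)%R x - (rho s t X x)%:E)%E)
      | X in Lp_space P p (F t)].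

Arguments min_penalty {d Omega R} P F p rho s t Q.

Definition calQ d (Omega : measurableType d) (R : realType)
    (P : probability Omega R) (T : R) (F : R -> set_system Omega) (p : R)
    (rho : R -> R -> (Omega -> R) -> Omega -> R) :
    set (probability (g_sigma_algebraType (F T)) R) :=
  [set Q | equivalent_on P Q /\
           \forall x \ae P, (min_penalty P F p rho 0 T Q x < +oo)%E].

Arguments calQ {d Omega R} P T F p rho.

Definition sensitive d (Omega : measurableType d) (R : realType)
    (P : probability Omega R) (T : R) (F : R -> set_system Omega) (p : R)
    (rho : R -> R -> (Omega -> R) -> Omega -> R) : Prop :=
  exists Q : probability (g_sigma_algebraType (F T)) R,
    equivalent_on P Q /\ \forall x \ae P, (min_penalty P F p rho 0 T Q x < +oo)%E.

Definition cnorm d (Omega : measurableType d) (R : realType)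
    (H : set_system Omega) (QQ : set (probability (g_sigma_algebraType H) R))
    (X : Omega -> R) : \bar R :=
  ereal_sup [set (\int[Q]_x (`|X x|)%:E)%E | Q in QQ].

(* The completion L^c_t of the essentially bounded F_t-measurable variables, realized
   inside the F_t-measurable variables as their closure for c; Lc_complete
   below shows that this closure is indeed complete. *)
Definition Lc d (Omega : measurableType d) (R : realType)
    (P : probability Omega R) (H : set_system Omega)
    (QQ : set (probability (g_sigma_algebraType H) R)) (G : set_system Omega) :
    set (Omega -> R) :=
  [set X | rv_measurable G X /\
    exists Xn : nat -> Omega -> R,
      (forall n, rv_measurable G (Xn n) /\
                 exists K : R, \forall x \ae P, `|Xn n x| <= K) /\
      cnorm QQ (X \- Xn n) @[n --> \oo] --> 0%E].

Lemma cnorm_triangle d (Omega : measurableType d) (R : realType)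
    (H : set_system Omega) (QQ : set (probability (g_sigma_algebraType H) R))
    (X Y Z : Omega -> R) :
  rv_measurable H X -> rv_measurable H Y -> rv_measurable H Z ->
  (cnorm QQ (X \- Z)%R <= cnorm QQ (X \- Y)%R + cnorm QQ (Y \- Z)%R)%E.
Proof.
move=> mX mY mZ; apply: ge_ereal_sup => _ [Q QQ_Q <-].
have mabs (U V : Omega -> R) : rv_measurable H U -> rv_measurable H V ->
    @measurable_fun _ _ (g_sigma_algebraType H) _ setT
      (fun x => (`|(U \- V)%R x|)%:E).
  move=> mU mV; apply/measurable_EFinP.
  by apply: (measurableT_comp (@normr_measurable R setT));
     apply: measurable_funB.
apply: (@le_trans _ _
  (\int[Q]_x ((`|(X \- Y)%R x|)%:E + (`|(Y \- Z)%R x|)%:E))%E).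
  apply: ge0_le_integral => //.
  - exact: mabs.
  - by apply: emeasurable_funD; exact: mabs.
  - move=> x _ /=; rewrite -EFinD lee_fin.
    by rewrite (_ : X x - Z x = (X x - Y x) + (Y x - Z x)) ?ler_normD//
               addrA subrK.
rewrite ge0_integralD//; [|exact: mabs|exact: mabs].
by apply: leeD; apply: ereal_sup_ubound; exists Q.
Qed.

Lemma cnorm_sym d (Omega : measurableType d) (R : realType)
    (H : set_system Omega) (QQ : set (probability (g_sigma_algebraType H) R))
    (X Y : Omega -> R) :
  cnorm QQ (X \- Y)%R = cnorm QQ (Y \- X)%R.
Proof.
rewrite /cnorm; congr ereal_sup; apply: eq_imagel => Q _.
by apply: eq_integral => x _ /=; rewrite distrC.
Qed.

Lemma limn_esup_dist (R : realType) (u : nat -> R) (k : nat) :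
  ((`|u k - fine (limn_esup (EFin \o u))|)%:E
   <= \sum_(0 <= i <oo) (`|u (i + k)%N - u (i + k).+1|)%:E)%E.
Proof.
set S := (X in (_ <= X)%E).
have S0 : (0 <= S)%E by apply: nneseries_ge0 => *; rewrite lee_fin.
case: (S =P +oo%E) => [->|/eqP Soo]; first exact: leey.
have Sfin : S \is a fin_num by rewrite ge0_fin_numE// ltey.
have dist n : `|u k - u (n + k)%N| <= fine S.
  rewrite -lee_fin fineK//.
  apply: le_trans (nneseries_lim_ge n _); last by move=> *; rewrite lee_fin.
  rewrite sumEFin lee_fin.
  elim: n => [|n IH]; first by rewrite add0n subrr normr0 big_geq.
  rewrite big_nat_recr//=; apply: le_trans (lerD IH (lexx _)).
  rewrite (_ : u k - u (n.+1 + k)%N =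
    (u k - u (n + k)%N) + (u (n + k)%N - u (n + k).+1)) ?ler_normD//.
  by rewrite addrA subrK.
have bnd m : (k <= m)%N -> u k - fine S <= u m <= u k + fine S.
  by move=> km; have := dist (m - k)%N; rewrite subnK// distrC ler_distl.
set L := limn_esup _.
have Lle : (L <= (u k + fine S)%:E)%E.
  apply: (@le_trans _ _ (ereal_sup ((EFin \o u) @` [set m | (k <= m)%N]))).
    apply: ereal_inf_lbound; exists [set m | (k <= m)%N] => //.
    by exists k.
  by apply: ge_ereal_sup => _ [m /= km <-]; rewrite lee_fin; case/andP: (bnd m km).
have leL : ((u k - fine S)%:E <= L)%E.
  apply: le_ereal_inf_tmp => _ [V [N _ NV] <-].
  apply: (@le_trans _ _ (u (maxn N k))%:E).
    by rewrite lee_fin; case/andP: (bnd (maxn N k) (leq_maxr _ _)).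
  by apply: ereal_sup_ubound; exists (maxn N k) => //; apply: NV; rewrite /= leq_maxl.
have Lfin : L \is a fin_num.
  by rewrite fin_numElt (lt_le_trans _ leL) ?ltNyr// (le_lt_trans Lle) ?ltry.
rewrite -(fineK Sfin) lee_fin distrC ler_distl -!lee_fin fineK//.
by rewrite leL Lle.
Qed.

Lemma cvge0_le (R : realType) (u : nat -> \bar R) :
  (forall e : R, 0 < e -> \forall n \near \oo, (0 <= u n <= e%:E)%E) ->
  u n @[n --> \oo] --> 0%E.
Proof.
move=> H; apply/fine_cvgP; split.
  have := H 1 ltr01; apply: filterS => n /andP[u0 u1].
  by rewrite ge0_fin_numE// (le_lt_trans u1) ?ltry.
apply/cvgrPdist_le => e e0; have := H e e0; apply: filterS => n /andP[u0 ue].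
have ufin : u n \is a fin_num by rewrite ge0_fin_numE// (le_lt_trans ue) ?ltry.
by rewrite sub0r normrN ger0_norm ?fine_ge0//= -lee_fin fineK.
Qed.

Lemma Lc_complete d (Omega : measurableType d) (R : realType)
    (P : probability Omega R) (H : set_system Omega)
    (QQ : set (probability (g_sigma_algebraType H) R)) (G : set_system Omega)
    (X : nat -> Omega -> R) :
  QQ !=set0 -> G `<=` H -> (forall n, Lc P QQ G (X n)) ->
  (forall e : R, 0 < e -> exists N, forall m n, (N <= m)%N -> (N <= n)%N ->
     (cnorm QQ (X m \- X n)%R <= e%:E)%E) ->
  exists2 Y, Lc P QQ G Y & cnorm QQ (X n \- Y)%R @[n --> \oo] --> 0%E.
Proof.
move=> [Q0 QQ0] GH XLc Xcauchy.
have c_ge0 Z : (0 <= cnorm QQ Z)%E.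
  apply: (@le_trans _ _ (\int[Q0]_x (`|Z x|)%:E)%E).
    by apply: integral_ge0 => *; rewrite lee_fin.
  by apply: ereal_sup_ubound; exists Q0.
have mGH Z : rv_measurable G Z -> rv_measurable H Z.
  move=> mZ _ B mB; have := mZ measurableT B mB.
  by apply: sub_sigma_algebra2.
have mX n : rv_measurable G (X n) by have [] := XLc n.
have rto0 (e : R) : 0 < e -> exists k, forall n, (k <= n)%N -> 1 / 2 ^+ n <= e.
  move=> e0; have [k _ kP] := near_infty_natSinv_expn_lt (PosNum e0).
  by exists k => n kn; apply/ltW/(kP n).
pose r (k : nat) : R := 1 / (2 ^ k.+1)%:R.
have r0 k : 0 < r k by rewrite divr_gt0// ltr0n expn_gt0.
have [N NP] := choice (fun k => Xcauchy (r k) (r0 k)).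
pose M k := (\sum_(j < k.+1) N j)%N.
have NM k : (N k <= M k)%N by rewrite /M big_ord_recr/= leq_addl.
have MS k : (M k <= M k.+1)%N by rewrite {2}/M big_ord_recr/= leq_addr.
pose Z k := X (M k).
have cZ j : (cnorm QQ (Z j \- Z j.+1)%R <= (r j)%:E)%E.
  by apply: NP; [exact: NM|exact: leq_trans (NM j) (MS j)].
pose Y x := fine (limn_esup (fun n => (Z n x)%:E)).
have mY : rv_measurable G Y.
  suff: @measurable_fun _ _ (g_sigma_algebraType G) (\bar R) setT
      (fun x => limn_esup (fun n => (Z n x)%:E)).
    by apply: measurableT_comp; exact: fine_measurable.
  apply: (@measurable_fun_limn_esup _ (g_sigma_algebraType G) R setT
    (fun n x => (Z n x)%:E)) => n.
  by apply/measurable_EFinP; exact: mX.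
have mabs (U V : Omega -> R) : rv_measurable G U -> rv_measurable G V ->
    @measurable_fun _ _ (g_sigma_algebraType H) _ setT
      (fun x => (`|(U \- V)%R x|)%:E).
  move=> mU mV; apply/measurable_EFinP.
  by apply: (measurableT_comp (@normr_measurable R setT));
     apply: measurable_funB; exact: mGH.
have cZY k : (cnorm QQ (Z k \- Y)%R <= (1 / 2 ^+ k)%:E)%E.
  apply: ge_ereal_sup => _ [Q QQ_Q <-].
  apply: (@le_trans _ _ (\int[Q]_x
    \sum_(0 <= i <oo) (`|(Z (i + k)%N \- Z (i + k).+1)%R x|)%:E)%E).
    apply: ge0_le_integral => //.
    - by apply: mabs => //; exact: mX.
    - by apply: ge0_emeasurable_sum => // n _; apply: mabs; exact: mX.
    - by move=> x _; exact: (limn_esup_dist (fun n => Z n x) k).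
  rewrite integral_nneseries//; last by move=> n; apply: mabs; exact: mX.
  rewrite -(cvg_lim _ (@cvg_geometric_eseries_half R 1 k))//.
  apply: lee_nneseries => [i _ _|i _].
    by apply: integral_ge0 => *; rewrite lee_fin.
  rewrite addnS; apply: le_trans (cZ (i + k)%N).
  by apply: ereal_sup_ubound; exists Q.
have tri (U V W : Omega -> R) : rv_measurable G U -> rv_measurable G V -> rv_measurable G W ->
    (cnorm QQ (U \- W)%R <= cnorm QQ (U \- V)%R + cnorm QQ (V \- W)%R)%E.
  by move=> mU mV mW; apply: cnorm_triangle; exact: mGH.
have half2 (e : R) : e = e / 2 + e / 2 by rewrite -splitr.
have XY : cnorm QQ (X n \- Y)%R @[n --> \oo] --> 0%E.
  apply: cvge0_le => e e0.
  have [k kP] := rto0 (e / 2) (divr_gt0 e0 (ltr0Sn R 1)).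
  exists (M k) => // n /= Mn; rewrite c_ge0/=.
  apply: le_trans (tri _ (Z k) _ _ _ _) _ => //; first exact: mX.
  rewrite (half2 e) EFinD; apply: leeD; last first.
    by apply: le_trans (cZY k) _; rewrite lee_fin kP.
  have /le_trans := NP k n (M k) (leq_trans (NM k) Mn) (NM k); apply.
  rewrite lee_fin; apply: le_trans (kP k.+1 _) => //.
  by rewrite /r natrX.
exists Y => //; split => //.
have /choice[B BP] : forall k, exists b : Omega -> R,
    [/\ rv_measurable G b, (exists K : R, \forall x \ae P, `|b x| <= K) &
        (cnorm QQ (Z k \- b)%R <= (r k)%:E)%E].
  move=> k.
  have [_ [W [WP /fine_cvgP[Wfin /cvgrPdist_le/(_ _ (r0 k)) Wc]]]] := XLc (M k).
  have [n [nfin nc]] : exists n,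
      cnorm QQ (X (M k) \- W n)%R \is a fin_num /\
      `|0 - fine (cnorm QQ (X (M k) \- W n)%R)| <= r k.
    have [n _ nP] : \forall n \near \oo,
      cnorm QQ (X (M k) \- W n)%R \is a fin_num /\
      `|0 - fine (cnorm QQ (X (M k) \- W n)%R)| <= r k.
      by near=> n; split; near: n.
    by exists n; exact: (nP n (leqnn n)).
  have [mW bW] := WP n; exists (W n); split => //.
  by rewrite -(fineK nfin) lee_fin; apply: le_trans nc; rewrite sub0r normrN ler_norm.
exists B; split; first by move=> n; have [] := BP n.
apply: cvge0_le => e e0.
have [k kP] := rto0 (e / 2) (divr_gt0 e0 (ltr0Sn R 1)).
exists k => // n /= kn; rewrite c_ge0/=.
have [mB _ cB] := BP n.
apply: le_trans (tri _ (Z n) _ _ _ _) _ => //; first exact: mX.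
rewrite (half2 e) EFinD; apply: leeD.
  by rewrite cnorm_sym; apply: le_trans (cZY n) _; rewrite lee_fin kP.
apply: le_trans cB _; rewrite lee_fin; apply: le_trans (kP n.+1 _).
  by rewrite /r natrX.
exact: leq_trans kn _.
Unshelve. all: by end_near.
Qed.

Definition calPtilde d (Omega : measurableType d) (R : realType)
    (P : probability Omega R) (T : R) (F : R -> set_system Omega) (p : R)
    (rho : R -> R -> (Omega -> R) -> Omega -> R) (s t : R) :
    set (probability (g_sigma_algebraType (F t)) R) :=
  [set S | [/\ equivalent_on P S,
     (forall A, F s A -> S A = P A) &
     (ereal_sup [set (\int[Q]_x min_penalty P F p rho s t S x)%E
                  | Q in calQ P T F p rho] < +oo)%E]].

Arguments calPtilde {d Omega R} P T F p rho s t.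

Definition Lc_extension d (Omega : measurableType d) (R : realType)
    (P : probability Omega R) (T : R) (F : R -> set_system Omega) (p : R)
    (rho : R -> R -> (Omega -> R) -> Omega -> R) (s t : R)
    (rt : (Omega -> R) -> Omega -> R) : Prop :=
  let QQ := calQ P T F p rho in
  [/\ (forall X, Lc P QQ (F t) X -> Lc P QQ (F s) (rt X)),
      (forall X, Lp_space P p (F t) X ->
         \forall x \ae P, rt X x = rho s t X x) &
      (forall X Y, Lc P QQ (F t) X -> Lc P QQ (F t) Y ->
         (cnorm QQ (rt X \- rt Y)%R <= cnorm QQ (X \- Y)%R)%E)].

(* Main.v *)
Require Import Defs.
From HB Require Import structures.
From mathcomp Require Import finmap.
From mathcomp Require Import all_boot all_order all_algebra.
From mathcomp Require Import all_classical all_reals all_analysis.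
From mathcomp Require Import measurable_realfun ring lra.
Import numFieldNormedType.Exports.
Import Order.TTheory GRing.Theory Num.Theory.
Local Open Scope classical_set_scope.
Local Open Scope ring_scope.

Set Implicit Arguments.
Unset Strict Implicit.
Unset Printing Implicit Defensive.

(* The heart of the proof is the estimate
     E_Q rho_st(Y - l E) <= C + l c(E)   for all l >= 0 and E >= 0,
   with C depending only on Q in calQ and on Y. As convexity gives
   l (rho_st(Y - E) - rho_st Y) <= rho_st(Y - l E) - rho_st Y for l >= 1,
   letting l -> oo shows that rho_st is a contraction for c, and it extends by
   completeness. In the same way l E_S(Z | F_s) <= rho_st(- l Z) + alpha_st(S)
   gives E_Q E_S(Z | F_s) <= c(Z) for Z >= 0 and S in calPtilde, so that the
   bound E_S(-X | F_s) - alpha_st(S) <= rho_st X passes to the extension.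

   The estimate rests on nearly optimal measures equivalent to P. A subgradient
   of E_P rho_st at X (Hahn-Banach) is integration against a measure R0 that
   agrees with P on F_s (Daniell-Riesz, continuity on L_p being automatic for
   monotone functionals). By locality R0 attains the conditional representation
   at X, and mixing it with a small F_s-measurable amount of some Q in calQ makes
   it equivalent to P. Near optimal measures at bounded approximations of X lie
   in calPtilde, whence the essential supremum is not smaller than the extension. *)

(** * Subgradients of convex functions *)

(** The estimate starts at s = 0, t = T: E_P rho_0T is bounded above through a measure S nearly
    optimal for rho_0T. Such an S has bounded penalty, so it belongs to [calQ], and c is a supremum
    over exactly these measures. Time consistency carries the bound to rho_st at the price of the
    costs rho_sT 0 and rho_tT 0, which are not assumed to vanish. Domination enters through c(Z) <=
    rhobar(-|Z|): it makes c finite on L_p and small on truncation errors, whence L_p lies in L^c.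
    Two obstacles shape the representation. A subgradient need not be equivalent to P, hence the
    mixing; and the Q mixed in needs a finite conditional penalty given F_s, which its finite
    penalty at time 0 yields only through time consistency. Moreover, E_Q E_S(Z | F_s) <= c(Z) is
    available only once S is known to lie in [calPtilde], so it cannot serve to prove this
    membership; approximating by a bounded position breaks the circle. *)

Section hahn_banach.
Context {R : realType} {V : lmodType R}.
(** The subspace is a predicate on an ambient module, so that functionals on L_p are plain maps on
    [Omega -> R]. *)
Variable D : set V.
Hypotheses (D0 : D 0) (DD : forall x y, D x -> D y -> D (x + y))
  (DZ : forall (a : R) x, D x -> D (a *: x)).

Let DN x : D x -> D (- x). Proof. by rewrite -scaleN1r; exact: DZ. Qed.

Definition sublinear_on (q : V -> R) : Prop :=
  (forall x y, D x -> D y -> q (x + y) <= q x + q y) /\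
  (forall a x, 0 <= a -> D x -> q (a *: x) = a * q x).

Let sub0 q : sublinear_on q -> q 0 = 0.
Proof. by move=> [_ qZ]; rewrite -(scale0r 0) qZ// mul0r. Qed.

Let subN q x : sublinear_on q -> D x -> - q (- x) <= q x.
Proof.
move=> sq Dx; have [qD _] := sq.
by rewrite lerNl -subr_ge0 opprK addrC -(sub0 sq) -(subrr x) qD//; exact: DN.
Qed.

Lemma odd_sublinear_linear q : sublinear_on q ->
  (forall x, D x -> q (- x) <= - q x) ->
  (forall x y, D x -> D y -> q (x + y) = q x + q y) /\
  (forall a x, D x -> q (a *: x) = a * q x).
Proof.
move=> sq qN; have [qD qZ] := sq.
have qNE x : D x -> q (- x) = - q x.
  move=> Dx; apply/eqP; rewrite eq_le qN//=.
  by rewrite lerNl; exact: subN.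
split=> [x y Dx Dy|a x Dx].
  apply/eqP; rewrite eq_le qD//= -(opprK (x + y)) (qNE _ (DN (DD Dx Dy))).
  by rewrite lerNr !opprD -!qNE//; apply: qD; exact: DN.
have [a0|a0] := leP 0 a; first exact: qZ.
rewrite -(opprK a) scaleNr qNE; last by apply: DZ.
by rewrite qZ// ?mulNr// oppr_ge0 ltW.
Qed.

(* For q minimal, [q' x = inf_(t >= 0) (q (x + t x0) - t q x0)] is again
   sublinear and below q, and evaluating it at [- x0] shows that q is odd. *)
Lemma sublinear_lower_linear (p : V -> R) : sublinear_on p ->
  exists l : V -> R,
  [/\ forall x, D x -> l x <= p x,
      forall x y, D x -> D y -> l (x + y) = l x + l y &
      forall a x, D x -> l (a *: x) = a * l x].
Proof.
move=> sp.
(* Candidates vanish off D: the order compares values on D only, while antisymmetry asks for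
   equality as functions. *)
pose good (q : V -> R) := [/\ sublinear_on q, forall x, D x -> q x <= p x
  & forall x, ~ D x -> q x = 0].
pose W := {q | good q}.
(* The order is reversed, so that a maximal element for Zorn is a minimal sublinear functional. *)
pose rel (q1 q2 : W) := `[< forall x, D x -> sval q2 x <= sval q1 x >].
pose norm (q : V -> R) x := if `[< D x >] then q x else 0.
have normE q x : D x -> norm q x = q x by move=> Dx; rewrite /norm asboolT.
have good_norm q : sublinear_on q -> (forall x, D x -> q x <= p x) -> good (norm q).
  move=> [qD qZ] qp; split.
  - split=> [x y Dx Dy|a x a0 Dx]; rewrite !normE//; [exact: qD|exact: DD|
      exact: qZ|exact: DZ].
  - by move=> x Dx; rewrite normE// qp.
  - by move=> x Dx; rewrite /norm asboolF.
(* This common lower bound keeps the infima over chains finite. *)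
have lbq q x : good q -> D x -> - p (- x) <= q x.
  move=> [sq qp _] Dx; apply: le_trans (subN sq Dx).
  by rewrite lerN2; apply: qp; exact: DN.
have [q qmin] : exists t, forall s, rel t s -> s = t.
  apply: Zorn.
  - by move=> q; apply/asboolP => x.
  - move=> q2 q1 q3 /asboolP h1 /asboolP h2; apply/asboolP => x Dx.
    exact: le_trans (h2 x Dx) (h1 x Dx).
  - move=> [q1 g1] [q2 g2] /asboolP /= h1 /asboolP /= h2.
    have E : q1 = q2.
      apply/funext => x; have [Dx|nDx] := pselect (D x).
        by apply/eqP; rewrite eq_le h1// h2.
      by case: g1 => _ _ ->//; case: g2 => _ _ ->.
    by subst q2; congr exist; exact: Prop_irrelevance.
  - move=> A totA; have [->|/set0P[a Aa]] := eqVneq A set0.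
      by exists (exist _ _ (good_norm p sp (fun x _ => lexx _))) => ? [].
    pose I x := [set sval q x | q in A].
    have Ine x : I x !=set0 by exists (sval a x); exists a.
    have Ilb x : D x -> has_lbound (I x).
      by move=> Dx; exists (- p (- x)) => _ [b Ab <-]; apply: lbq => //; exact: (svalP b).
    have infle x b : D x -> A b -> inf (I x) <= sval b x.
      by move=> Dx Ab; apply: ge_inf; [exact: Ilb|exists b].
    have sI : sublinear_on (fun x => inf (I x)).
      split=> [x y Dx Dy|c x c0 Dx].
        suff H b1 b2 : A b1 -> A b2 -> inf (I (x + y)) <= sval b1 x + sval b2 y.
          rewrite -lerBlDr; apply: lb_le_inf => // _ [b1 Ab1 <-].
          rewrite lerBlDr -lerBlDl; apply: lb_le_inf => // _ [b2 Ab2 <-].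
          by rewrite lerBlDl H.
        (* Two members of a chain are comparable, and the subadditivity of the smaller one gives
           that of the infimum. *)
        move=> Ab1 Ab2; have [/asboolP h|/asboolP h] := totA b1 b2 Ab1 Ab2.
          have [[qD _] _ _] := svalP b2.
          apply: le_trans (infle _ b2 (DD Dx Dy) Ab2) _.
          by apply: le_trans (qD _ _ Dx Dy) _; rewrite lerD2r h.
        have [[qD _] _ _] := svalP b1.
        apply: le_trans (infle _ b1 (DD Dx Dy) Ab1) _.
        by apply: le_trans (qD _ _ Dx Dy) _; rewrite lerD2l h.
      have := c0; rewrite le_eqVlt => /predU1P[<-|cp].
        rewrite scale0r mul0r.
        rewrite (_ : I 0 = [set 0]) ?inf1//; apply/seteqP; split => [_ [b Ab <-]|_ ->].
          by have [sb _ _] := svalP b; rewrite (sub0 sb).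
        by exists a => //; have [sb _ _] := svalP a; rewrite (sub0 sb).
      apply/eqP; rewrite eq_le; apply/andP; split.
        rewrite mulrC -ler_pdivrMr//; apply: lb_le_inf => // _ [b Ab <-].
        rewrite ler_pdivrMr// mulrC; have [[_ qZ] _ _] := svalP b.
        by rewrite -qZ//; apply: infle => //; exact: DZ.
      apply: lb_le_inf => // _ [b Ab <-]; have [[_ qZ] _ _] := svalP b.
      by rewrite qZ// ler_pM2l//; exact: infle.
    have Ip x : D x -> inf (I x) <= p x.
      move=> Dx; apply: le_trans (infle _ a Dx Aa) _.
      by have [_ + _] := svalP a; exact.
    exists (exist _ _ (good_norm _ sI Ip)) => b Ab; apply/asboolP => x Dx /=.
    by rewrite normE//; exact: infle.
have [sq qp _] := svalP q; have [qD qZ] := sq.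
have [] := odd_sublinear_linear sq; last first.
  by move=> qa qs; exists (sval q).
move=> x0 Dx0.
pose J x := [set sval q (x + t *: x0) - t * sval q x0 | t in [set t : R | 0 <= t]].
have Jne x : J x !=set0 by exists (sval q (x + 0 *: x0) - 0 * sval q x0); exists 0 => /=.
have Jlb x : D x -> has_lbound (J x).
  move=> Dx; exists (- sval q (- x)) => _ [t /= t0 <-].
  rewrite lerBrDr addrC lerBlDl -qZ//.
  have {1}-> : t *: x0 = - x + (x + t *: x0) by rewrite addKr.
  by apply: qD; [exact: DN|apply: DD => //; exact: DZ].
have infle x t : D x -> 0 <= t -> inf (J x) <= sval q (x + t *: x0) - t * sval q x0.
  by move=> Dx t0; apply: ge_inf; [exact: Jlb|exists t].
have infq x : D x -> inf (J x) <= sval q x.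
  by move=> Dx; have := infle x 0 Dx (lexx _); rewrite scale0r mul0r subr0 addr0.
have sJ : sublinear_on (fun x => inf (J x)).
  split=> [x y Dx Dy|c x c0 Dx].
    suff H s t : 0 <= s -> 0 <= t -> inf (J (x + y)) <=
        (sval q (x + s *: x0) - s * sval q x0) + (sval q (y + t *: x0) - t * sval q x0).
      rewrite -lerBlDr; apply: lb_le_inf => // _ [s s0 <-].
      rewrite lerBlDr -lerBlDl; apply: lb_le_inf => // _ [t t0 <-].
      by rewrite lerBlDl H.
    move=> s0 t0; apply: le_trans (infle _ (s + t) (DD Dx Dy) (addr_ge0 s0 t0)) _.
    rewrite addrACA -opprD -mulrDl lerD2r scalerDl addrACA.
    by apply: qD; apply: DD => //; exact: DZ.
  have := c0; rewrite le_eqVlt => /predU1P[<-|cp].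
    rewrite scale0r mul0r (_ : J 0 = [set 0]) ?inf1//.
    apply/seteqP; split => [_ [t /= t0 <-]|_ ->].
      by rewrite add0r qZ// subrr.
    by exists 0 => //=; rewrite scale0r mul0r addr0 subr0 (sub0 sq).
  apply/eqP; rewrite eq_le; apply/andP; split.
    rewrite mulrC -ler_pdivrMr//; apply: lb_le_inf => // _ [t /= t0 <-].
    rewrite ler_pdivrMr// mulrC.
    apply: le_trans (infle (c *: x) (c * t) (DZ c Dx) (mulr_ge0 c0 t0)) _.
    rewrite -scalerA -scalerDr qZ//; last by apply: DD => //; exact: DZ.
    by rewrite mulrBr mulrA.
  apply: lb_le_inf => // _ [t /= t0 <-].
  rewrite mulrC -ler_pdivlMr//.
  apply: le_trans (infle x (t / c) Dx _) _; first by rewrite divr_ge0.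
  rewrite ler_pdivlMr// mulrC mulrBr -(qZ c)//; last by apply: DD => //; exact: DZ.
  have ct : c * (t / c) = t by rewrite mulrCA mulfV ?gt_eqF// mulr1.
  by rewrite scalerDr scalerA ct mulrA ct.
have Jp x : D x -> inf (J x) <= p x by move=> Dx; exact: le_trans (infq _ Dx) (qp _ Dx).
have gJ := good_norm _ sJ Jp.
have := qmin (exist _ _ gJ) _.
move=> E; have {}E : norm (fun x => inf (J x)) = sval q.
  have /= <- // := congr1 sval (E _).
  by apply/asboolP => x Dx /=; rewrite normE// infq.
rewrite -{1}E normE; last exact: DN.
have := infle (- x0) 1 (DN Dx0) ler01.
by rewrite scale1r addNr (sub0 sq) mul1r sub0r.
Qed.

(** The directional derivative of psi at X, the infimum of the difference quotients over h > 0, is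
    sublinear; any linear functional below it is a subgradient. *)
Lemma convex_subgradient (psi : V -> R) (X : V) : D X ->
  (forall x y (l : R), D x -> D y -> 0 <= l <= 1 ->
    psi (l *: x + (1 - l) *: y) <= l * psi x + (1 - l) * psi y) ->
  exists l : V -> R,
  [/\ forall x, D x -> l x <= psi (X + x) - psi X,
      forall x y, D x -> D y -> l (x + y) = l x + l y &
      forall a x, D x -> l (a *: x) = a * l x].
Proof.
move=> DX psiC; pose q h x := (psi (X + h *: x) - psi X) / h.
have DXh h x : D x -> D (X + h *: x) by move=> Dx; apply: DD => //; exact: DZ.
pose I x := [set q h x | h in [set h : R | 0 < h]].
have Ine x : I x !=set0 by exists (q 1 x); exists 1 => //=; exact: ltr01.
(* With h = h1 h2 / (h1 + h2), the point X + h (x + y) is the convex combination of X + h1 x and X +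
   h2 y with weights h2 / (h1 + h2) and h1 / (h1 + h2). *)
have conv h1 h2 x y : 0 < h1 -> 0 < h2 -> D x -> D y ->
    q (h1 * h2 / (h1 + h2)) (x + y) <= q h1 x + q h2 y.
  move=> h10 h20 Dx Dy; have s0 : 0 < h1 + h2 by exact: addr_gt0.
  have l01 : 0 <= h2 / (h1 + h2) <= 1.
    apply/andP; split; first by apply: divr_ge0; exact: ltW.
    by rewrite ler_pdivrMr// mul1r lerDr ltW.
  have := psiC _ _ _ (DXh h1 x Dx) (DXh h2 y Dy) l01.
  have -> : 1 - h2 / (h1 + h2) = h1 / (h1 + h2) by field; rewrite gt_eqF.
  have -> : h2 / (h1 + h2) *: (X + h1 *: x) + h1 / (h1 + h2) *: (X + h2 *: y)
      = X + (h1 * h2 / (h1 + h2)) *: (x + y).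
    rewrite !scalerDr !scalerA addrACA -scalerDl.
    have -> : h2 / (h1 + h2) + h1 / (h1 + h2) = 1 by field; rewrite gt_eqF.
    rewrite scale1r; congr (_ + (_ *: _ + _ *: _)); field; by rewrite gt_eqF.
  move=> H; rewrite /q ler_pdivrMr ?divr_gt0 ?mulr_gt0//.
  rewrite lerBlDr; apply: le_trans H _.
  rewrite le_eqVlt; apply/orP; left; apply/eqP; field.
  by rewrite !gt_eqF.
(* The case y = - x, h2 = 1 of [conv] bounds the difference quotients from below. *)
have lb x h : 0 < h -> D x -> psi X - psi (X - x) <= q h x.
  move=> h0 Dx; have := conv h 1 x (- x) h0 ltr01 Dx (DN Dx).
  rewrite subrr {1}/q scaler0 addr0 subrr mul0r /q scale1r divr1.
  by rewrite -lerBlDr sub0r opprB.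
have Ilb x : D x -> has_lbound (I x).
  by move=> Dx; exists (psi X - psi (X - x)) => _ [h /= h0 <-]; exact: lb.
have infle x h : D x -> 0 < h -> inf (I x) <= q h x.
  by move=> Dx h0; apply: ge_inf; [exact: Ilb|exists h].
have sI : sublinear_on (fun x => inf (I x)).
  split=> [x y Dx Dy|c x c0 Dx].
    suff H h1 h2 : 0 < h1 -> 0 < h2 -> inf (I (x + y)) <= q h1 x + q h2 y.
      rewrite -lerBlDr; apply: lb_le_inf => // _ [s s0 <-].
      rewrite lerBlDr -lerBlDl; apply: lb_le_inf => // _ [t t0 <-].
      by rewrite lerBlDl H.
    move=> h10 h20; apply: le_trans (conv _ _ _ _ h10 h20 Dx Dy).
    by apply: infle; [exact: DD|rewrite divr_gt0 ?mulr_gt0 ?addr_gt0].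
  have := c0; rewrite le_eqVlt => /predU1P[<-|cp].
    rewrite scale0r mul0r (_ : I 0 = [set 0]) ?inf1//.
    apply/seteqP; split => [_ [h /= h0 <-]|_ ->].
      by rewrite /q scaler0 addr0 subrr mul0r.
    by exists 1; rewrite /= ?ltr01// /q scaler0 addr0 subrr mul0r.
  have qE h : 0 < h -> q h (c *: x) = c * q (c * h) x.
    by move=> h0; rewrite /q scalerA (mulrC h c); field; rewrite !gt_eqF.
  apply/eqP; rewrite eq_le; apply/andP; split.
    rewrite mulrC -ler_pdivrMr//; apply: lb_le_inf => // _ [h /= h0 <-].
    rewrite ler_pdivrMr// mulrC.
    have := infle (c *: x) (h / c) (DZ c Dx) (divr_gt0 h0 cp).
    by rewrite qE ?divr_gt0// (_ : c * (h / c) = h)//; field; rewrite gt_eqF.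
  apply: lb_le_inf => // _ [h /= h0 <-].
  by rewrite qE// ler_pM2l//; apply: infle => //; rewrite mulr_gt0.
have [l [lp lD lZ]] := sublinear_lower_linear sI.
exists l; split => // x Dx; apply: le_trans (lp x Dx) _.
by apply: le_trans (infle x 1 Dx ltr01) _; rewrite /q scale1r divr1.
Qed.

End hahn_banach.

(** * Densities *)

Section densities.
Context {d} {T : measurableType d} {R : realType}.
Local Open Scope ereal_scope.

Lemma ex_density_measure (mu : {measure set T -> \bar R}) (f : T -> \bar R) :
  measurable_fun setT f -> (forall x, 0 <= f x) ->
  exists nu : {measure set T -> \bar R}, forall A, nu A = \int[mu]_(x in A) f x.
Proof.
move=> mf f0; pose nu A := \int[mu]_(x in A) f x.
have nu0 : nu set0 = 0 by rewrite /nu integral_set0.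
have nu_ge0 A : 0 <= nu A by exact: integral_ge0.
have nuS : semi_sigma_additive nu.
  move=> A mA tA mUA; rewrite [X in _ --> X]/nu ge0_integral_bigcup//.
    by apply: is_cvg_nneseries => n _ _; exact: integral_ge0.
  exact: measurable_funTS.
pose nuM := isMeasure.Build _ _ _ nu nu0 nu_ge0 nuS.
by exists (HB.pack_for {measure set T -> \bar R} nu nuM).
Qed.

Lemma ex_finite_measure (mu : {measure set T -> \bar R}) : mu setT < +oo ->
  exists nu : {finite_measure set T -> \bar R}, forall A, nu A = mu A.
Proof.
move=> moo; have mfin : fin_num_fun mu by exact: lty_fin_num_fun.
have mu0 : mu set0 < +oo by rewrite measure0.
pose H1 := isFinite.Build _ _ _ (Measure.sort mu) mfin.
have msf := fin_num_fun_sigma_finite mu0 mfin.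
pose H2 := isSFinite.Build _ _ _ (Measure.sort mu) (sfinite_measure_sigma_finite msf).
pose H3 := isSigmaFinite.Build _ _ _ (Measure.sort mu) msf.
by exists (HB.pack_for {finite_measure set T -> \bar R} (Measure.sort mu) H1 H2 H3).
Qed.

Lemma ex_probability (nu : {measure set T -> \bar R}) : nu setT = 1 ->
  exists P : probability T R, forall A, P A = nu A.
Proof.
move=> nu1; have [nu' nuE] := @ex_finite_measure nu (eq_ind_r (fun x => x < +oo) (ltry _) nu1).
have nu'1 : nu' setT = 1 by rewrite nuE.
pose H1 := isSubProbability.Build _ _ _ (FiniteMeasure.sort nu') (eq_ind_r (fun x => x <= 1) (lexx _) nu'1).
pose H2 := isProbability.Build _ _ _ (FiniteMeasure.sort nu') nu'1.
by exists (HB.pack_for (probability T R) (FiniteMeasure.sort nu') H1 H2).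
Qed.

Lemma aeS (mu : {measure set T -> \bar R}) (A B : T -> Prop) :
  (\forall x \ae mu, A x) -> (forall x, A x -> B x) -> \forall x \ae mu, B x.
Proof. by move=> + AB; apply: filterS. Qed.

Lemma aeS2 (mu : {measure set T -> \bar R}) (A B C : T -> Prop) :
  (\forall x \ae mu, A x) -> (\forall x \ae mu, B x) ->
  (forall x, A x -> B x -> C x) -> \forall x \ae mu, C x.
Proof. by move=> + + ABC; apply: filterS2. Qed.

Lemma aeS3 (mu : {measure set T -> \bar R}) (A B C D : T -> Prop) :
  (\forall x \ae mu, A x) -> (\forall x \ae mu, B x) -> (\forall x \ae mu, C x) ->
  (forall x, A x -> B x -> C x -> D x) -> \forall x \ae mu, D x.
Proof. by move=> + + + ABCD; apply: filterS3. Qed.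

Lemma aeS4 (mu : {measure set T -> \bar R}) (A B C D E : T -> Prop) :
  (\forall x \ae mu, A x) -> (\forall x \ae mu, B x) -> (\forall x \ae mu, C x) ->
  (\forall x \ae mu, D x) ->
  (forall x, A x -> B x -> C x -> D x -> E x) -> \forall x \ae mu, E x.
Proof.
move=> a b c e ABCDE; have bc := aeS2 a b (fun x => @conj _ _).
by apply: (aeS3 bc c e) => x [? ?]; exact: ABCDE.
Qed.

Lemma integral_probability_cst (P : probability T R) (c : \bar R) :
  \int[P]_x c = c.
Proof.
rewrite integral_cst//; transitivity (c * 1); last by rewrite mule1.
by congr (_ * _); exact: probability_setT.
Qed.

(** By uniqueness f is a.e. the Radon-Nikodym derivative of nu, for which the change of variables is
    known. *)
Lemma integral_density (mu nu : {measure set T -> \bar R}) (f h : T -> \bar R) :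
  mu setT < +oo -> nu setT < +oo ->
  measurable_fun setT f -> (forall x, 0 <= f x) ->
  (forall A, measurable A -> nu A = \int[mu]_(x in A) f x) ->
  measurable_fun setT h -> (forall x, 0 <= h x) ->
  \int[nu]_x h x = \int[mu]_x (h x * f x).
Proof.
move=> muoo nuoo mf f0 nuf mh h0.
have [mu' muE] := ex_finite_measure muoo; have [nu' nuE] := ex_finite_measure nuoo.
have numu : nu' `<< mu'.
  apply/null_content_dominatesP => A mA A0.
  have {}A0 : mu A = 0 by rewrite -muE.
  transitivity (nu A); first exact: nuE.
  rewrite nuf//.
  have -> : \int[mu]_(x in A) f x = \int[mu]_(x in A) `|f x|.
    by apply: eq_integral => x _; rewrite gee0_abs.
  by rewrite integral_abs_eq0//; exact: measurable_funTS.
have mrn : measurable_fun setT (Radon_Nikodym_SigmaFinite.f nu' mu').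
  exact: measurable_int (Radon_Nikodym_SigmaFinite.f_integrable numu).
transitivity (\int[nu']_x h x).
  by apply: eq_measure_integral => A mA _; apply/esym; exact: nuE.
rewrite -(Radon_Nikodym_SigmaFinite.change_of_variables numu)//.
transitivity (\int[mu']_x (h x * f x)); last first.
  by apply: eq_measure_integral => A mA _; exact: muE.
apply: ge0_ae_eq_integral => //.
- exact: emeasurable_funM.
- exact: emeasurable_funM.
- by move=> x _; rewrite mule_ge0//; exact: Radon_Nikodym_SigmaFinite.f_ge0.
- by move=> x _; rewrite mule_ge0.
apply: ae_eqe_mul2l.
apply: integral_ae_eq => //; first exact: Radon_Nikodym_SigmaFinite.f_integrable.
move=> A _ mA; rewrite -Radon_Nikodym_SigmaFinite.f_integral//.
transitivity (nu A); first exact: nuE.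
by rewrite nuf//; apply: eq_measure_integral => B mB _; apply/esym; exact: muE.
Qed.

Lemma ex_radon_nikodym (mu nu : {measure set T -> \bar R}) :
  mu setT < +oo -> nu setT < +oo ->
  (forall A, measurable A -> mu A = 0 -> nu A = 0) ->
  exists f : T -> R, [/\ measurable_fun setT f, (forall x, 0 <= f x)%R &
    forall A, measurable A -> nu A = \int[mu]_(x in A) (f x)%:E].
Proof.
move=> muoo nuoo dom.
have [mu' muE] := ex_finite_measure muoo; have [nu' nuE] := ex_finite_measure nuoo.
have numu : nu' `<< mu'.
  apply/null_content_dominatesP => A mA A0; transitivity (nu A); first exact: nuE.
  by apply: dom => //; rewrite -muE.
have [g [g0 gfin ig gE]] := radon_nikodym_sigma_finite numu.
exists (fine \o g); split.
- by apply: measurableT_comp => //; exact: measurable_int ig.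
- by move=> x; rewrite fine_ge0.
- move=> A mA; rewrite -nuE; transitivity (nu' A) => //.
  rewrite gE//; transitivity (\int[mu']_(x in A) (fine (g x))%:E).
    by apply: eq_integral => x _ /=; rewrite fineK.
  by apply: eq_measure_integral => B mB _; exact: muE.
Qed.

(** Subtracting integrals requires that of g to be finite, so the set where g < f is cut into the
    pieces [A n] on which g <= n; f - g is positive there with zero integral. *)
Lemma le_ae_of_le_integral (mu : {measure set T -> \bar R}) (f g : T -> \bar R) :
  mu setT < +oo -> measurable_fun setT f -> measurable_fun setT g ->
  (forall x, 0 <= f x) -> (forall x, 0 <= g x) ->
  (forall A, measurable A -> \int[mu]_(x in A) f x <= \int[mu]_(x in A) g x) ->
  \forall x \ae mu, f x <= g x.
Proof.
move=> muoo mf mg f0 g0 fg.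
pose A (n : nat) := [set x | g x < f x] `&` [set x | g x <= n%:R%:E].
have mA n : measurable (A n).
  apply: measurableI; rewrite -[X in measurable X]setTI.
    exact: measurable_lte.
  exact: measurable_lee.
suff A0 n : mu (A n) = 0.
  apply: (@negligibleS _ _ _ _ (\bigcup_n A n)).
    move=> x /= /negP; rewrite -ltNge => gf.
    have gfin : g x \is a fin_num by rewrite ge0_fin_numE// (lt_le_trans gf) ?leey.
    exists (Num.truncn (fine (g x))).+1 => //; split => //=.
    by rewrite -(fineK gfin) lee_fin ltW// truncnS_gt.
  by apply: negligible_bigcup => n; apply/(negligibleP _ (mA n)); exact: A0.
have gAfin : \int[mu]_(x in A n) g x < +oo.
  apply: (@le_lt_trans _ _ (\int[mu]_(x in A n) n%:R%:E)).
    apply: ge0_le_integral => //; try exact: measurable_funTS.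
    by move=> x [].
  rewrite integral_cst// lte_mul_pinfty ?lee_fin//.
  by apply: le_lt_trans muoo; apply: le_measure; rewrite ?inE//; exact: measurableT.
have mfg : measurable_fun setT (f \- g) by exact: emeasurable_funB.
have fgA x : A n x -> 0 < f x - g x by move=> [/= gf _]; rewrite sube_gt0.
have fE : \int[mu]_(x in A n) f x = \int[mu]_(x in A n) (f x - g x) + \int[mu]_(x in A n) g x.
  rewrite -ge0_integralD//; try exact: measurable_funTS.
    apply: eq_integral => x; rewrite inE => -[_ /= gn]; rewrite subeK//.
    by rewrite ge0_fin_numE// (le_lt_trans gn) ?ltry.
  by move=> x Ax; exact/ltW/fgA.
have I0 : \int[mu]_(x in A n) `|f x - g x| = 0.
  have -> : \int[mu]_(x in A n) `|f x - g x| = \int[mu]_(x in A n) (f x - g x).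
    by apply: eq_integral => x; rewrite inE => /fgA /ltW fg0; rewrite gee0_abs.
  apply/eqP; rewrite eq_le; apply/andP; split; last first.
    by apply: integral_ge0 => x /fgA /ltW.
  have := fg _ (mA n); rewrite fE -leeBrDr//; last first.
    by rewrite ge0_fin_numE//; exact: integral_ge0.
  by rewrite subee// ge0_fin_numE//; exact: integral_ge0.
move/ae_eq_integral_abs : I0 => /(_ (mA n) (measurable_funTS mfg)) => I0.
apply/negligibleP => //.
apply: negligibleS I0 => x Ax /= H; have := fgA _ Ax.
by rewrite H// ltxx.
Qed.

End densities.

(** * Conditional expectations *)

Section subsigma.
Context {d} {Omega : measurableType d} {R : realType}.
Implicit Types G H : set_system Omega.
Local Open Scope ereal_scope.

Lemma erv_measurableS G H (f : Omega -> \bar R) :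
  G `<=` H -> erv_measurable G f -> erv_measurable H f.
Proof.
move=> GH mf _ B mB; have := mf measurableT B mB.
exact: (@sub_sigma_algebra2 _ setT).
Qed.

Lemma rv_measurableS G H (f : Omega -> R) :
  G `<=` H -> rv_measurable G f -> rv_measurable H f.
Proof.
move=> GH mf _ B mB; have := mf measurableT B mB.
exact: (@sub_sigma_algebra2 _ setT).
Qed.

Lemma erv_measurable_EFin G (f : Omega -> R) :
  rv_measurable G f -> erv_measurable G (EFin \o f).
Proof. by move=> mf; apply/measurable_EFinP. Qed.

(** The restriction is the image of mu under the identity, read as a map between two measurable
    structures on Omega. *)
Lemma ex_restrict_measure G H (mu : {measure set (g_sigma_algebraType H) -> \bar R}) :
  sigma_algebra setT G -> sigma_algebra setT H -> G `<=` H ->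
  exists nu : {measure set (g_sigma_algebraType G) -> \bar R},
    (forall A, nu A = mu A) /\
    forall f A, erv_measurable G f -> (forall x, 0 <= f x) -> G A ->
      \int[nu]_(x in A) f x = \int[mu]_(x in A) f x.
Proof.
move=> sG sH GH; pose i : g_sigma_algebraType H -> g_sigma_algebraType G := id.
have mi : measurable_fun setT i.
  move=> _ B mB; rewrite setTI; move: mB.
  rewrite measurable_g_measurableTypeE// => /GH HB.
  suff : measurable (B : set (g_sigma_algebraType H)) by [].
  by rewrite measurable_g_measurableTypeE.
unshelve eexists (pushforward mu i); first exact: mi.
split => // f A mf f0 GA.
rewrite ge0_integral_pushforward//.
  by rewrite measurable_g_measurableTypeE.
exact: measurable_funTS.
Qed.
Lemma g_measurableE G A : sigma_algebra setT G -> G A ->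
  measurable (A : set (g_sigma_algebraType G)).
Proof. by move=> sG; rewrite measurable_g_measurableTypeE. Qed.

Lemma g_measurableP G (A : set (g_sigma_algebraType G)) : sigma_algebra setT G ->
  measurable A -> G A.
Proof. by move=> sG; rewrite measurable_g_measurableTypeE. Qed.

(** The slices of a nonnegative f are bounded and sum to f. They reduce conditional expectations of
    arbitrary nonnegative variables to bounded ones by countable additivity, without
    integrability. *)
Definition slice (f : Omega -> R) (n : nat) (x : Omega) : R :=
  Num.min (f x) n.+1%:R - Num.min (f x) n%:R.

Lemma slice_ge0 f n x : (0 <= slice f n x)%R.
Proof. by rewrite subr_ge0 le_min ge_min lexx/= ge_min ler_nat leqnSn orbT. Qed.

Lemma sum_slice f n x : (0 <= f x)%R ->
  (\sum_(0 <= i < n) slice f i x = Num.min (f x) n%:R)%R.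
Proof.
by move=> f0; rewrite telescope_sumr// (min_r f0) subr0.
Qed.

Lemma slice_le f n x : (0 <= f x)%R -> (slice f n x <= n.+1%:R)%R.
Proof.
move=> f0; rewrite lerBlDr ge_min; apply/orP; right.
by rewrite lerDl le_min f0 ler0n.
Qed.

Lemma nneseries_slice f x : (0 <= f x)%R ->
  \sum_(n <oo) (slice f n x)%:E = (f x)%:E.
Proof.
move=> f0; apply/cvg_lim => //; apply: cvg_near_cst.
exists (Num.truncn (f x)).+1 => // n /= fn.
rewrite sumEFin sum_slice// min_l//.
by apply: le_trans (ltW (truncnS_gt _)) _; rewrite ler_nat.
Qed.

Lemma rv_measurable_min G (f : Omega -> R) (c : R) :
  rv_measurable G f -> rv_measurable G (fun x => Num.min (f x) c).
Proof. by move=> mf; apply: measurable_minr. Qed.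

Lemma rv_measurable_slice G f n : rv_measurable G f -> rv_measurable G (slice f n).
Proof. by move=> mf; apply: measurable_funB; exact: rv_measurable_min. Qed.

End subsigma.

Section cond_exp.
Context {d} {Omega : measurableType d} {R : realType} {H G : set_system Omega}.
Hypotheses (sH : sigma_algebra setT H) (sG : sigma_algebra setT G) (GH : G `<=` H).
Variable Q : probability (g_sigma_algebraType H) R.
Local Open Scope ereal_scope.

Let mH (f : Omega -> \bar R) : erv_measurable G f -> erv_measurable H f.
Proof. exact: erv_measurableS. Qed.

Lemma is_cond_exp_nneg_le (f1 f2 g1 g2 : Omega -> \bar R) :
  is_cond_exp_nneg Q G f1 g1 -> is_cond_exp_nneg Q G f2 g2 ->
  (forall A, G A -> \int[Q]_(x in A) f1 x <= \int[Q]_(x in A) f2 x) ->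
  \forall x \ae Q, g1 x <= g2 x.
Proof.
move=> [mg1 g10 g1E] [mg2 g20 g2E] f12.
have [nu [nuE nuI]] := ex_restrict_measure Q sG sH GH.
suff [N [mN N0 sN]] : \forall x \ae nu, g1 x <= g2 x.
  exists N; split => //.
    exact: g_measurableE sH (GH (g_measurableP sG mN)).
  by rewrite -nuE.
apply: le_ae_of_le_integral => //.
  suff -> : nu setT = 1 by exact: ltry.
  by rewrite nuE; exact: (probability_setT Q).
move=> A; rewrite measurable_g_measurableTypeE// => GA.
by rewrite !nuI// g1E// g2E//; exact: f12.
Qed.

(** Radon-Nikodym on G for the measure with density f; the bound on f keeps this measure finite. *)
Lemma is_cond_exp_nneg_bounded (f : Omega -> R) (c : R) :
  rv_measurable H f -> (forall x, 0 <= f x <= c)%R ->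
  exists g : Omega -> \bar R, is_cond_exp_nneg Q G (EFin \o f) g.
Proof.
move=> mf fc; have f0 x : 0 <= (f x)%:E by rewrite lee_fin; case/andP: (fc x).
have [mu muE] := ex_density_measure Q (erv_measurable_EFin mf) f0.
have [nu [nuE _]] := ex_restrict_measure mu sG sH GH.
have [Q' [Q'E Q'I]] := ex_restrict_measure Q sG sH GH.
have Qoo : Q' setT < +oo.
  suff -> : Q' setT = 1 by exact: ltry.
  by rewrite Q'E; exact: (probability_setT Q).
have nuoo : nu setT < +oo.
  rewrite nuE muE; apply: (@le_lt_trans _ _ (\int[Q]_x c%:E)).
    apply: ge0_le_integral => //.
    - by move=> x _; exact: f0.
    - exact: erv_measurable_EFin.
    - by move=> x _; rewrite lee_fin; case/andP: (fc x).
  by rewrite integral_probability_cst ltry.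
have [//|g [mg g0 gE]] := ex_radon_nikodym Qoo nuoo.
  move=> A mA; rewrite Q'E nuE muE => A0.
  have mA' : measurable (A : set (g_sigma_algebraType H)).
    exact: g_measurableE sH (GH (g_measurableP sG mA)).
  have -> : \int[Q]_(x in A) (f x)%:E = \int[Q]_(x in A) `|(f x)%:E|.
    by apply: eq_integral => x _; rewrite gee0_abs.
  rewrite integral_abs_eq0//; apply: measurable_funTS.
  exact: erv_measurable_EFin.
exists (EFin \o g); split.
- exact: erv_measurable_EFin.
- by move=> x; rewrite lee_fin.
- move=> A GA; rewrite -(Q'I (EFin \o g))//; last first.
    exact: erv_measurable_EFin.
  by rewrite -gE ?nuE ?muE//; exact: g_measurableE.
Qed.

Lemma is_cond_exp_nneg_series (f g : nat -> Omega -> \bar R) :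
  (forall n, erv_measurable H (f n)) -> (forall n x, 0 <= f n x) ->
  (forall n, is_cond_exp_nneg Q G (f n) (g n)) ->
  is_cond_exp_nneg Q G (fun x => \sum_(n <oo) f n x) (fun x => \sum_(n <oo) g n x).
Proof.
move=> mf f0 fg; split.
- by apply: ge0_emeasurable_sum => [n x _ _|n _]; have [] := fg n.
- by move=> x; apply: nneseries_ge0 => n _ _; have [] := fg n.
- move=> A GA; have mA := g_measurableE sH (GH GA).
  rewrite !integral_nneseries//.
  + by apply: eq_eseriesr => n _; have [_ _] := fg n; exact.
  + by move=> n; exact: measurable_funTS (mf n).
  + by move=> n; apply: measurable_funTS; apply: mH; have [] := fg n.
  + by move=> n x _; have [_] := fg n.
Qed.

Lemma is_cond_exp_nneg_exists (f : Omega -> R) :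
  rv_measurable H f -> (forall x, 0 <= f x)%R ->
  exists g : Omega -> \bar R, is_cond_exp_nneg Q G (EFin \o f) g.
Proof.
move=> mf f0.
have /choice[g gP] : forall n, exists g : Omega -> \bar R,
    is_cond_exp_nneg Q G (EFin \o slice f n) g.
  move=> n; apply: (@is_cond_exp_nneg_bounded _ n.+1%:R).
    exact: rv_measurable_slice.
  by move=> x; rewrite slice_ge0 slice_le.
exists (fun x => \sum_(n <oo) g n x).
have -> : EFin \o f = fun x => \sum_(n <oo) (slice f n x)%:E.
  by apply/funext => x; rewrite nneseries_slice.
apply: (@is_cond_exp_nneg_series (fun n => EFin \o slice f n)) => //.
- by move=> n; apply: erv_measurable_EFin; exact: rv_measurable_slice.
- by move=> n x; rewrite lee_fin slice_ge0.
Qed.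

Local Notation cen := (cond_exp_nneg Q G).

Lemma cond_exp_nnegP (f : Omega -> R) :
  rv_measurable H f -> (forall x, 0 <= f x)%R ->
  is_cond_exp_nneg Q G (EFin \o f) (cen (EFin \o f)).
Proof.
move=> mf f0; have [g gP] := is_cond_exp_nneg_exists mf f0.
exact: (@xgetPex _ (cst 0) [set g | is_cond_exp_nneg Q G (EFin \o f) g]
  (ex_intro _ g gP)).
Qed.

Lemma is_cond_exp_nneg_unique (f g1 g2 : Omega -> \bar R) :
  is_cond_exp_nneg Q G f g1 -> is_cond_exp_nneg Q G f g2 ->
  \forall x \ae Q, g1 x = g2 x.
Proof.
move=> h1 h2; have a := is_cond_exp_nneg_le h1 h2 (fun A _ => lexx _).
have b := is_cond_exp_nneg_le h2 h1 (fun A _ => lexx _).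
by apply: (aeS2 a b) => x {}a {}b; apply/eqP; rewrite eq_le a.
Qed.

Lemma is_cond_exp_nnegD (f1 f2 g1 g2 : Omega -> \bar R) :
  erv_measurable H f1 -> erv_measurable H f2 ->
  (forall x, 0 <= f1 x) -> (forall x, 0 <= f2 x) ->
  is_cond_exp_nneg Q G f1 g1 -> is_cond_exp_nneg Q G f2 g2 ->
  is_cond_exp_nneg Q G (fun x => f1 x + f2 x) (fun x => g1 x + g2 x).
Proof.
move=> mf1 mf2 f10 f20 [mg1 g10 g1E] [mg2 g20 g2E]; split.
- exact: emeasurable_funD.
- by move=> x; rewrite adde_ge0.
- move=> A GA; have mA := g_measurableE sH (GH GA).
  rewrite !ge0_integralD//; try (by apply: measurable_funTS => //; exact: mH).
  by rewrite g1E// g2E.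
Qed.

Lemma is_cond_exp_nneg_id (f : Omega -> \bar R) : erv_measurable G f ->
  (forall x, 0 <= f x) -> is_cond_exp_nneg Q G f f.
Proof. by []. Qed.

Lemma cond_exp_nneg_le (f1 f2 : Omega -> R) :
  rv_measurable H f1 -> rv_measurable H f2 ->
  (forall x, 0 <= f1 x)%R -> (forall x, 0 <= f2 x)%R ->
  (\forall x \ae Q, (f1 x <= f2 x)%R) ->
  \forall x \ae Q, cen (EFin \o f1) x <= cen (EFin \o f2) x.
Proof.
move=> mf1 mf2 f10 f20 f12.
apply: is_cond_exp_nneg_le (cond_exp_nnegP mf1 f10) (cond_exp_nnegP mf2 f20) _.
move=> A GA; have mA := g_measurableE sH (GH GA).
apply: ae_ge0_le_integral => //.
- by move=> x _; rewrite lee_fin.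
- by apply: measurable_funTS; exact: erv_measurable_EFin.
- by move=> x _; rewrite lee_fin.
- by apply: measurable_funTS; exact: erv_measurable_EFin.
- by apply: (aeS f12) => x {}f12 _; rewrite lee_fin.
Qed.

Lemma cond_exp_nnegD (f1 f2 : Omega -> R) :
  rv_measurable H f1 -> rv_measurable H f2 ->
  (forall x, 0 <= f1 x)%R -> (forall x, 0 <= f2 x)%R ->
  \forall x \ae Q, cen (EFin \o (f1 \+ f2)%R) x = cen (EFin \o f1) x + cen (EFin \o f2) x.
Proof.
move=> mf1 mf2 f10 f20.
apply: is_cond_exp_nneg_unique.
  apply: cond_exp_nnegP; first exact: measurable_funD.
  by move=> x; rewrite addr_ge0.
apply: (@is_cond_exp_nnegD (EFin \o f1) (EFin \o f2)).
- exact: erv_measurable_EFin.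
- exact: erv_measurable_EFin.
- by move=> x; rewrite lee_fin.
- by move=> x; rewrite lee_fin.
- exact: cond_exp_nnegP.
- exact: cond_exp_nnegP.
Qed.

Lemma cond_exp_nnegZ (c : R) (f : Omega -> R) : (0 <= c)%R ->
  rv_measurable H f -> (forall x, 0 <= f x)%R ->
  \forall x \ae Q, cen (EFin \o (fun x => c * f x)%R) x = c%:E * cen (EFin \o f) x.
Proof.
move=> c0 mf f0; have [mg g0 gE] := cond_exp_nnegP mf f0.
apply: is_cond_exp_nneg_unique.
  apply: cond_exp_nnegP; first exact: measurable_funM.
  by move=> x; rewrite mulr_ge0.
split.
- exact: emeasurable_funM.
- by move=> x; rewrite mule_ge0.
- move=> A GA; have mA := g_measurableE sH (GH GA).
  rewrite ge0_integralZl//; last exact: measurable_funTS (mH mg).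
  rewrite gE// -ge0_integralZl//.
  + by apply: measurable_funTS; exact: erv_measurable_EFin.
  + by move=> x _; rewrite lee_fin.
Qed.

Lemma cond_exp_nneg_cst (c : R) : (0 <= c)%R ->
  \forall x \ae Q, cen (EFin \o cst c) x = c%:E.
Proof.
move=> c0; apply: is_cond_exp_nneg_unique.
  by apply: cond_exp_nnegP => //; exact: measurable_cst.
apply: is_cond_exp_nneg_id; last by move=> x; rewrite lee_fin.
by apply: erv_measurable_EFin; exact: measurable_cst.
Qed.

Lemma cond_exp_nneg_slice (f : Omega -> R) :
  rv_measurable H f -> (forall x, 0 <= f x)%R ->
  \forall x \ae Q, cen (EFin \o f) x = \sum_(n <oo) cen (EFin \o slice f n) x.
Proof.
move=> mf f0; apply: is_cond_exp_nneg_unique (cond_exp_nnegP mf f0) _.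
have -> : EFin \o f = fun x => \sum_(n <oo) (slice f n x)%:E.
  by apply/funext => x; rewrite nneseries_slice.
have ms n : rv_measurable H (slice f n) by exact: rv_measurable_slice.
apply: (@is_cond_exp_nneg_series (fun n => EFin \o slice f n)) => [n|n x|n].
- exact: erv_measurable_EFin.
- by rewrite lee_fin slice_ge0.
- by apply: cond_exp_nnegP => // x; exact: slice_ge0.
Qed.

Lemma cond_exp_nneg_sum_slice (f : Omega -> R) n :
  rv_measurable H f -> (forall x, 0 <= f x)%R ->
  \forall x \ae Q, \sum_(0 <= i < n) cen (EFin \o slice f i) x =
                   cen (EFin \o (fun x => Num.min (f x) n%:R)) x.
Proof.
move=> mf f0; elim: n => [|n IH].
  have -> : EFin \o (fun x => Num.min (f x) 0%:R) = EFin \o cst 0%R.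
    by apply/funext => x /=; rewrite min_r.
  by apply: (aeS (cond_exp_nneg_cst (lexx 0%R))) => x ->; rewrite big_geq.
have -> : (fun x => Num.min (f x) n.+1%:R) =
    ((fun x => Num.min (f x) n%:R) \+ slice f n)%R.
  by apply/funext => x /=; rewrite addrC subrK.
have m1 : rv_measurable H (fun x => Num.min (f x) n%:R) by exact: rv_measurable_min.
have h : forall x, (0 <= Num.min (f x) n%:R)%R by move=> x; rewrite le_min f0 ler0n.
have a := cond_exp_nnegD m1 (rv_measurable_slice n mf) h (fun x => slice_ge0 f n x).
by apply: (aeS2 IH a) => x {}IH ->; rewrite big_nat_recr//= IH.
Qed.

Lemma cond_exp_nneg_lty (f : Omega -> R) :
  rv_measurable H f -> (forall x, 0 <= f x)%R -> \int[Q]_x (f x)%:E < +oo ->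
  \forall x \ae Q, cen (EFin \o f) x < +oo.
Proof.
move=> mf f0 foo; have [mg g0 gE] := cond_exp_nnegP mf f0.
have iT : Q.-integrable setT (cen (EFin \o f)).
  apply/integrableP; split; first exact: mH.
  under eq_integral do rewrite gee0_abs//.
  rewrite gE//; rewrite -(measurable_g_measurableTypeE sG); exact: measurableT.
apply: (aeS (integrable_ae measurableT iT)) => x /(_ I).
by rewrite fin_numElt => /andP[].
Qed.

(** The measures with densities f and E_Q(f | G) coincide on G, hence give the same integral to the
    G-measurable h. *)
Lemma cond_exp_nneg_pull (f h : Omega -> R) :
  rv_measurable H f -> (forall x, 0 <= f x)%R -> \int[Q]_x (f x)%:E < +oo ->
  rv_measurable G h -> (forall x, 0 <= h x)%R ->
  \int[Q]_x ((h x)%:E * cen (EFin \o f) x) = \int[Q]_x ((h x)%:E * (f x)%:E).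
Proof.
move=> mf f0 foo mh h0; have [mg g0 gE] := cond_exp_nnegP mf f0.
have GT : G setT by rewrite -(measurable_g_measurableTypeE sG); exact: measurableT.
have fE0 x : 0 <= (EFin \o f) x by rewrite lee_fin.
have Qoo : Q setT < +oo by rewrite probability_setT ltry.
have [mu muE] := ex_density_measure Q (erv_measurable_EFin mf) fE0.
have [mu' mu'E] := ex_density_measure Q (mH mg) g0.
have mhH : erv_measurable H (EFin \o h) by apply: mH; exact: erv_measurable_EFin.
have muoo : mu setT < +oo by rewrite muE.
have mu'oo : mu' setT < +oo by rewrite mu'E gE.
rewrite -(integral_density Qoo mu'oo (mH mg) g0 _ mhH)//.
rewrite -(integral_density Qoo muoo (erv_measurable_EFin mf) fE0 _ mhH)//.
have [nu [nuE nuI]] := ex_restrict_measure mu sG sH GH.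
have [nu' [nu'E nu'I]] := ex_restrict_measure mu' sG sH GH.
rewrite -nuI//; last exact: erv_measurable_EFin.
rewrite -nu'I//; last exact: erv_measurable_EFin.
apply: eq_measure_integral => A + _; rewrite measurable_g_measurableTypeE// => GA.
by rewrite nuE nu'E muE mu'E gE.
Qed.

Lemma cond_expE (X : Omega -> R) : cond_exp Q G X = fun x =>
  cen (EFin \o (X^\+)%R) x - cen (EFin \o (X^\-)%R) x.
Proof.
apply/funext => x; congr (cond_exp_nneg Q G _ x - cond_exp_nneg Q G _ x).
  by apply/funext => y; rewrite /= funeposE /funrpos EFin_max.
by apply/funext => y; rewrite /= funenegE /funrneg EFin_max.
Qed.

End cond_exp.

(** * Conditional expectations of signed variables *)

Section signed_cond_exp.
Context {d} {Omega : measurableType d} {R : realType} {H G : set_system Omega}.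
Hypotheses (sH : sigma_algebra setT H) (sG : sigma_algebra setT G) (GH : G `<=` H).
Variable Q : probability (g_sigma_algebraType H) R.
Local Open Scope ereal_scope.
Local Notation cen := (cond_exp_nneg Q G).
Local Notation ce := (cond_exp Q G).
Implicit Types X Y : Omega -> R.

(** For S in [calPtilde] and X in L^c_t only the finiteness of E_S(|X| | F_s) is at hand, not
    S-integrability of X; linearity is therefore proved under this weaker condition. *)
Definition cond_integrable X : Prop :=
  \forall x \ae Q, cen (EFin \o (Num.norm \o X)) x < +oo.

Lemma rv_measurable_pos K X : rv_measurable K X -> rv_measurable K (X^\+)%R.
Proof. by move=> mX; apply: measurable_funrpos. Qed.

Lemma rv_measurable_neg K X : rv_measurable K X -> rv_measurable K (X^\-)%R.
Proof. by move=> mX; apply: measurable_funrneg. Qed.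

Lemma rv_measurable_norm K X : rv_measurable K X -> rv_measurable K (Num.norm \o X).
Proof. by move=> mX; exact: measurableT_comp. Qed.

Lemma rv_measurableD K X Y : rv_measurable K X -> rv_measurable K Y ->
  rv_measurable K (X \+ Y)%R.
Proof. by move=> mX mY; exact: measurable_funD. Qed.

Lemma rv_measurableB K X Y : rv_measurable K X -> rv_measurable K Y ->
  rv_measurable K (X \- Y)%R.
Proof. by move=> mX mY; exact: measurable_funB. Qed.

Lemma funrpos_le_norm X x : (X^\+ x <= `|X x|)%R.
Proof. by rewrite /funrpos ge_max ler_norm normr_ge0. Qed.

Lemma funrneg_le_norm X x : (X^\- x <= `|X x|)%R.
Proof. by rewrite /funrneg ge_max -normrN ler_norm normr_ge0. Qed.

Lemma funrposBnegE X x : (X^\+ x - X^\- x = X x)%R.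
Proof. by rewrite -[in RHS](funrposBneg X). Qed.

Lemma erv_measurable_ce X : rv_measurable H X -> erv_measurable G (ce X).
Proof.
move=> mX; rewrite cond_expE.
have [mp _ _] := cond_exp_nnegP sH sG GH Q (rv_measurable_pos mX) (funrpos_ge0 X).
have [mn _ _] := cond_exp_nnegP sH sG GH Q (rv_measurable_neg mX) (funrneg_ge0 X).
exact: emeasurable_funB.
Qed.

Lemma cond_exp_split X : rv_measurable H X -> cond_integrable X ->
  \forall x \ae Q, exists a b : R,
    [/\ cen (EFin \o (X^\+)%R) x = a%:E, cen (EFin \o (X^\-)%R) x = b%:E &
        ce X x = (a - b)%:E].
Proof.
move=> mX iX.
have ap := cond_exp_nneg_le sH sG GH (rv_measurable_pos mX) (rv_measurable_norm mX)
  (funrpos_ge0 X) (fun x => normr_ge0 _) (aeW Q (funrpos_le_norm X)).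
have an := cond_exp_nneg_le sH sG GH (rv_measurable_neg mX) (rv_measurable_norm mX)
  (funrneg_ge0 X) (fun x => normr_ge0 _) (aeW Q (funrneg_le_norm X)).
apply: (aeS3 iX ap an) => x oo lep len.
have [_ p0 _] := cond_exp_nnegP sH sG GH Q (rv_measurable_pos mX) (funrpos_ge0 X).
have [_ n0 _] := cond_exp_nnegP sH sG GH Q (rv_measurable_neg mX) (funrneg_ge0 X).
have fp : cen (EFin \o (X^\+)%R) x \is a fin_num.
  by rewrite ge0_fin_numE//; exact: le_lt_trans lep oo.
have fn : cen (EFin \o (X^\-)%R) x \is a fin_num.
  by rewrite ge0_fin_numE//; exact: le_lt_trans len oo.
exists (fine (cen (EFin \o (X^\+)%R) x)), (fine (cen (EFin \o (X^\-)%R) x)).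
by rewrite EFinB !fineK// cond_expE.
Qed.

Lemma cond_exp_fin X : rv_measurable H X -> cond_integrable X ->
  \forall x \ae Q, ce X x \is a fin_num.
Proof.
by move=> mX iX; apply: (aeS (cond_exp_split mX iX)) => x [a [b [_ _ ->]]].
Qed.

Lemma cond_integrable_integrable X : rv_measurable H X ->
  Q.-integrable setT (EFin \o X) -> cond_integrable X.
Proof.
move=> mX /integrableP[_ iX]; apply: (cond_exp_nneg_lty sH sG GH).
- exact: rv_measurable_norm.
- by move=> x; exact: normr_ge0.
- exact: iX.
Qed.

Lemma cond_expD X Y : rv_measurable H X -> rv_measurable H Y ->
  cond_integrable X -> cond_integrable Y ->
  \forall x \ae Q, ce (X \+ Y)%R x = ce X x + ce Y x.
Proof.
move=> mX mY iX iY.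
have mXY : rv_measurable H (X \+ Y)%R by exact: rv_measurableD.
have iXY : cond_integrable (X \+ Y)%R.
  have a := cond_exp_nnegD sH sG GH Q (rv_measurable_norm mX) (rv_measurable_norm mY)
    (fun x => normr_ge0 _) (fun x => normr_ge0 _).
  have b := cond_exp_nneg_le sH sG GH (rv_measurable_norm mXY)
    (rv_measurableD (rv_measurable_norm mX) (rv_measurable_norm mY))
    (fun x => normr_ge0 _) (fun x => addr_ge0 (normr_ge0 _) (normr_ge0 _))
    (aeW Q (fun x => ler_normD (X x) (Y x))).
  apply: (aeS4 iX iY a b) => x ox oy -> /le_lt_trans; apply.
  exact: lte_add_pinfty.
(* This rearrangement has sums of nonnegative variables on both sides, so additivity of
   [cond_exp_nneg] applies to each. *)
have E : (((X \+ Y)^\+ \+ X^\-) \+ Y^\-)%R = (((X \+ Y)^\- \+ X^\+) \+ Y^\+)%R.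
  apply/funext => x /=.
  have := funrposBnegE X x; have := funrposBnegE Y x; have := funrposBnegE (X \+ Y)%R x.
  by rewrite /=; lra.
have h1 := cond_exp_nnegD sH sG GH Q (rv_measurable_pos mXY) (rv_measurable_neg mX)
  (funrpos_ge0 _) (funrneg_ge0 _).
have h2 := cond_exp_nnegD sH sG GH Q
  (rv_measurableD (rv_measurable_pos mXY) (rv_measurable_neg mX)) (rv_measurable_neg mY)
  (fun x => addr_ge0 (funrpos_ge0 _ _) (funrneg_ge0 _ _)) (funrneg_ge0 _).
have h3 := cond_exp_nnegD sH sG GH Q (rv_measurable_neg mXY) (rv_measurable_pos mX)
  (funrneg_ge0 _) (funrpos_ge0 _).
have h4 := cond_exp_nnegD sH sG GH Q
  (rv_measurableD (rv_measurable_neg mXY) (rv_measurable_pos mX)) (rv_measurable_pos mY)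
  (fun x => addr_ge0 (funrneg_ge0 _ _) (funrpos_ge0 _ _)) (funrpos_ge0 _).
have h12 := aeS2 h1 h2 (fun x => @conj _ _).
have h34 := aeS2 h3 h4 (fun x => @conj _ _).
have hXY := aeS2 (cond_exp_split mX iX) (cond_exp_split mY iY) (fun x => @conj _ _).
apply: (aeS4 h12 h34 hXY (cond_exp_split mXY iXY)) => x [].
move=> e1 e2 [e3 e4] [[a [b [e5 e6 ->]]] [a' [b' [e7 e8 ->]]]] [a2 [b2 [e9 e10 ->]]].
move: e4; rewrite -E e2 e1 e3 e5 e6 e7 e8 e9 e10.
by rewrite -!EFinD => -[h]; congr _%:E; lra.
Qed.

Lemma cond_exp_le X Y : rv_measurable H X -> rv_measurable H Y ->
  (\forall x \ae Q, (X x <= Y x)%R) -> \forall x \ae Q, ce X x <= ce Y x.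
Proof.
move=> mX mY XY.
have a : \forall x \ae Q, cen (EFin \o (X^\+)%R) x <= cen (EFin \o (Y^\+)%R) x.
  apply: (cond_exp_nneg_le sH sG GH) => //; [exact: rv_measurable_pos..|].
  by apply: (aeS XY) => x h; rewrite /funrpos ge_max !le_max h/= lexx orbT.
have b : \forall x \ae Q, cen (EFin \o (Y^\-)%R) x <= cen (EFin \o (X^\-)%R) x.
  apply: (cond_exp_nneg_le sH sG GH) => //; [exact: rv_measurable_neg..|].
  by apply: (aeS XY) => x h; rewrite /funrneg ge_max !le_max lerN2 h/= lexx orbT.
by rewrite !cond_expE; apply: (aeS2 a b) => x {}a {}b; exact: leeB.
Qed.

Lemma cond_exp_ge0E X : (forall x, 0 <= X x)%R ->
  \forall x \ae Q, ce X x = cen (EFin \o X) x.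
Proof.
move=> X0; rewrite cond_expE.
have -> : (X^\+)%R = X by apply/funext => x; rewrite /funrpos max_l.
have -> : (X^\-)%R = cst 0%R by apply/funext => x; rewrite /funrneg max_r// oppr_le0.
by apply: (aeS (cond_exp_nneg_cst sH sG GH Q (lexx 0%R))) => x ->; rewrite sube0.
Qed.

Lemma cond_exp_lip X Y : rv_measurable H X -> rv_measurable H Y ->
  cond_integrable X -> cond_integrable Y ->
  \forall x \ae Q, ce X x <= ce Y x + cen (EFin \o (Num.norm \o (X \- Y)%R)) x.
Proof.
move=> mX mY iX iY.
have mXY : rv_measurable H (X \- Y)%R by exact: rv_measurableB.
have mN := rv_measurable_norm mXY.
have iN : cond_integrable (Num.norm \o (X \- Y)%R).
  have a := cond_exp_nnegD sH sG GH Q (rv_measurable_norm mX) (rv_measurable_norm mY)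
    (fun x => normr_ge0 _) (fun x => normr_ge0 _).
  have b : \forall x \ae Q, cen (EFin \o (Num.norm \o (Num.norm \o (X \- Y)%R))) x <=
      cen (EFin \o (Num.norm \o X \+ (Num.norm \o Y))%R) x.
    apply: (cond_exp_nneg_le sH sG GH) => //.
    - exact: rv_measurable_norm.
    - by apply: rv_measurableD; exact: rv_measurable_norm.
    - by move=> x; exact: normr_ge0.
    - by move=> x; apply: addr_ge0; exact: normr_ge0.
    - by apply: aeW => x /=; rewrite normr_id ler_normB.
  apply: (aeS4 iX iY a b) => x ox oy -> /le_lt_trans; apply.
  exact: lte_add_pinfty.
have h1 : \forall x \ae Q, ce X x <= ce (Y \+ (Num.norm \o (X \- Y)))%R x.
  apply: cond_exp_le => //; first exact: rv_measurableD.
  by apply: aeW => x /=; rewrite -lerBlDl ler_norm.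
have h2 := cond_expD mY mN iY iN.
have h3 := cond_exp_ge0E (fun x => normr_ge0 ((X \- Y)%R x)).
by apply: (aeS3 h1 h2 h3) => x a b c; rewrite b c in a.
Qed.

Lemma cond_exp_le_cst X (c : R) : (0 <= c)%R -> rv_measurable H X ->
  (\forall x \ae Q, (X x <= c)%R) -> \forall x \ae Q, ce X x <= c%:E.
Proof.
move=> c0 mX Xc; have h : \forall x \ae Q, ce X x <= ce (cst c) x.
  by apply: cond_exp_le => //; exact: measurable_cst.
have h' : \forall x \ae Q, ce (cst c) x = cen (EFin \o cst c) x.
  exact: cond_exp_ge0E.
by apply: (aeS3 h h' (cond_exp_nneg_cst sH sG GH Q c0)) => x a b e; rewrite b e in a.
Qed.

Lemma integral_fine_cond_exp X : rv_measurable H X ->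
  Q.-integrable setT (EFin \o X) ->
  [/\ rv_measurable G (fine \o ce X), Q.-integrable setT (EFin \o (fine \o ce X)) &
   forall A, G A ->
     \int[Q]_(x in A) (fine (ce X x))%:E = \int[Q]_(x in A) (X x)%:E].
Proof.
move=> mX iX; have iX' := cond_integrable_integrable mX iX.
have mce := erv_measurable_ce mX.
have mf : rv_measurable G (fine \o ce X) by apply: measurableT_comp.
have [mp p0 pE] := cond_exp_nnegP sH sG GH Q (rv_measurable_pos mX) (funrpos_ge0 X).
have [mn n0 nE] := cond_exp_nnegP sH sG GH Q (rv_measurable_neg mX) (funrneg_ge0 X).
have GT : G setT by rewrite -(measurable_g_measurableTypeE sG); exact: measurableT.
have ip0 : Q.-integrable setT (EFin \o (X^\+)%R) by exact: integrable_funrpos.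
have in0 : Q.-integrable setT (EFin \o (X^\-)%R) by exact: integrable_funrneg.
have iabs f : erv_measurable H f -> (forall x, 0 <= f x) -> \int[Q]_x f x < +oo ->
    Q.-integrable setT f.
  move=> mf' f0 foo; apply/integrableP; split => //.
  by under eq_integral do rewrite gee0_abs//.
have ip : Q.-integrable setT (cen (EFin \o (X^\+)%R)).
  apply: iabs => //; first exact: erv_measurableS mp.
  rewrite pE//; have /integrableP[_] := ip0.
  by under eq_integral do rewrite gee0_abs ?lee_fin ?funrpos_ge0//.
have in' : Q.-integrable setT (cen (EFin \o (X^\-)%R)).
  apply: iabs => //; first exact: erv_measurableS mn.
  rewrite nE//; have /integrableP[_] := in0.
  by under eq_integral do rewrite gee0_abs ?lee_fin ?funrneg_ge0//.
have ae : \forall x \ae Q, (fine (ce X x))%:E = cen (EFin \o (X^\+)%R) x - cen (EFin \o (X^\-)%R) x.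
  by apply: (aeS (cond_exp_fin mX iX')) => x h; rewrite fineK// cond_expE.
have mfE : erv_measurable H (EFin \o (fine \o ce X)).
  by apply: erv_measurableS GH _; exact: erv_measurable_EFin.
have key A : G A -> \int[Q]_(x in A) (fine (ce X x))%:E = \int[Q]_(x in A) (X x)%:E.
  move=> GA; have mA := g_measurableE sH (GH GA).
  transitivity (\int[Q]_(x in A) (cen (EFin \o (X^\+)%R) x - cen (EFin \o (X^\-)%R) x)).
    apply: ae_eq_integral => //.
    - exact: measurable_funTS mfE.
    - apply: measurable_funTS; apply: emeasurable_funB.
        exact: erv_measurableS mp.
      exact: erv_measurableS mn.
    - by apply: (aeS ae) => x e _; exact: e.
  rewrite integralB//; [|exact: integrableS ip|exact: integrableS in'].
  rewrite pE// nE// -integralB//; [|exact: integrableS ip0|exact: integrableS in0].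
  by apply: eq_integral => x _; rewrite /= -EFinB funrposBnegE.
split => //.
have iB := integrableB measurableT ip in'.
apply/integrableP; split => //.
have /integrableP[mB] := iB.
rewrite (_ : \int[Q]_x `|(EFin \o (fine \o ce X)) x| = \int[Q]_x
  `|(cen (EFin \o (X^\+)%R) \- cen (EFin \o (X^\-)%R)) x|)//.
apply: ge0_ae_eq_integral => //.
- exact: measurableT_comp.
- exact: measurableT_comp.
- by apply: (aeS ae) => x e _; congr abse; exact: e.
Qed.

Lemma le_ae_of_le_integral_EFin (U V : Omega -> R) :
  rv_measurable G U -> rv_measurable G V ->
  Q.-integrable setT (EFin \o U) -> Q.-integrable setT (EFin \o V) ->
  (forall A, G A -> \int[Q]_(x in A) (U x)%:E <= \int[Q]_(x in A) (V x)%:E) ->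
  \forall x \ae Q, (U x <= V x)%R.
Proof.
move=> mU mV iU iV UV.
have mUH := rv_measurableS GH mU; have mVH := rv_measurableS GH mV.
pose A := [set x | V x < U x]%R.
have GA : G A.
  apply: (@g_measurableP _ _ G) => //; rewrite -[X in measurable X]setTI.
  have -> : A = [set x | (EFin \o V) x < (EFin \o U) x] by [].
  by apply: measurable_lte => //; exact: erv_measurable_EFin.
have mA := g_measurableE sH (GH GA).
have mB : erv_measurable H (EFin \o (U \- V)%R).
  by apply: erv_measurable_EFin; exact: rv_measurableB.
have I0 : \int[Q]_(x in A) `|(U x - V x)%:E| = 0.
  have -> : \int[Q]_(x in A) `|(U x - V x)%:E| = \int[Q]_(x in A) ((U x)%:E - (V x)%:E).
    apply: eq_integral => x; rewrite inE /A /= => h.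
    by rewrite ger0_norm// subr_ge0 ltW.
  apply/eqP; rewrite eq_le; apply/andP; split; last first.
    by apply: integral_ge0 => x /ltW h; rewrite -EFinB lee_fin subr_ge0.
  have iUA := integrableS measurableT mA (@subsetT _ A) iU.
  have iVA := integrableS measurableT mA (@subsetT _ A) iV.
  rewrite integralB// sube_le0; exact: UV.
move/ae_eq_integral_abs : I0 => /(_ mA (measurable_funTS mB)) I0.
apply: (aeS I0) => x h; rewrite leNgt; apply/negP => Ax; have := h Ax.
by rewrite /= => -[] /eqP; rewrite subr_eq0 gt_eqF.
Qed.

Lemma cond_exp_le_of_integral X (V : Omega -> R) :
  rv_measurable H X -> rv_measurable G V ->
  Q.-integrable setT (EFin \o X) -> Q.-integrable setT (EFin \o V) ->
  (forall A, G A -> \int[Q]_(x in A) (X x)%:E <= \int[Q]_(x in A) (V x)%:E) ->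
  \forall x \ae Q, ce X x <= (V x)%:E.
Proof.
move=> mX mV iX iV XV.
have [mf i_f fE] := integral_fine_cond_exp mX iX.
have h : \forall x \ae Q, ((fine \o ce X) x <= V x)%R.
  by apply: le_ae_of_le_integral_EFin => // A GA; rewrite fE//; exact: XV.
apply: (aeS2 h (cond_exp_fin mX (cond_integrable_integrable mX iX))) => x /= + hf.
by rewrite -lee_fin fineK.
Qed.

Lemma measurable_mem d0 (T : measurableType d0) (A : set T) : measurable A ->
  measurable_fun setT (fun x => x \in A).
Proof.
move=> mA; apply: (measurable_fun_bool true).
rewrite setTI (_ : _ @^-1` _ = A)//; apply/seteqP; split=> x /=.
  by move=> /set_mem.
by move=> /mem_set.
Qed.

Lemma erv_measurable_patch K (U V : Omega -> \bar R) (A : set Omega) :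
  sigma_algebra setT K -> K A ->
  erv_measurable K U -> erv_measurable K V -> erv_measurable K (patch V A U).
Proof.
move=> sK KA mU mV; have mKA := g_measurableE sK KA.
exact: (measurable_fun_ifT (measurable_mem mKA) mU mV).
Qed.

Lemma rv_measurable_patch K (U V : Omega -> R) (A : set Omega) :
  sigma_algebra setT K -> K A ->
  rv_measurable K U -> rv_measurable K V -> rv_measurable K (patch V A U).
Proof.
move=> sK KA mU mV; have mKA := g_measurableE sK KA.
exact: (measurable_fun_ifT (measurable_mem mKA) mU mV).
Qed.

Lemma is_cond_exp_nneg_patch (f1 f2 g1 g2 : Omega -> \bar R) (A : set Omega) :
  erv_measurable H f1 -> erv_measurable H f2 ->
  (forall x, 0 <= f1 x) -> (forall x, 0 <= f2 x) -> G A ->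
  is_cond_exp_nneg Q G f1 g1 -> is_cond_exp_nneg Q G f2 g2 ->
  is_cond_exp_nneg Q G (patch f2 A f1) (patch g2 A g1).
Proof.
move=> mf1 mf2 f10 f20 GA [mg1 g10 g1E] [mg2 g20 g2E].
split; first exact: erv_measurable_patch.
  by move=> x; rewrite /patch; case: ifP.
have mGA := g_measurableE sG GA; have mA := g_measurableE sH (GH GA).
have split_int (U V : Omega -> \bar R) B : erv_measurable H U -> erv_measurable H V ->
    (forall x, 0 <= U x) -> (forall x, 0 <= V x) -> G B ->
    \int[Q]_(x in B) patch V A U x =
    \int[Q]_(x in B `&` A) U x + \int[Q]_(x in B `\` A) V x.
  move=> mU mV U0 V0 GB; have mB := g_measurableE sH (GH GB).
  rewrite -{1}(setUIDK B A) ge0_integral_setU//.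
  - congr (_ + _); apply: eq_integral => x; rewrite inE => -[Bx Ax].
      by rewrite /patch mem_set.
    by rewrite /patch memNset.
  - exact: measurableI.
  - exact: measurableD.
  - by apply: measurable_funTS; apply: erv_measurable_patch => //; exact: GH.
  - by move=> x _; rewrite /patch; case: ifP.
  - by rewrite disj_set2E; apply/eqP/seteqP; split => // x [[_ Ax] [_ /(_ Ax)]].
move=> B GB; have mGB := g_measurableE sG GB.
rewrite !split_int//; last 2 first.
  exact: erv_measurableS mg1.
  exact: erv_measurableS mg2.
rewrite g1E ?g2E//; apply: (@g_measurableP _ _ G) => //.
  exact: measurableD.
exact: measurableI.
Qed.

(** [patch Y A X] is X on A and Y elsewhere. This locality, combined with [crm_patch], allows
    penalized positions to be pasted along events of G. *)
Lemma cond_exp_patch X Y (A : set Omega) : rv_measurable H X -> rv_measurable H Y ->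
  G A -> \forall x \ae Q, ce (patch Y A X) x = patch (ce Y) A (ce X) x.
Proof.
move=> mX mY GA; have HA := GH GA.
have nneg (f1 f2 : Omega -> R) : rv_measurable H f1 -> rv_measurable H f2 ->
    (forall x, (0 <= f1 x)%R) -> (forall x, (0 <= f2 x)%R) ->
    \forall x \ae Q, cen (EFin \o patch f2 A f1) x =
      patch (cen (EFin \o f2)) A (cen (EFin \o f1)) x.
  move=> mf1 mf2 f10 f20.
  apply: (is_cond_exp_nneg_unique sH sG GH).
    apply: (cond_exp_nnegP sH sG GH); first exact: rv_measurable_patch.
    by move=> x; rewrite /patch; case: ifP.
  have -> : EFin \o patch f2 A f1 = patch (EFin \o f2) A (EFin \o f1).
    by apply/funext => x; rewrite /patch /=; case: ifP.
  apply: is_cond_exp_nneg_patch => //.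
  - exact: erv_measurable_EFin.
  - exact: erv_measurable_EFin.
  - exact: (cond_exp_nnegP sH sG GH).
  - exact: (cond_exp_nnegP sH sG GH).
have hp := nneg _ _ (rv_measurable_pos mX) (rv_measurable_pos mY) (funrpos_ge0 X) (funrpos_ge0 Y).
have hn := nneg _ _ (rv_measurable_neg mX) (rv_measurable_neg mY) (funrneg_ge0 X) (funrneg_ge0 Y).
rewrite !cond_expE.
have -> : ((patch Y A X)^\+)%R = patch (Y^\+)%R A (X^\+)%R.
  by apply/funext => x; rewrite /funrpos /patch; case: ifP.
have -> : ((patch Y A X)^\-)%R = patch (Y^\-)%R A (X^\-)%R.
  by apply/funext => x; rewrite /funrneg /patch; case: ifP.
by apply: (aeS2 hp hn) => x -> ->; rewrite /patch; case: ifP.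
Qed.

End signed_cond_exp.

(** * Essential suprema *)

Section ess_sup_exists.
Context {d} {T : measurableType d} {R : realType}.
Local Open Scope ereal_scope.

Lemma measurable_fun_inv_ge0 (f : T -> R) : measurable_fun setT f ->
  (forall x, 0 <= f x)%R -> measurable_fun setT (fun x => (f x)^-1%R).
Proof.
move=> mf f0; under eq_fun do rewrite -powR_inv1//.
exact: measurableT_comp (measurable_powR (-1)) mf.
Qed.

Lemma measurable_fun_contract (f : T -> \bar R) : measurable_fun setT f ->
  measurable_fun setT (@contract R \o f).
Proof.
move=> mf.
have mset (c : \bar R) : measurable (f @^-1` [set c]).
  by rewrite -[X in measurable X]setTI; apply: mf => //; exact: emeasurable_set1.
have -> : @contract R \o f = fun x =>
    if x \in f @^-1` [set +oo] then 1%R else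
    if x \in f @^-1` [set -oo] then (-1)%R else
    (fine (f x) * (1 + `|fine (f x)|)^-1)%R.
  apply/funext => x /=; case: ifPn => [|/negP].
    by rewrite inE /= => ->.
  rewrite inE /= => fy; case: ifPn => [|/negP].
    by rewrite inE /= => ->.
  by rewrite inE /=; case: (f x) fy.
have mfine : measurable_fun setT (fine \o f) by exact: measurableT_comp.
apply: measurable_fun_ifT; [exact: measurable_mem|exact: measurable_cst|].
apply: measurable_fun_ifT; [exact: measurable_mem|exact: measurable_cst|].
apply: measurable_funM => //.
apply: measurable_fun_inv_ge0; last by move=> x; rewrite addr_ge0.
by apply: measurable_funD => //; exact: measurableT_comp.
Qed.

Definition csup (Z : nat -> T -> \bar R) (x : T) := ereal_sup (range (Z^~ x)).

Lemma csup_ubound Z n x : Z n x <= csup Z x.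
Proof. by apply: ereal_sup_ubound; exists n. Qed.

Lemma csup_le Z x y : (forall n, Z n x <= y) -> csup Z x <= y.
Proof. by move=> Zy; apply: ge_ereal_sup => _ [n _ <-]. Qed.

Lemma measurable_csup Z : (forall n, measurable_fun setT (Z n)) ->
  measurable_fun setT (csup Z).
Proof.
move=> mZ; have -> : csup Z = fun x => esups (Z^~ x) 0%N.
  apply/funext => x; rewrite /csup /esups; congr ereal_sup.
  by apply/seteqP; split => _ [n /= _ <-]; exists n.
exact: measurable_fun_esups.
Qed.

(* The integral of the bounded increasing transform [1 + contract] detects
   strict increase, so a countable supremum maximizing it is essential. *)
Lemma ess_sup_countable (P : probability T R) (U : set (T -> \bar R)) :
  U !=set0 -> (forall Z, U Z -> measurable_fun setT Z) ->
  exists Z : nat -> T -> \bar R, (forall n, U (Z n)) /\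
    forall W, U W -> \forall x \ae P, W x <= csup Z x.
Proof.
move=> [Z0 UZ0] mU.
pose psi (f : T -> \bar R) x := (1 + contract (f x))%:E.
have psi_ge0 f x : 0 <= psi f x.
  by rewrite lee_fin -lerBlDl sub0r; have := contract_le1 (f x); rewrite ler_norml => /andP[].
have psi_le2 f x : psi f x <= 2%:E.
  by rewrite lee_fin (_ : 2 = 1 + 1)%R// lerD2l; have := contract_le1 (f x); rewrite ler_norml => /andP[].
have mpsi f : measurable_fun setT f -> measurable_fun setT (psi f).
  move=> mf; apply/measurable_EFinP; apply: measurable_funD => //.
  exact: measurable_fun_contract.
have le_psi f g : measurable_fun setT f -> measurable_fun setT g ->
    (forall x, f x <= g x) -> \int[P]_x psi f x <= \int[P]_x psi g x.
  move=> mf mg fg; apply: ge0_le_integral => //; [exact: mpsi|exact: mpsi|].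
  by move=> x _; rewrite lee_fin lerD2l le_contract; exact: fg.
pose S := [set \int[P]_x psi (csup Z) x | Z in [set Z : nat -> T -> \bar R | forall n, U (Z n)]].
have S0 : S (\int[P]_x psi (csup (fun=> Z0)) x) by exists (fun=> Z0).
have Sfin : ereal_sup S \is a fin_num.
  rewrite ge0_fin_numE; last first.
    by apply: le_trans (ereal_sup_ubound S0); exact: integral_ge0.
  apply: (@le_lt_trans _ _ 2%:E); last exact: ltry.
  apply: ge_ereal_sup => _ [Z UZ <-]; rewrite -(integral_probability_cst P 2%:E).
  apply: ge0_le_integral => //; apply: mpsi.
  by apply: measurable_csup => n; exact: mU.
have /choice[ZZ ZZP] : forall n : nat, exists Z : nat -> T -> \bar R,
    (forall k, U (Z k)) /\ ereal_sup S - n.+1%:R^-1%:E < \int[P]_x psi (csup Z) x.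
  move=> n; have n0 : (0 < n.+1%:R^-1 :> R)%R by rewrite invr_gt0.
  by have [_ [Z UZ <-] h] := ub_ereal_sup_adherent n0 Sfin; exists Z.
(* One sequence running through all the [ZZ n k] by pairing indices, so that its supremum dominates
   each nearly maximizing one; [Z0] fills the codes that decode to nothing. *)
pose Z n := if @unpickle (nat * nat)%type n is Some ij then ZZ ij.1 ij.2 else Z0.
have UZ n : U (Z n).
  by rewrite /Z; case: unpickle => // ij; have [+ _] := ZZP ij.1; exact.
have mZ : measurable_fun setT (csup Z) by apply: measurable_csup => n; exact: mU.
have Zmax : ereal_sup S <= \int[P]_x psi (csup Z) x.
  apply/lee_addgt0Pr => e e0.
  have [n _ nP] := near_infty_natSinv_lt (PosNum e0).
  rewrite -leeBlDr//; have [UZn /ltW h] := ZZP n.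
  apply: le_trans (le_trans h _); last first.
    apply: le_psi => //.
      by apply: measurable_csup => k; exact: mU.
    move=> x; apply: csup_le => k.
    by have := csup_ubound Z (pickle (n, k)) x; rewrite /Z pickleK.
  by rewrite leeB// lee_fin ltW//; exact: (nP n (leqnn n)).
exists Z; split => // W UW.
(* Prepending W cannot exceed the maximal integral, so the transforms of the two suprema agree
   almost surely. *)
pose Z' n := if n is n'.+1 then Z n' else W.
have UZ' n : U (Z' n) by case: n.
have mZ' : measurable_fun setT (csup Z') by apply: measurable_csup => n; exact: mU.
have ZZ' x : csup Z x <= csup Z' x.
  by apply: csup_le => n; exact: (csup_ubound Z' n.+1 x).
have Z'max : \int[P]_x psi (csup Z') x <= \int[P]_x psi (csup Z) x.
  by apply: le_trans Zmax; apply: ereal_sup_ubound; exists Z'.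
pose g x := (contract (csup Z' x) - contract (csup Z x))%:E.
have g0 x : 0 <= g x by rewrite lee_fin subr_ge0 le_contract; exact: ZZ'.
have mg : measurable_fun setT g.
  by apply/measurable_EFinP; apply: measurable_funB; exact: measurable_fun_contract.
have psiZ : \int[P]_x psi (csup Z) x \is a fin_num.
  rewrite ge0_fin_numE; last exact: integral_ge0.
  apply: (@le_lt_trans _ _ 2%:E); last exact: ltry.
  rewrite -(integral_probability_cst P 2%:E).
  by apply: ge0_le_integral => //; exact: mpsi.
have I0 : \int[P]_x `|g x| = 0.
  have -> : \int[P]_x `|g x| = \int[P]_x g x by apply: eq_integral => x _; rewrite gee0_abs.
  apply/eqP; rewrite eq_le; apply/andP; split; last exact: integral_ge0.
  rewrite -(leeD2lE _ _ psiZ) adde0 -ge0_integralD//; last exact: mpsi.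
  apply: le_trans Z'max; rewrite le_eqVlt; apply/orP; left; apply/eqP.
  by apply: eq_integral => x _; rewrite -EFinD; congr _%:E; rewrite addrA addrAC addrK.
move/ae_eq_integral_abs : I0 => /(_ measurableT mg) I0.
apply: (aeS I0) => x /(_ I) [] /eqP; rewrite subr_eq0 => /eqP/contract_inj <-.
exact: (csup_ubound Z' 0%N x).
Qed.

End ess_sup_exists.

Section family_ess_sup.
Context {d} {Omega : measurableType d} {R : realType}.
Variables (P : probability Omega R) (G : set_system Omega).
Hypotheses (sG : sigma_algebra setT G) (Gm : G `<=` measurable).
Local Open Scope ereal_scope.

Lemma erv_measurableT (f : Omega -> \bar R) :
  erv_measurable G f -> measurable_fun setT f.
Proof.
move=> mf _ B mB; apply: Gm; apply: (@g_measurableP _ _ G) => //.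
exact: mf.
Qed.

Lemma rv_measurableT (f : Omega -> R) :
  rv_measurable G f -> measurable_fun setT f.
Proof.
move=> mf _ B mB; apply: Gm; apply: (@g_measurableP _ _ G) => //.
exact: mf.
Qed.

(** A countable supremum is G-measurable, and countably many almost sure bounds hold simultaneously;
    hence it is least among the upper bounds. *)
Lemma is_ess_sup_csup (U : set (Omega -> \bar R)) : U !=set0 ->
  (forall Z, U Z -> erv_measurable G Z) ->
  exists Z : nat -> Omega -> \bar R, (forall n, U (Z n)) /\
    is_ess_sup P G U (csup Z).
Proof.
move=> U0 mU.
have [Z [UZ Zub]] := ess_sup_countable P U0 (fun Z UZ => erv_measurableT (mU Z UZ)).
exists Z; split => //; split => //.
- by apply: (@measurable_csup _ (g_sigma_algebraType G)) => n; exact: mU.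
- move=> Y' _ ub; have := ae_foralln (fun n => ub _ (UZ n)).
  by move=> h; apply: (aeS h) => x {}h; exact: csup_le.
Qed.

Lemma family_ess_supP (U : set (Omega -> \bar R)) : U !=set0 ->
  (forall Z, U Z -> erv_measurable G Z) ->
  is_ess_sup P G U (family_ess_sup P G U).
Proof.
move=> U0 mU; have [Z [_ ZP]] := is_ess_sup_csup U0 mU.
exact: (@xgetPex _ (cst -oo) [set Y | is_ess_sup P G U Y] (ex_intro _ _ ZP)).
Qed.

End family_ess_sup.

(** * Functionals on L_p *)

Section Lp_spaces.
Context {d} {Omega : measurableType d} {R : realType}.
Variables (P : probability Omega R) (p : R) (hp : 1 <= p).
Implicit Types (G : set_system Omega) (X Y Z : Omega -> R).

Let p0 : p != 0. Proof. by rewrite gt_eqF// (lt_le_trans ltr01). Qed.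
Let pp : 0 < p. Proof. exact: lt_le_trans ltr01 hp. Qed.

Lemma finite_normP X :
  finite_norm P p%:E X <-> (\int[P]_x (`|X x| `^ p)%:E < +oo)%E.
Proof.
have NE : ('N[P]_p%:E[EFin \o X] `^ p = \int[P]_x (`|X x| `^ p)%:E)%E.
  by rewrite poweR_Lnorm//; apply: eq_integral => x _; rewrite -poweR_EFin.
split => [h|]; first by rewrite -NE; exact: poweR_lty.
by rewrite -NE; exact: lty_poweRy.
Qed.

Lemma Lp_spaceP G X : Lp_space P p G X <->
  rv_measurable G X /\ (\int[P]_x (`|X x| `^ p)%:E < +oo)%E.
Proof. by split => -[mX /finite_normP]. Qed.

Section closure.
Variable G : set_system Omega.
Hypotheses (sG : sigma_algebra setT G) (Gm : G `<=` measurable).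
Local Notation D := (Lp_space P p G).

Lemma measurable_powR_norm X : rv_measurable G X ->
  measurable_fun setT (fun x => (`|X x| `^ p)%:E).
Proof.
move=> mX; apply/measurable_EFinP.
apply: (measurableT_comp (measurable_powR p)).
by apply: measurableT_comp => //; exact: (rv_measurableT sG Gm).
Qed.

Lemma Lp_space_le X Y : rv_measurable G X -> D Y ->
  (\forall x \ae P, `|X x| <= `|Y x|) -> D X.
Proof.
move=> mX /Lp_spaceP[mY Yoo] XY; apply/Lp_spaceP; split => //.
apply: le_lt_trans Yoo; apply: ae_ge0_le_integral => //.
- exact: measurable_powR_norm.
- exact: measurable_powR_norm.
- by apply: (aeS XY) => x h _; rewrite lee_fin ge0_ler_powR// ?ltW// nnegrE.
Qed.

Lemma Lp_space_Lfun X : D X <-> rv_measurable G X /\ X \in Lfun P p%:E.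
Proof.
split=> -[mX h]; split => //.
  by rewrite inE/=; apply/andP; split; rewrite inE//=; exact: rv_measurableT mX.
by move: h; rewrite inE => /andP[_]; rewrite inE.
Qed.

Let p1 : (1%:E <= p%:E)%E. Proof. by rewrite lee_fin. Qed.

Lemma Lp_space_lin (a : R) X Y : D X -> D Y -> D (fun x => a * X x + Y x).
Proof.
move=> /Lp_space_Lfun[mX hX] /Lp_space_Lfun[mY hY]; apply/Lp_space_Lfun; split.
  by apply: measurable_funD => //; exact: measurable_funM.
have [_ h] := Lfun_submod_closed P p1.
have -> : (fun x => a * X x + Y x) = a *: X + Y by [].
exact: h.
Qed.

Lemma Lp_space_cst (c : R) : D (cst c).
Proof.
apply/Lp_space_Lfun; split; first exact: measurable_cst.
exact: Lfun_cst.
Qed.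

Lemma Lp_spaceD X Y : D X -> D Y -> D (X \+ Y).
Proof.
move=> DX DY; have -> : X \+ Y = (fun x => 1 * X x + Y x).
  by apply/funext => x; rewrite mul1r.
exact: Lp_space_lin.
Qed.

Lemma Lp_spaceZ (a : R) X : D X -> D (fun x => a * X x).
Proof.
move=> DX; have -> : (fun x => a * X x) = (fun x => a * X x + cst 0 x).
  by apply/funext => x; rewrite addr0.
by apply: Lp_space_lin => //; exact: Lp_space_cst.
Qed.

Lemma Lp_spaceN X : D X -> D (\- X).
Proof.
move=> DX; have -> : \- X = (fun x => -1 * X x).
  by apply/funext => x; rewrite mulN1r.
exact: Lp_spaceZ.
Qed.

Lemma Lp_spaceB X Y : D X -> D Y -> D (X \- Y).
Proof. by move=> DX DY; apply: Lp_spaceD => //; exact: Lp_spaceN. Qed.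

Lemma Lp_space_norm X : D X -> D (Num.norm \o X).
Proof.
move=> DX; have [mX _] := DX; apply: (Lp_space_le _ DX).
  exact: rv_measurable_norm.
by apply: aeW => x /=; rewrite normr_id.
Qed.

Lemma Lp_space_patch X Y (A : set Omega) : G A -> D X -> D Y -> D (patch Y A X).
Proof.
move=> GA DX DY; have [mX _] := DX; have [mY _] := DY.
apply: (Lp_space_le _ (Lp_spaceD (Lp_space_norm DX) (Lp_space_norm DY))).
  exact: rv_measurable_patch.
apply: aeW => x /=; rewrite [leRHS]ger0_norm ?addr_ge0//.
by rewrite /patch; case: ifP => _; rewrite ?lerDl ?lerDr.
Qed.

Lemma Lp_space_max X Y : D X -> D Y -> D (fun x => Num.max (X x) (Y x)).
Proof.
move=> DX DY; have [mX _] := DX; have [mY _] := DY.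
apply: (Lp_space_le _ (Lp_spaceD (Lp_space_norm DX) (Lp_space_norm DY))).
  exact: measurable_maxr.
apply: aeW => x /=; rewrite [leRHS]ger0_norm ?addr_ge0//.
by case: (leP (X x) (Y x)) => _; rewrite ?lerDl ?lerDr.
Qed.

Lemma Lp_space_bounded X (K : R) : rv_measurable G X ->
  (\forall x \ae P, `|X x| <= K) -> D X.
Proof.
move=> mX XK; apply: (Lp_space_le mX (Lp_space_cst K)).
by apply: (aeS XK) => x h; apply: le_trans h _; exact: ler_norm.
Qed.

Lemma Lp_space_integrable X : D X -> P.-integrable setT (EFin \o X).
Proof.
move=> /Lp_space_Lfun[mX hX]; apply/Lfun1_integrable.
by apply: Lfun_subset hX => //; rewrite fin_num_measure.
Qed.

(* With n_k chosen so that E (Z_(n_k))^p is tiny,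
   f = (sum_k ((k+1) Z_(n_k))^p)^(1/p) dominates every multiple k Z_(n_k). *)
Lemma Lp_dominating (Z : nat -> Omega -> R) :
  (forall n, D (Z n)) -> (forall n x, 0 <= Z n x) ->
  (forall e, 0 < e -> exists n, (\int[P]_x (Z n x `^ p)%:E <= e%:E)%E) ->
  exists f, [/\ D f, forall x, 0 <= f x &
    forall k : nat, exists n, \forall x \ae P, k%:R * Z n x <= f x].
Proof.
move=> DZ Z0 Zlim.
pose r (k : nat) : R := 1 / (2 ^ (k + 1))%:R.
have r0 k : 0 < r k by rewrite divr_gt0// ltr0n expn_gt0.
(* After multiplication by (k+1)^p the bound on the k-th integral is [r k] = 2^-(k+1), which is
   summable. *)
have /choice[N NP] : forall k, exists n,
    (\int[P]_x (Z n x `^ p)%:E <= (r k / k.+1%:R `^ p)%:E)%E.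
  by move=> k; apply: Zlim; rewrite divr_gt0.
pose u k x := ((k.+1%:R `^ p) * Z (N k) x `^ p)%:E.
have u0 k x : (0 <= u k x)%E by rewrite lee_fin mulr_ge0 ?powR_ge0.
have mZp n : @measurable_fun _ _ (g_sigma_algebraType G) _ setT (fun x => (Z n x `^ p)).
  by apply: (measurableT_comp (measurable_powR p)); have [] := DZ n.
have muG k : erv_measurable G (u k).
  by apply: erv_measurable_EFin; apply: measurable_funM.
have mu k : measurable_fun setT (u k) by exact: (erv_measurableT sG Gm).
pose h x := (\sum_(k <oo) u k x)%E.
have h0 x : (0 <= h x)%E by exact: nneseries_ge0.
have mhG : erv_measurable G h.
  by apply: (@ge0_emeasurable_sum _ (g_sigma_algebraType G)) => n *; [exact: u0|exact: muG].
have mh : measurable_fun setT h by exact: (erv_measurableT sG Gm).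
have hoo : (\int[P]_x h x < +oo)%E.
  rewrite integral_nneseries//; apply: (@le_lt_trans _ _ (\sum_(k <oo) (r k)%:E)%E).
    apply: lee_nneseries => [k _ _|k _]; first exact: integral_ge0.
    rewrite /u; under eq_integral do rewrite EFinM.
    rewrite ge0_integralZl//.
    - apply: (@le_trans _ _ ((k.+1%:R `^ p)%:E * (r k / k.+1%:R `^ p)%:E)%E).
        by rewrite lee_pmul// ?lee_fin ?powR_ge0//; apply: integral_ge0 => x _; rewrite lee_fin powR_ge0.
      by rewrite -EFinM lee_fin mulrC divfK// gt_eqF.
    - by apply: (erv_measurableT sG Gm); exact: (erv_measurable_EFin (mZp _)).
    - by move=> x _; rewrite lee_fin powR_ge0.
  suff -> : (\sum_(k <oo) (r k)%:E = (1 / 2 ^+ 0)%:E)%E by exact: ltry.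
  exact: (cvg_lim _ (@cvg_geometric_eseries_half R 1 0)).
have hfin : \forall x \ae P, h x \is a fin_num.
  have ih : P.-integrable setT h.
    by apply/integrableP; split => //; under eq_integral do rewrite gee0_abs//.
  by apply: (aeS (integrable_ae measurableT ih)) => x; exact.
exists (fun x => fine (h x) `^ p^-1); split.
- apply/Lp_spaceP; split.
    apply: (measurableT_comp (measurable_powR p^-1)).
    by apply: measurableT_comp => //; exact: mhG.
  apply: le_lt_trans hoo; apply: ge0_le_integral => //.
  + apply/measurable_EFinP; apply: (measurableT_comp (measurable_powR p)).
    apply: measurableT_comp => //; apply: (measurableT_comp (measurable_powR p^-1)).
    exact: measurableT_comp.
  + move=> x _; rewrite ger0_norm ?powR_ge0// -powRrM mulVf// powRr1 ?fine_ge0//.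
    by case: (h x) (h0 x) => //= *; exact: leey.
- by move=> x; exact: powR_ge0.
- move=> k; exists (N k); apply: (aeS hfin) => x hx.
  have kZ0 : 0 <= k%:R * Z (N k) x by rewrite mulr_ge0.
  have -> : k%:R * Z (N k) x = ((k%:R * Z (N k) x) `^ p) `^ p^-1.
    by rewrite -powRrM mulfV// powRr1.
  apply: ge0_ler_powR; [by rewrite invr_ge0 ltW|by rewrite nnegrE powR_ge0|
    by rewrite nnegrE fine_ge0|].
  rewrite -lee_fin fineK//; apply: (@le_trans _ _ (u k x)).
    rewrite lee_fin -powRM//; apply: ge0_ler_powR; [exact: ltW|
      by rewrite nnegrE|by rewrite nnegrE mulr_ge0|].
    by rewrite ler_wpM2r// ler_nat.
  rewrite /h; apply: le_trans (nneseries_lim_ge k.+1 _); last by move=> *; exact: u0.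
  by rewrite big_nat_recr//= leeDr//; apply: sume_ge0.
Qed.

(** This is the automatic continuity. If every N(Z n) exceeded e, the f of [Lp_dominating] would
    satisfy k e < N f for every positive k. Only monotonicity above 0 and integer homogeneity are
    assumed, so that the lemma covers linear functionals and X |-> rhobar(-X) alike. *)
Lemma Lp_positive_functional_small (N : (Omega -> R) -> R) (Z : nat -> Omega -> R) :
  (forall X Y, D X -> D Y -> (\forall x \ae P, 0 <= X x) ->
    (\forall x \ae P, X x <= Y x) -> N X <= N Y) ->
  (forall (k : nat) X, D X -> N (fun x => k%:R * X x) = k%:R * N X) ->
  (forall n, D (Z n)) -> (forall n x, 0 <= Z n x) ->
  (forall e, 0 < e -> exists n, (\int[P]_x (Z n x `^ p)%:E <= e%:E)%E) ->
  forall e, 0 < e -> exists n, N (Z n) <= e.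
Proof.
move=> Nmono NZ DZ Z0 Zlim e e0; apply: contrapT => /forallNP H.
have [f [Df f0 fP]] := Lp_dominating DZ Z0 Zlim.
have [n nP] := fP (Num.truncn (`|N f| / e)).+1.
have := Nmono _ _ (Lp_spaceZ (Num.truncn (`|N f| / e)).+1%:R (DZ n)) Df.
move=> /(_ _ nP); rewrite NZ// => h.
have {}h := h (aeW P (fun x => mulr_ge0 (ler0n _ _) (Z0 n x))).
have : `|N f| < (Num.truncn (`|N f| / e)).+1%:R * e.
  by rewrite -ltr_pdivrMr//; exact: truncnS_gt.
have : (Num.truncn (`|N f| / e)).+1%:R * e < (Num.truncn (`|N f| / e)).+1%:R * N (Z n).
  by rewrite ltr_pM2l// ltNge; exact/negP/H.
by move=> /lt_le_trans/(_ h) h1 h2; have := lt_le_trans (lt_trans h2 h1) (ler_norm _); rewrite ltxx.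
Qed.

(** This is the distance from X to its truncation to [-n, n]. *)
Definition excess X (n : nat) (x : Omega) : R := Num.max (`|X x| - n%:R) 0.

Lemma excess_ge0 X n x : 0 <= excess X n x.
Proof. by rewrite le_max lexx orbT. Qed.

Lemma excess_le X n x : excess X n x <= `|X x|.
Proof. by rewrite ge_max normr_ge0 gerBl ler0n. Qed.

Lemma Lp_space_excess X n : D X -> D (excess X n).
Proof.
move=> DX; have [mX _] := DX; apply: (Lp_space_le _ DX).
  apply: measurable_maxr => //; apply: measurable_funB => //.
  exact: rv_measurable_norm.
by apply: aeW => x; rewrite ger0_norm ?excess_ge0// excess_le.
Qed.

Lemma Lp_dominated_small (Z : nat -> Omega -> R) Y :
  (forall n, D (Z n)) -> D Y -> (forall n x, 0 <= Z n x <= Y x) ->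
  (forall x, Z n x @[n --> \oo] --> (0 : R)) ->
  forall e, 0 < e -> exists n, (\int[P]_x (Z n x `^ p)%:E <= e%:E)%E.
Proof.
move=> DZ DY ZY Zcvg e e0; have /Lp_spaceP[mY Yoo] := DY.
have Z0 n x : 0 <= Z n x by case/andP: (ZY n x).
have mE n : measurable_fun setT (fun x => (Z n x `^ p)%:E).
  have [mE _] := DZ n.
  have -> : (fun x => (Z n x `^ p)%:E) = (fun x => (`|Z n x| `^ p)%:E).
    by apply/funext => x; rewrite ger0_norm.
  exact: measurable_powR_norm.
have cv : (\int[P]_x (Z n x `^ p)%:E @[n --> \oo] --> \int[P]_x (cst 0%E x))%E.
  have dc := @dominated_convergence _ _ _ P setT measurableT
    (fun n x => (Z n x `^ p)%:E) (cst 0%E) (fun x => (`|Y x| `^ p)%:E)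
    mE (measurable_cst _).
  have [|||_ _] := dc.
  - apply: aeW => x _; apply: cvg_EFin; first exact: nearW.
    apply/cvgrPdist_le => /= eps eps0.
    have /cvgrPdist_le/(_ (eps `^ p^-1) (powR_gt0 _ eps0)) := Zcvg x.
    apply: filterS => n; rewrite !sub0r !normrN (ger0_norm (Z0 n x)) => h.
    rewrite ger0_norm ?powR_ge0//.
    have -> : eps = (eps `^ p^-1) `^ p by rewrite -powRrM mulVf// powRr1// ltW.
    by apply: ge0_ler_powR; [exact: ltW|rewrite nnegrE|rewrite nnegrE powR_ge0|].
  - apply/integrableP; split; first exact: measurable_powR_norm.
    by under eq_integral do rewrite gee0_abs ?lee_fin ?powR_ge0//.
  - apply: aeW => x n _; rewrite gee0_abs ?lee_fin ?powR_ge0//.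
    apply: ge0_ler_powR; [exact: ltW|by rewrite nnegrE|by rewrite nnegrE|].
    by apply: le_trans (ler_norm _); case/andP: (ZY n x).
  exact.
rewrite integral0 in cv.
have /fine_cvgP[fin /cvgrPdist_le/(_ _ e0)] := cv.
move=> ev; have [n _ nP] : \forall n \near \oo,
    (\int[P]_x (Z n x `^ p)%:E)%E \is a fin_num /\
    `|0 - fine (\int[P]_x (Z n x `^ p)%:E)%E| <= e.
  by near=> n; split; near: n.
exists n; have [nfin] := nP n (leqnn n).
rewrite sub0r normrN => nle.
by rewrite -(fineK nfin) lee_fin; apply: le_trans nle; exact: ler_norm.
Unshelve. all: by end_near.
Qed.

Lemma excess_cvg0 X x : excess X n x @[n --> \oo] --> (0 : R).
Proof.
apply: cvg_near_cst; exists (Num.truncn `|X x|).+1 => // n /= nX.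
rewrite /excess max_r// subr_le0.
by apply: le_trans (ltW (truncnS_gt _)) _; rewrite ler_nat.
Qed.

Lemma excess_small X : D X -> forall e, 0 < e ->
  exists n, (\int[P]_x (excess X n x `^ p)%:E <= e%:E)%E.
Proof.
move=> DX; apply: (@Lp_dominated_small _ (Num.norm \o X)).
- by move=> n; exact: Lp_space_excess.
- exact: Lp_space_norm.
- by move=> n x; rewrite excess_ge0 excess_le.
- exact: excess_cvg0.
Qed.

(** * Daniell-Riesz representation of positive functionals on L_p *)

Section positive_functional.
Variable N : (Omega -> R) -> R.
Hypotheses (ND : forall X Y, D X -> D Y -> N (X \+ Y) = N X + N Y)
  (NZ : forall a X, D X -> N (fun x => a * X x) = a * N X)
  (N0 : forall X, D X -> (\forall x \ae P, 0 <= X x) -> 0 <= N X).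

Lemma positive_functionalB X Y : D X -> D Y -> N (X \- Y) = N X - N Y.
Proof.
move=> DX DY; have -> : X \- Y = X \+ (fun x => -1 * Y x).
  by apply/funext => x /=; rewrite mulN1r.
by rewrite ND ?NZ ?mulN1r//; exact: Lp_spaceZ.
Qed.

Lemma positive_functional_le X Y : D X -> D Y ->
  (\forall x \ae P, X x <= Y x) -> N X <= N Y.
Proof.
move=> DX DY XY; rewrite -subr_ge0 -positive_functionalB//.
by apply: N0; [exact: Lp_spaceB|apply: (aeS XY) => x h; rewrite subr_ge0].
Qed.

Lemma positive_functional_small (Z : nat -> Omega -> R) Y :
  (forall n, D (Z n)) -> D Y -> (forall n x, 0 <= Z n x <= Y x) ->
  (forall x, Z n x @[n --> \oo] --> (0 : R)) ->
  forall e, 0 < e -> exists n, N (Z n) <= e.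
Proof.
move=> DZ DY ZY Zcvg; apply: Lp_positive_functional_small => //.
- by move=> X1 X2 D1 D2 _; exact: positive_functional_le.
- by move=> k X; exact: NZ.
- by move=> n x; case/andP: (ZY n x).
- exact: Lp_dominated_small ZY Zcvg.
Qed.

Lemma positive_functional_sum (I : Type) (r : seq I) (X : I -> Omega -> R) :
  (forall i, D (X i)) -> D (fun x => \sum_(i <- r) X i x) /\
  N (fun x => \sum_(i <- r) X i x) = \sum_(i <- r) N (X i).
Proof.
move=> DX; elim: r => [|i r [IH1 IH2]].
  have -> : (fun x => \sum_(i <- [::]) X i x) = (fun x => 0 * cst 0 x).
    by apply/funext => x; rewrite big_nil mul0r.
  have D0 : D (cst 0) by exact: Lp_space_cst.
  by rewrite NZ// big_nil mul0r; split => //; exact: Lp_spaceZ.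
have -> : (fun x => \sum_(i <- i :: r) X i x) = X i \+ (fun x => \sum_(i <- r) X i x).
  by apply/funext => x; rewrite big_cons.
by rewrite ND// big_cons IH2; split => //; exact: Lp_spaceD.
Qed.

Lemma Lp_space_indic A : G A -> D (\1_A : Omega -> R).
Proof.
move=> GA; apply: (@Lp_space_bounded _ 1).
  by apply: measurable_indic; exact: g_measurableE.
by apply: aeW => x; rewrite indicE ger0_norm// lern1 leq_b1.
Qed.

(** The value 0 off G keeps nu nonnegative on all sets; G, being a sigma-algebra, contains every
    measurable set. *)
Let nu (A : set (g_sigma_algebraType G)) : \bar R :=
  if `[< G A >] then (N \1_A)%:E else 0%E.

Let nuE A : G A -> nu A = (N \1_A)%:E.
Proof. by move=> GA; rewrite /nu asboolT. Qed.

Let N00 : N (cst 0) = 0.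
Proof.
have -> : cst 0 = (fun x : Omega => 0 * cst 0 x :> R) by apply/funext => x; rewrite mul0r.
by rewrite NZ ?mul0r//; exact: Lp_space_cst.
Qed.

Let GsU (A : nat -> set Omega) : (forall n, G (A n)) -> G (\bigcup_n A n).
Proof. by case: sG => _ _; exact. Qed.

(** The indicators of the tails of a disjoint union are dominated by 1 and tend to 0 pointwise, so N
    is small on them by automatic continuity. *)
Let nu_sigma : semi_sigma_additive nu.
Proof.
move=> A mA tA _; have GA n : G (A n) by exact: g_measurableP.
have GU := GsU GA; rewrite nuE//.
pose tail n := \bigcup_i (if (n <= i)%N then A i else set0).
have G0 : G set0 by case: sG.
have Gtail n : G (tail n) by apply: GsU => i; case: ifP.
have splitE n : \1_(\bigcup_i A i) = (fun x => \sum_(0 <= i < n) \1_(A i) x) \+ \1_(tail n) :> (Omega -> R).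
  elim: n => [|n IH].
    by apply/funext => x; rewrite /= big_geq// add0r.
  rewrite IH; apply/funext => x /=; rewrite big_nat_recr//= -addrA; congr (_ + _).
  have -> : tail n = A n `|` tail n.+1.
    apply/seteqP; split => [y [i _]|y [Any|[i _]]].
    - case: ifPn => // ni Aiy; move: ni; rewrite leq_eqVlt => /predU1P[->|ni].
        by left.
      by right; exists i => //; rewrite ni.
    - by exists n => //; rewrite leqnn.
    - by case: ifPn => // ni Aiy; exists i => //; rewrite (ltnW ni).
  rewrite !indicE in_setU; case: (boolP (x \in A n)) => [/set_mem Any|_] /=.
    rewrite memNset ?addr0// => -[i _].
    case: ifPn => // ni Aiy; have /trivIsetP/(_ n i I I) := tA.
    by rewrite (ltn_eqF ni) => /(_ isT); rewrite -subset0 => /(_ x); apply.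
  by rewrite add0r.
have NE n : (\sum_(0 <= i < n) nu (A i) = (N \1_(\bigcup_i A i) - N \1_(tail n))%:E)%E.
  under eq_bigr do rewrite nuE//; rewrite sumEFin; congr _%:E.
  have [D1 <-] := positive_functional_sum (index_iota 0 n) (fun i => Lp_space_indic (GA i)).
  by rewrite (splitE n) ND ?addrK//; exact: Lp_space_indic.
have tail_small e : 0 < e -> exists n, N \1_(tail n) <= e.
  apply: (@positive_functional_small _ (cst 1)).
  - by move=> n; exact: Lp_space_indic.
  - exact: Lp_space_cst.
  - by move=> n x; rewrite indicE ler0n/= lern1 leq_b1.
  - move=> x; apply: cvg_near_cst.
    have [[i _ Aix]|nA] := pselect ((\bigcup_i A i) x); last first.
      exists 0%N => // n _; rewrite indicE memNset// => -[i _].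
      by case: ifPn => // _ Aix; apply: nA; exists i.
    exists i.+1 => // n /= ni; rewrite indicE memNset// => -[j _].
    case: ifPn => // nj Ajx; have /trivIsetP/(_ i j I I) := tA.
    by rewrite (ltn_eqF (leq_trans ni nj)) => /(_ isT); rewrite -subset0 => /(_ x); apply.
under eq_fun do rewrite NE.
apply: cvg_EFin; first exact: nearW.
apply/cvgrPdist_le => /= e e0; have [n0 n0e] := tail_small e e0.
exists n0 => // n /= n0n; rewrite opprB addrC subrK ger0_norm; last first.
  by apply: N0; [exact: Lp_space_indic|apply: aeW => x; rewrite indicE].
apply: le_trans n0e; apply: positive_functional_le; [exact: Lp_space_indic..|].
apply: aeW => x; rewrite !indicE ler_nat; case: (boolP (x \in tail n)) => //.
rewrite inE => -[i _]; case: ifPn => // ni Aix; rewrite mem_set//.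
by exists i => //; rewrite (leq_trans n0n ni).
Qed.

Import HBNNSimple.

(** Both functionals agree on simple functions. The increasing approximations f n of X satisfy 0 <=
    X - f n <= X and converge to X, so [positive_functional_small] controls the remainder. *)
Lemma positive_functional_measure :
  exists mu : {measure set (g_sigma_algebraType G) -> \bar R},
    (forall A, G A -> mu A = (N \1_A)%:E) /\
    forall X, D X -> (forall x, 0 <= X x) -> (\int[mu]_x (X x)%:E = (N X)%:E)%E.
Proof.
have nu0 : nu set0 = 0%E.
  by rewrite nuE; [rewrite indic0 N00|case: sG].
have nu_ge0 A : (0 <= nu A)%E.
  rewrite /nu; case: asboolP => // GA; rewrite lee_fin; apply: N0.
    exact: Lp_space_indic.
  by apply: aeW => x; rewrite indicE.
pose M := isMeasure.Build _ _ _ nu nu0 nu_ge0 nu_sigma.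
pose mu := HB.pack_for {measure set (g_sigma_algebraType G) -> \bar R} nu M.
exists mu; split; first exact: nuE.
move=> X DX X0; have [mX _] := DX.
have mXE : @measurable_fun _ _ (g_sigma_algebraType G) _ setT (EFin \o X).
  exact: erv_measurable_EFin.
pose f := nnsfun_approx measurableT mXE.
have fX n x : f n x <= X x.
  by rewrite nnsfun_approxE -lee_fin; apply: (@le_approx _ _ _ setT (EFin \o X)) => // y _; rewrite lee_fin.
have Df n : D (f n).
  apply: (Lp_space_le _ DX); first exact: measurable_funP.
  by apply: aeW => x; rewrite !ger0_norm.
have fN n : (\int[mu]_x (f n x)%:E = (N (f n))%:E)%E.
  rewrite integralT_nnsfun sintegralE.
  rewrite fsbig_finite//= .
  have -> : N (f n) = N (fun x => \sum_(r <- fset_set (range (f n))) r * \1_(f n @^-1` [set r]) x).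
    by congr N; apply/funext => x; rewrite [LHS]fimfunE fsbig_finite.
  have Gpre r : G (f n @^-1` [set r]) by exact: g_measurableP.
  have [_ ->] := positive_functional_sum (fset_set (range (f n)))
    (fun r => Lp_spaceZ r (Lp_space_indic (Gpre r))).
  rewrite -sumEFin; apply: eq_bigr => r _.
  by rewrite NZ ?EFinM ?nuE//; exact: Lp_space_indic.
apply/eqP; rewrite eq_le; apply/andP; split.
  have -> : (\int[mu]_x (X x)%:E = limn (fun n => \int[mu]_x (f n x)%:E))%E.
    rewrite -monotone_convergence//.
    - apply: eq_integral => x _; apply/esym/cvg_lim => //.
      by apply: cvg_nnsfun_approx => // y _; rewrite lee_fin.
    - by move=> n; exact/measurable_EFinP/measurable_funP.
    - by move=> n x _; rewrite lee_fin.
    - by move=> x _ m n mn; rewrite lee_fin; exact/lefP/nd_nnsfun_approx.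
  apply: lime_le.
    apply: ereal_nondecreasing_is_cvgn => m n mn; apply: ge0_le_integral => //.
    - by move=> x _; rewrite lee_fin.
    - exact/measurable_EFinP/measurable_funP.
    - exact/measurable_EFinP/measurable_funP.
    - by move=> x _; rewrite lee_fin; exact/lefP/nd_nnsfun_approx.
  apply: nearW => n; rewrite fN lee_fin; apply: positive_functional_le => //.
  exact: aeW.
apply/lee_addgt0Pr => e e0.
have [n nP] : exists n, N (X \- f n) <= e.
  apply: (@positive_functional_small (fun n => X \- f n) X) => //.
  - by move=> n; exact: Lp_spaceB.
  - by move=> n x /=; rewrite subr_ge0 fX gerBl; exact: fun_ge0.
  - move=> x; have cf : f n x @[n --> \oo] --> X x.
      have h : (EFin \o (fun n => f n x)) @ \oo --> (X x)%:E.
        by apply: (cvg_nnsfun_approx measurableT mXE _ I) => y _; rewrite lee_fin.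
      exact: (fine_cvg h).
    by rewrite -[X in _ --> X](subrr (X x)); apply: cvgB => //; exact: cvg_cst.
apply: (@le_trans _ _ (\int[mu]_x (f n x)%:E + e%:E)%E).
  rewrite fN -EFinD lee_fin -lerBlDl.
  by rewrite -positive_functionalB.
rewrite leeD2r//; apply: ge0_le_integral => //.
- by move=> x _; rewrite lee_fin.
- exact/measurable_EFinP/measurable_funP.
- by move=> x _; rewrite lee_fin.
Qed.

End positive_functional.

End closure.
End Lp_spaces.

(** * Locality and subgradients of the risk measure *)

Section expectation.
Context {d} {T : measurableType d} {R : realType} (mu : probability T R).

Lemma EFin_Rintegral (f : T -> R) : mu.-integrable setT (EFin \o f) ->
  (\int[mu]_x f x)%:E = (\int[mu]_x (f x)%:E)%E.
Proof. by move=> i_f; rewrite fineK//; exact: integrable_fin_num. Qed.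

Lemma ae_le_Rintegral (f g : T -> R) : mu.-integrable setT (EFin \o f) ->
  mu.-integrable setT (EFin \o g) -> (\forall x \ae mu, f x <= g x) ->
  \int[mu]_x f x <= \int[mu]_x g x.
Proof.
move=> i_f i_g fg.
have mf : measurable_fun setT f by apply/measurable_EFinP; exact: measurable_int i_f.
have mg : measurable_fun setT g by apply/measurable_EFinP; exact: measurable_int i_g.
have mm : measurable_fun setT (fun x => Num.max (f x) (g x)) by exact: measurable_maxr.
(* The maximum of f and g equals g almost everywhere and dominates f everywhere. *)
have E : (\int[mu]_x (g x)%:E = \int[mu]_x (Num.max (f x) (g x))%:E)%E.
  apply: ae_eq_integral => //.
  - exact/measurable_EFinP.
  - exact/measurable_EFinP.
  - by apply: (aeS fg) => x h _; rewrite max_r.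
have im : mu.-integrable setT (EFin \o (fun x => Num.max (f x) (g x))).
  have /integrableP[_ fo] := i_f; have /integrableP[_ go] := i_g.
  apply/integrableP; split; first exact/measurable_EFinP.
  apply: (@le_lt_trans _ _ (\int[mu]_x (`|(f x)%:E| + `|(g x)%:E|)))%E.
    apply: ge0_le_integral => //.
    - by apply: measurableT_comp => //; exact/measurable_EFinP.
    - apply: emeasurable_funD; apply: measurableT_comp => //; exact/measurable_EFinP.
    - move=> x _ /=; rewrite -EFinD lee_fin.
      by case: (leP (f x) (g x)) => _; rewrite ?lerDl ?lerDr.
  rewrite ge0_integralD//; first exact: lte_add_pinfty.
    by apply: measurableT_comp => //; exact/measurable_EFinP.
  by apply: measurableT_comp => //; exact/measurable_EFinP.
rewrite {2}/Rintegral E; apply: le_Rintegral => // x _.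
by rewrite le_max lexx.
Qed.

Lemma Rintegral_probability_cst (c : R) : \int[mu]_x c = c.
Proof. by rewrite /Rintegral integral_probability_cst. Qed.

End expectation.

Section risk_measure.
Context {d} {Omega : measurableType d} {R : realType}.
Variables (P : probability Omega R) (T : R) (F : R -> set_system Omega) (p : R).
Variable rho : R -> R -> (Omega -> R) -> Omega -> R.
Hypotheses (hF : complete_filtration P T F) (hp : 1 <= p)
  (hrho : fully_dynamic_crm P T F p rho).
Implicit Types X Y Z : Omega -> R.
Local Notation D t := (Lp_space P p (F t)).

Lemma Lp_space_mono s t X : 0 <= s -> s <= t -> t <= T -> D s X -> D t X.
Proof.
move=> s0 st tT [mX nX]; split => //; apply: rv_measurableS mX.
exact: filtration_mono hF _ _ _ _ _.
Qed.

Section one_step.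
Variables (s t : R).
Hypotheses (s0 : 0 <= s) (st : s <= t) (tT : t <= T).

Let sF : sigma_algebra setT (F s).
Proof. by apply: (filtration_sigma hF); rewrite s0 (le_trans st). Qed.
Let tF : sigma_algebra setT (F t).
Proof. by apply: (filtration_sigma hF); rewrite (le_trans s0). Qed.
Let sm : F s `<=` measurable.
Proof. by apply: (filtration_sub hF); rewrite s0 (le_trans st). Qed.
Let tm : F t `<=` measurable.
Proof. by apply: (filtration_sub hF); rewrite (le_trans s0). Qed.
Let stF : F s `<=` F t. Proof. exact: (filtration_mono hF). Qed.
Let Dst X : D s X -> D t X. Proof. exact: Lp_space_mono. Qed.

Let rho_maps X : D t X -> D s (rho s t X). Proof. exact: (crm_maps hrho). Qed.
Let rho_mono X Y : D t X -> D t Y -> (\forall x \ae P, Y x <= X x) ->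
  \forall x \ae P, rho s t X x <= rho s t Y x.
Proof. exact: (crm_monotone hrho). Qed.
Let rho_transl X f : D t X -> D s f ->
  \forall x \ae P, rho s t (X \+ f) x = rho s t X x - f x.
Proof. exact: (crm_translation hrho). Qed.

Lemma crm_congr X Y : D t X -> D t Y -> (\forall x \ae P, X x = Y x) ->
  \forall x \ae P, rho s t X x = rho s t Y x.
Proof.
move=> DX DY XY.
have a : \forall x \ae P, rho s t X x <= rho s t Y x.
  by apply: rho_mono => //; apply: (aeS XY) => x ->.
have b : \forall x \ae P, rho s t Y x <= rho s t X x.
  by apply: rho_mono => //; apply: (aeS XY) => x ->.
by apply: (aeS2 a b) => x {}a {}b; apply/eqP; rewrite eq_le a b.
Qed.

(* Translation invariance settles a bounded C; an unbounded one is truncated,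
   and the remainders are absorbed by convexity, all their multiples being
   dominated by one element of L_p. *)
Lemma crm_local_decrease X C (A : set Omega) : F s A -> D t X -> D t C ->
  (forall x, 0 <= C x) -> (forall x, A x -> C x = 0) ->
  \forall x \ae P, A x -> rho s t (X \- C) x <= rho s t X x.
Proof.
move=> sA DX DC C0 CA; pose E n := excess C n; pose B n := C \- E n.
have DE n : D t (E n) by exact: Lp_space_excess.
have DB n : D t (B n) by exact: Lp_spaceB.
have DXC : D t (X \- C) by exact: Lp_spaceB.
have E0 n x : 0 <= E n x by exact: excess_ge0.
have BC n x : B n x <= C x by rewrite /B /= gerBl.
have Bn n x : B n x <= n%:R.
  rewrite /B /E /excess /= (ger0_norm (C0 x)).
  by case: (leP (C x - n%:R) 0) => h; lra.
have step1 n : \forall x \ae P, A x -> rho s t (X \- B n) x <= rho s t X x.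
  (* N is 0 on A and n elsewhere: it dominates [B n] and is F_s-measurable, so translation
     invariance applies to it. *)
  pose N := patch (cst n%:R : Omega -> R) A (cst 0).
  have DN : D s N by apply: Lp_space_patch => //; exact: Lp_space_cst.
  have DXN : D t (X \+ (\- N)) by apply: Lp_spaceD => //; apply: Lp_spaceN => //; exact: Dst.
  have h1 : \forall x \ae P, rho s t (X \- B n) x <= rho s t (X \+ (\- N)) x.
    apply: rho_mono => //; first exact: Lp_spaceB.
    apply: aeW => x /=; rewrite lerD2l lerN2 /N /patch; case: ifPn => [/set_mem Ax|_].
      by apply: le_trans (BC n x) _; rewrite CA.
    exact: Bn.
  have h2 := rho_transl DX (Lp_spaceN hp sF sm DN).
  apply: (aeS2 h1 h2) => x a b Ax.
  by apply: le_trans a _; rewrite b /= /N /patch mem_set//= oppr0 subr0.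
have [f [Df f0 fP]] := Lp_dominating hp tF tm DE E0 (excess_small hp tF tm DC).
have DXCf : D t ((X \- C) \- f) by exact: Lp_spaceB.
have step2 k : \forall x \ae P, A x -> rho s t (X \- C) x <=
    (1 - k.+1%:R^-1) * rho s t X x + k.+1%:R^-1 * rho s t ((X \- C) \- f) x.
  have [n nP] := fP k.+1.
  (* The remainder E n is recovered by convexity: X - C is the combination of Y' and Y with weight
     1/(k+1) on Y', and Y' >= X - C - f for an f that depends on neither k nor n. *)
  pose Y := X \- B n; pose Y' := (X \- B n) \- (fun x => k.+1%:R * E n x).
  have DY : D t Y by exact: Lp_spaceB.
  have DY' : D t Y' by apply: Lp_spaceB => //; exact: Lp_spaceZ.
  have l01 : 0 <= (k.+1%:R^-1 : R) <= 1.
    by rewrite invr_ge0 ler0n invf_le1 ?ltr0n// ler1n.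
  have h1 := crm_convex hrho s0 st tT DY' DY l01.
  have h2 := rho_mono DY' DXCf.
  have {}h2 : \forall x \ae P, rho s t Y' x <= rho s t ((X \- C) \- f) x.
    apply: h2; apply: (aeS nP) => x /= h; rewrite /Y' /B /=.
    have := BC n x; rewrite /B /=; lra.
  have E1 : (fun y => k.+1%:R^-1 * Y' y + (1 - k.+1%:R^-1) * Y y) = X \- C.
    by apply/funext => x; rewrite /Y' /Y /B /=; field.
  rewrite E1 in h1.
  apply: (aeS3 h1 h2 (step1 n)) => x a b c Ax.
  apply: le_trans a _; rewrite addrC; case/andP: l01 => l0 l1.
  by apply: lerD; apply: ler_wpM2l => //; [rewrite subr_ge0|exact: c].
apply: (aeS (ae_foralln step2)) => x h Ax.
set a := rho s t (X \- C) x in h *; set b := rho s t X x in h *.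
set c := rho s t ((X \- C) \- f) x in h *.
rewrite leNgt; apply/negP => ba.
pose k := Num.truncn (`|c - b| / (a - b)).
have ab0 : 0 < a - b by rewrite subr_gt0.
have : `|c - b| < k.+1%:R * (a - b) by rewrite -ltr_pdivrMr//; exact: truncnS_gt.
have := h k Ax => {}h.
have : k.+1%:R * a <= k.+1%:R * b + (c - b).
  have -> : k.+1%:R * b + (c - b) = k.+1%:R * ((1 - k.+1%:R^-1) * b + k.+1%:R^-1 * c).
    by field; rewrite gt_eqF.
  by rewrite ler_pM2l.
have := ler_norm (c - b); lra.
Qed.

(** If W and Z agree on B, then C = |W - Z| vanishes on B and W >= Z - C, so rho_st W <= rho_st(Z -
    C) <= rho_st Z on B. This is used for Z = X on A and for Z = Y on its complement. *)
Lemma crm_patch X Y (A : set Omega) : F s A -> D t X -> D t Y ->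
  \forall x \ae P, rho s t (patch Y A X) x <= patch (rho s t Y) A (rho s t X) x.
Proof.
move=> sA DX DY; have tA := stF sA; pose W := patch Y A X.
have DW : D t W by exact: Lp_space_patch.
have loc B Z : F s B -> D t Z -> (forall x, B x -> W x = Z x) ->
    \forall x \ae P, B x -> rho s t W x <= rho s t Z x.
  move=> sB DZ WZ; pose C := Num.norm \o (W \- Z).
  have DC : D t C by apply: Lp_space_norm => //; exact: Lp_spaceB.
  have C0 x : 0 <= C x by exact: normr_ge0.
  have CB x : B x -> C x = 0 by move=> Bx; rewrite /C /= WZ// subrr normr0.
  have h1 := crm_local_decrease sB DZ DC C0 CB.
  have h2 : \forall x \ae P, rho s t W x <= rho s t (Z \- C) x.
    apply: rho_mono => //; first exact: Lp_spaceB.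
    by apply: aeW => x; rewrite /C /=; have := ler_norm (Z x - W x); rewrite distrC; lra.
  by apply: (aeS2 h1 h2) => x a b Bx; exact: le_trans b (a Bx).
have h1 : \forall x \ae P, A x -> rho s t W x <= rho s t X x.
  by apply: loc => // x Ax; rewrite /W /patch mem_set.
have sA' : F s (~` A) by rewrite -setTD; case: sF => _ + _; exact.
have h2 : \forall x \ae P, (~` A) x -> rho s t W x <= rho s t Y x.
  by apply: loc => // x Ax; rewrite /W /patch memNset.
apply: (aeS2 h1 h2) => x a b.
by rewrite [leRHS]/patch; case: ifPn => [/set_mem /a//|/negP]; rewrite inE => /b.
Qed.

Let psi X : R := \int[P]_x rho s t X x.

Let irho X : D t X -> P.-integrable setT (EFin \o rho s t X).
Proof. by move=> DX; apply: (Lp_space_integrable hp sF sm); exact: rho_maps. Qed.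

Let psi_convex X Y (l : R) : D t X -> D t Y -> 0 <= l <= 1 ->
  psi (fun x => l * X x + (1 - l) * Y x) <= l * psi X + (1 - l) * psi Y.
Proof.
move=> DX DY l01.
have iX := irho DX; have iY := irho DY.
have iZ (c : R) Z : D t Z -> P.-integrable setT (EFin \o (fun x => c * rho s t Z x)).
  by move=> DZ; apply: (integrableZl measurableT c (irho DZ)).
rewrite /psi -!RintegralZl// -RintegralD//; [|exact: iZ|exact: iZ].
apply: ae_le_Rintegral.
- by apply: irho; apply: Lp_space_lin => //; exact: Lp_spaceZ.
- by apply: (integrableD measurableT (iZ l X DX) (iZ (1 - l) Y DY)).
- exact: (crm_convex hrho).
Qed.

(* R0 is a subgradient at X of Z |-> E_P (rho_st Z); locality of rho_st turns
   the scalar subgradient inequality into one on every A in F_s. *)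
Lemma crm_subgradient X : D t X ->
  exists R0 : probability (g_sigma_algebraType (F t)) R,
  [/\ forall A, F s A -> R0 A = P A,
      forall Z, D t Z -> R0.-integrable setT (EFin \o Z) &
      forall Z A, D t Z -> F s A ->
        (\int[R0]_(x in A) (X x - Z x)%:E <=
         \int[P]_(x in A) (rho s t Z x - rho s t X x)%:E)%E].
Proof.
move=> DX.
have [l [lp lD lZ]] := @convex_subgradient R (Omega -> R^o) (D t)
  (Lp_space_cst P p tF tm 0) (fun U V => Lp_spaceD hp tF tm (X:=U) (Y:=V))
  (fun a U => Lp_spaceZ hp tF tm a (X:=U)) psi X DX
  (fun U V c DU DV => @psi_convex U V c DU DV).
(* Since rho_st is decreasing, the positive functional is the opposite of the subgradient. *)
pose m Z := - l Z.
have mD U V : D t U -> D t V -> m (U \+ V) = m U + m V.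
  by move=> DU DV; rewrite /m -opprD; congr (- _); exact: lD.
have mZ a U : D t U -> m (fun x => a * U x) = a * m U.
  by move=> DU; rewrite /m mulrN; congr (- _); exact: lZ.
have DXp Z : D t Z -> D t (X \+ Z) by move=> DZ; exact: Lp_spaceD.
have m0 U : D t U -> (\forall x \ae P, 0 <= U x) -> 0 <= m U.
  move=> DU U0; rewrite oppr_ge0; apply: le_trans (lp U DU) _.
  rewrite subr_le0; apply: ae_le_Rintegral; [exact: irho (DXp U DU)|exact: irho|].
  apply: rho_mono => //; first exact: DXp.
  by apply: (aeS U0) => x h; rewrite /= lerDl.
have [mu [muE muI]] := positive_functional_measure hp tF tm mD mZ m0.
(* Translation invariance bounds m V below by E_P V for F_s-measurable V; the same bound at - V
   gives equality. Hence m has total mass 1 and its measure agrees with P on F_s. *)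
have ms U : D s U -> m U = \int[P]_x U x.
  have le1 V : D s V -> \int[P]_x V x <= m V.
    move=> DV; have iV := Lp_space_integrable hp sF sm DV.
    rewrite lerNr; apply: le_trans (lp V (Dst DV)) _.
    rewrite lerBlDr [leRHS]addrC /psi -RintegralB//; last exact: irho.
    apply: ae_le_Rintegral.
    - exact: irho (DXp _ (Dst DV)).
    - exact: (integrableB measurableT (irho DX) iV).
    - by apply: (aeS (rho_transl DX DV)) => x h; rewrite h.
  move=> DU; apply/eqP; rewrite eq_le le1// andbT.
  have DN : D s (fun x => -1 * U x) by exact: Lp_spaceZ.
  have := le1 _ DN; rewrite mZ; last exact: Dst.
  rewrite RintegralZl ?mulN1r ?lerN2//; exact: Lp_space_integrable DU.
have ind A : F s A -> m \1_A = fine (P A).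
  move=> sA; rewrite ms; last exact: Lp_space_indic.
  by rewrite /Rintegral integral_indic ?setIT//; exact: sm.
have sT : F s setT.
  by rewrite -(setD0 setT); case: sF => h0 + _; apply.
have muT : mu setT = 1%E.
  transitivity ((m \1_setT)%:E); first by apply: muE; exact: stF.
  by rewrite ind// probability_setT.
have [R0 R0E] := ex_probability muT.
have R0I Z : D t Z -> (forall x, 0 <= Z x) -> (\int[R0]_x (Z x)%:E = (m Z)%:E)%E.
  by move=> DZ Z0; rewrite -muI//; apply: eq_measure_integral => A _ _; exact: R0E.
have iR Z : D t Z -> R0.-integrable setT (EFin \o Z).
  move=> DZ; have [mZ' _] := DZ.
  apply/integrableP; split; first exact: erv_measurable_EFin.
  have DN : D t (Num.norm \o Z) by exact: Lp_space_norm.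
  have -> : (\int[R0]_x `|(EFin \o Z) x| = \int[R0]_x ((Num.norm \o Z) x)%:E)%E by [].
  by rewrite R0I ?ltry// => x; exact: normr_ge0.
(* A signed Z is the difference of the nonnegative variables Z + |Z| and |Z|. *)
have R0E' Z : D t Z -> (\int[R0]_x (Z x)%:E = (m Z)%:E)%E.
  move=> DZ; have DN : D t (Num.norm \o Z) by exact: Lp_space_norm.
  have DS : D t (Z \+ (Num.norm \o Z)) by exact: Lp_spaceD.
  have S0 x : 0 <= (Z \+ (Num.norm \o Z)) x.
    by rewrite /= -lerBlDr sub0r lerNl -normrN ler_norm.
  have := R0I _ DS S0; rewrite mD// EFinD.
  rewrite (_ : (\int[R0]_x ((Z \+ (Num.norm \o Z)) x)%:E =
     \int[R0]_x (Z x)%:E + \int[R0]_x ((Num.norm \o Z) x)%:E)%E); last first.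
    by rewrite -integralD//; [exact: iR|exact: iR].
  rewrite (R0I _ DN (fun x => normr_ge0 _)) -(EFin_Rintegral (iR Z DZ)) -EFinD.
  by move=> -[/addIr ->].
exists R0; split.
- move=> A sA; transitivity (mu A); first exact: R0E.
  rewrite muE; last exact: stF.
  by rewrite ind// fineK// fin_num_measure//; exact: sm.
- exact: iR.
(* Subtracting V from X replaces X by Z on A and leaves it unchanged elsewhere. *)
- move=> Z A DZ sA; pose V := patch (cst 0) A (X \- Z).
  have DV : D t V.
    by apply: (Lp_space_patch hp tF tm); [exact: stF|exact: Lp_spaceB|exact: Lp_space_cst].
  have -> : (\int[R0]_(x in A) (X x - Z x)%:E = \int[R0]_x (V x)%:E)%E.
    rewrite integral_mkcond; apply: eq_integral => x _.
    by rewrite /V /patch; case: ifP.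
  have -> : (\int[P]_(x in A) (rho s t Z x - rho s t X x)%:E =
      \int[P]_x (patch (rho s t X) A (rho s t Z) x - rho s t X x)%:E)%E.
    rewrite integral_mkcond; apply: eq_integral => x _.
    by rewrite /patch; case: ifP => // _; rewrite subrr.
  have DZX : D t (patch X A Z) by apply: Lp_space_patch => //; exact: stF.
  have Dp : D s (patch (rho s t X) A (rho s t Z)).
    by apply: Lp_space_patch => //; exact: rho_maps.
  have ip := Lp_space_integrable hp sF sm Dp.
  rewrite R0E'// -EFin_Rintegral; last exact: (integrableB measurableT ip (irho DX)).
  rewrite lee_fin RintegralB//; last exact: irho.
  have -> : m V = l (fun x => -1 * V x) by rewrite lZ// mulN1r.
  have DNV : D t (fun x => -1 * V x) by exact: Lp_spaceZ.
  apply: le_trans (lp _ DNV) _; rewrite lerD2r.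
  have -> : X + (fun x => -1 * V x) = patch X A Z.
    apply/funext => x; rewrite /V /patch /GRing.add /=; case: ifP => _; first by ring.
    by rewrite mulr0 addr0.
  apply: ae_le_Rintegral => //; first exact: irho.
  exact: crm_patch.
Qed.

End one_step.
End risk_measure.

(** * Penalties *)

Section ambient_restriction.
Context {d} {Omega : measurableType d} {R : realType} (P : probability Omega R).
Variables (G H : set_system Omega).
Hypotheses (sG : sigma_algebra setT G) (sH : sigma_algebra setT H)
  (GH : G `<=` H) (Hm : H `<=` measurable).
Variable S : probability (g_sigma_algebraType H) R.
Hypothesis SP : forall A, G A -> S A = P A.
Local Open Scope ereal_scope.

(** S and P live on different measurable spaces; both are pushed forward to G, where they
    coincide. *)
Lemma ge0_integral_agree (f : Omega -> \bar R) A : erv_measurable G f ->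
  (forall x, 0 <= f x) -> G A -> \int[S]_(x in A) f x = \int[P]_(x in A) f x.
Proof.
move=> mf f0 GA; have [nu [nuE nuI]] := ex_restrict_measure S sG sH GH.
rewrite -nuI//; pose i : Omega -> g_sigma_algebraType G := id.
have mi : measurable_fun setT i.
  move=> _ B mB; rewrite setTI; apply: Hm; apply: GH; exact: g_measurableP mB.
have [nu' nu'E nu'I] : exists2 nu' : {measure set (g_sigma_algebraType G) -> \bar R},
    (forall B, nu' B = P B) &
    \int[nu']_(x in A) f x = \int[P]_(x in A) f x.
  unshelve eexists (pushforward P i); [exact: mi|by []|].
  rewrite ge0_integral_pushforward//; first exact: g_measurableE.
  exact: measurable_funTS.
rewrite -nu'I; apply: eq_measure_integral => B mB _.
by rewrite nuE nu'E; apply: SP; exact: g_measurableP mB.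
Qed.

Lemma integral_agree (V : Omega -> R) : rv_measurable G V ->
  P.-integrable setT (EFin \o V) ->
  S.-integrable setT (EFin \o V) /\ (\int[S]_x V x = \int[P]_x V x)%R.
Proof.
move=> mV iV; have GT : G setT by exact: (g_measurableP sG measurableT).
have e f : erv_measurable G f -> (forall x, 0 <= f x) ->
    \int[S]_x f x = \int[P]_x f x.
  by move=> mf f0; exact: ge0_integral_agree.
have mVE := erv_measurable_EFin mV.
split.
  apply/integrableP; split; first exact: erv_measurableS mVE.
  have /integrableP[_] := iV; rewrite -(e (abse \o (EFin \o V)))//.
    exact: measurableT_comp.
  by move=> x; exact: abse_ge0.
rewrite /Rintegral integralE [in RHS]integralE; congr (fine (_ - _)).
  by apply: e => //; exact: measurable_funepos.
by apply: e => //; exact: measurable_funeneg.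
Qed.

End ambient_restriction.

Section risk_measure.
Context {d} {Omega : measurableType d} {R : realType}.
Variables (P : probability Omega R) (T : R) (F : R -> set_system Omega) (p : R).
Variable rho : R -> R -> (Omega -> R) -> Omega -> R.
Hypotheses (hF : complete_filtration P T F)
  (hF0 : trivial_sigma_algebra P (F 0)) (hp : 1 <= p)
  (hrho : fully_dynamic_crm P T F p rho)
  (htc : strong_time_consistent P T F p rho).
Implicit Types X Y Z : Omega -> R.
Local Notation D t := (Lp_space P p (F t)).

Lemma filtration_sigmaW t : 0 <= t -> t <= T -> sigma_algebra setT (F t).
Proof. by move=> t0 tT; apply: (filtration_sigma hF); rewrite t0. Qed.

Lemma filtration_subW t : 0 <= t -> t <= T -> F t `<=` measurable.
Proof. by move=> t0 tT; apply: (filtration_sub hF); rewrite t0. Qed.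

(** Completeness puts P-null sets into F_0, hence into every F_t; this is what moves exceptional
    sets from P to measures defined on F_t only. *)
Lemma negligible_F A t : 0 <= t -> t <= T -> P.-negligible A -> F t A /\ P A = 0%E.
Proof.
move=> t0 tT nA; have F0A := filtration_null hF nA.
have m0 : measurable A by apply: (filtration_sub hF (t := 0)); rewrite ?lexx ?(le_trans t0).
split; first exact: (filtration_mono hF (s := 0)).
exact/(negligibleP _ m0).
Qed.

Section transfer.
Variables (t : R) (t0 : 0 <= t) (tT : t <= T).
Let tF := filtration_sigmaW t0 tT.
Variable Q : probability (g_sigma_algebraType (F t)) R.

Lemma ae_agree s (B : Omega -> Prop) : 0 <= s -> s <= t ->
  (forall A, F s A -> Q A = P A) -> (\forall x \ae P, B x) -> \forall x \ae Q, B x.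
Proof.
move=> s0 st QP nB; have [sB PB] := negligible_F s0 (le_trans st tT) nB.
exists (~` [set x | B x]); split => //; last by rewrite QP.
by apply: g_measurableE => //; exact: (filtration_mono hF) sB.
Qed.

Lemma ae_equiv_to (B : Omega -> Prop) : equivalent_on P Q ->
  (\forall x \ae P, B x) -> \forall x \ae Q, B x.
Proof.
move=> PQ nB; have [tB PB] := negligible_F t0 tT nB.
exists (~` [set x | B x]); split => //; last exact/PQ.
exact: g_measurableE.
Qed.

Lemma ae_equiv_from (B : Omega -> Prop) : equivalent_on P Q ->
  (\forall x \ae Q, B x) -> \forall x \ae P, B x.
Proof.
move=> PQ [N [mN N0 sN]]; have tN := g_measurableP tF mN.
by exists N; split => //; [exact: filtration_subW tN|exact/PQ].
Qed.

(** On a trivial sigma-algebra the null sets determine all probabilities. *)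
Lemma equivalent_agree0 : equivalent_on P Q -> forall A, F 0 A -> Q A = P A.
Proof.
move=> PQ A F0A; have tA : F t A by exact: (filtration_mono hF (s := 0)).
have mA := filtration_subW t0 tT tA; have mA' := g_measurableE tF tA.
case: (hF0 F0A) => PA; first by rewrite PA; exact/PQ.
have tC : F t (~` A) by rewrite -setTD; case: tF => _ + _; exact.
have : Q (~` A) = 0%E.
  by apply/PQ => //; rewrite probability_setC// PA subee.
rewrite probability_setC// => /eqP; rewrite sube_eq ?add0e ?fin_num_measure//.
  by move=> /eqP <-.
Qed.

End transfer.

(** For F_t-measurable Z, translation invariance gives rho_tT Z = rho_tT 0 - Z, and time consistency
    inserts this into rho_st. The cost rho_tT 0 stays because rho is not normalized. *)
Lemma crm_horizon s t Z : 0 <= s -> s <= t -> t <= T -> D t Z ->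
  \forall x \ae P, rho s T Z x = rho s t (Z \- rho t T (cst 0)) x.
Proof.
move=> s0 st tT DZ; have t0 : 0 <= t by exact: le_trans st.
have tF := filtration_sigmaW t0 tT; have tm := filtration_subW t0 tT.
have DZT : D T Z by exact: (Lp_space_mono hF t0 tT (lexx T)).
have D0 : D T (cst 0).
  by apply: Lp_space_cst; [apply: filtration_sigmaW|apply: filtration_subW] => //; exact: le_trans tT.
have h1 := htc s0 st tT (lexx T) DZT.
have h2 := crm_translation hrho t0 tT (lexx T) D0 DZ.
have E : cst 0 \+ Z = Z by apply/funext => x; rewrite /= add0r.
rewrite E in h2.
have h3 : \forall x \ae P, rho s t (\- rho t T Z) x = rho s t (Z \- rho t T (cst 0)) x.
  apply: (crm_congr hrho s0 st tT).
  - by apply: Lp_spaceN => //; exact: (crm_maps hrho).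
  - by apply: Lp_spaceB => //; exact: (crm_maps hrho).
  - by apply: (aeS h2) => x /= ->; rewrite opprB.
by apply: (aeS2 h1 h3) => x -> ->.
Qed.

Section penalty.
Variables (s t : R).
Hypotheses (s0 : 0 <= s) (st : s <= t) (tT : t <= T).
Let t0 : 0 <= t. Proof. exact: le_trans st. Qed.
Let sT : s <= T. Proof. exact: le_trans tT. Qed.
Let sF := filtration_sigmaW s0 sT.
Let tF := filtration_sigmaW t0 tT.
Let sm := filtration_subW s0 sT.
Let tm := filtration_subW t0 tT.
Let stF : F s `<=` F t. Proof. exact: (filtration_mono hF). Qed.
Variable S : probability (g_sigma_algebraType (F t)) R.
Local Notation alpha := (min_penalty P F p rho s t S).

Lemma min_penaltyP : is_ess_sup P (F s)
  [set (fun x => (cond_exp S (F s) (\- X)%R x - (rho s t X x)%:E)%E) | X in D t] alpha.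
Proof.
apply: family_ess_supP => //.
  exists (fun x => (cond_exp S (F s) (\- cst 0)%R x - (rho s t (cst 0) x)%:E)%E).
  by exists (cst 0) => //; exact: Lp_space_cst.
move=> _ [X DX <-]; have [mX _] := DX.
apply: emeasurable_funB.
  by apply: (erv_measurable_ce tF sF stF); exact: measurable_funN.
by apply: erv_measurable_EFin; have [] := crm_maps hrho s0 st tT DX.
Qed.

Lemma min_penalty_ge X : D t X ->
  \forall x \ae P, (cond_exp S (F s) (\- X)%R x - (rho s t X x)%:E <= alpha x)%E.
Proof.
move=> DX; have [_ ub _] := min_penaltyP.
by apply: (ub (fun x => _)); exists X.
Qed.

Lemma min_penalty_le (U : Omega -> \bar R) : erv_measurable (F s) U ->
  (forall X, D t X -> \forall x \ae P,
    (cond_exp S (F s) (\- X)%R x - (rho s t X x)%:E <= U x)%E) ->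
  \forall x \ae P, (alpha x <= U x)%E.
Proof.
by move=> mU ub; have [_ _ lub] := min_penaltyP; apply: lub => // _ [X DX <-]; exact: ub.
Qed.

Hypothesis SP : forall A, F s A -> S A = P A.
Variable U : Omega -> R.
Hypotheses (mU : rv_measurable (F s) U) (iU : P.-integrable setT (EFin \o U)).
Hypothesis ubU : forall Z, D t Z -> \forall x \ae P,
  (cond_exp S (F s) (\- Z)%R x - (rho s t Z x)%:E <= (U x)%:E)%E.

Let irho X : D t X -> P.-integrable setT (EFin \o rho s t X).
Proof. by move=> DX; apply: (Lp_space_integrable hp sF sm); exact: (crm_maps hrho). Qed.

Let ae_S (B : Omega -> Prop) : (\forall x \ae P, B x) -> \forall x \ae S, B x.
Proof. exact: (ae_agree t0 tT s0 st SP). Qed.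

(** At the position -|Z| the bound reads E_S(|Z| | F_s) <= U + rho_st(-|Z|). The right-hand side is
    F_s-measurable and P-integrable, and S agrees with P on F_s. *)
Lemma penalized_integrable Z : D t Z -> S.-integrable setT (EFin \o Z).
Proof.
move=> DZ; have [mZ _] := DZ.
pose N : Omega -> R := \- (Num.norm \o Z).
have DN : D t N by apply: Lp_spaceN => //; exact: Lp_space_norm.
have mN := rv_measurable_norm mZ.
have [mc c0 cE] := cond_exp_nnegP tF sF stF S mN (fun x => normr_ge0 (Z x)).
have h : \forall x \ae S, (cond_exp_nneg S (F s) (EFin \o (Num.norm \o Z)) x <=
    `|(U x + rho s t N x)%:E|)%E.
  have EN : \- N = (Num.norm \o Z) :> (Omega -> R).
    by apply/funext => x; rewrite /N /= opprK.
  have := ubU DN; rewrite EN => h1.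
  have h2 := cond_exp_ge0E tF sF stF S (fun x => normr_ge0 (Z x)).
  apply: (aeS2 (ae_S h1) h2) => x; rewrite leeBlDr// => a b; rewrite b in a.
  by apply: le_trans a _; rewrite -EFinD lee_fin ler_norm.
have FT : F s setT by exact: (g_measurableP sF measurableT).
apply/integrableP; split; first exact: erv_measurable_EFin.
have -> : (\int[S]_x `|(EFin \o Z) x| = \int[S]_x (EFin \o (Num.norm \o Z)) x)%E by [].
rewrite -cE//.
pose V := U \+ rho s t N.
have iV : P.-integrable setT (EFin \o V) by exact: (integrableD measurableT iU (irho DN)).
have mV : erv_measurable (F s) (EFin \o V).
  apply: erv_measurable_EFin; apply: rv_measurableD => //.
  by have [] := crm_maps hrho s0 st tT DN.
have mVa : erv_measurable (F s) (abse \o (EFin \o V)).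
  exact: measurableT_comp.
apply: (@le_lt_trans _ _ (\int[S]_x (abse \o (EFin \o V)) x)%E).
  apply: ae_ge0_le_integral => //.
  - exact: (erv_measurableS stF mc).
  - by move=> x _; exact: abse_ge0.
  - exact: (erv_measurableS stF mVa).
  - by apply: (aeS h) => x a _; exact: a.
rewrite (ge0_integral_agree sF tF stF tm SP)//; last by move=> x; exact: abse_ge0.
by have /integrableP[_] := iV.
Qed.

Lemma penalized_le Z : D t Z ->
  \int[S]_x (- Z x) <= \int[P]_x U x + \int[P]_x rho s t Z x.
Proof.
move=> DZ; have [mZ _] := DZ.
have DN : D t (\- Z) by exact: Lp_spaceN.
have [mN _] := DN.
have FT : F s setT by exact: (g_measurableP sF measurableT).
have iN := penalized_integrable DN.
have [mf i_f fE] := integral_fine_cond_exp tF sF stF mN iN.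
have -> : \int[S]_x (- Z x) = \int[S]_x (fine (cond_exp S (F s) (\- Z) x)).
  by rewrite /Rintegral fE.
have iV : P.-integrable setT (EFin \o (U \+ rho s t Z)).
  exact: (integrableD measurableT iU (irho DZ)).
have mV : rv_measurable (F s) (U \+ rho s t Z).
  by apply: rv_measurableD => //; have [] := crm_maps hrho s0 st tT DZ.
have [iV' EV] := integral_agree sF tF stF tm SP mV iV.
rewrite -RintegralD//; last exact: irho.
apply: le_trans (_ : \int[S]_x (U \+ rho s t Z) x <= _); last by rewrite EV.
apply: ae_le_Rintegral => //.
have fin := cond_exp_fin tF sF stF mN (cond_integrable_integrable tF sF stF mN iN).
apply: (aeS2 (ae_S (ubU DZ)) fin) => x; rewrite leeBlDr// => a b.
by rewrite -lee_fin /= fineK.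
Qed.

End penalty.
End risk_measure.

(** * Bounds for measures of finite penalty *)

Section risk_measure.
Context {d} {Omega : measurableType d} {R : realType}.
Variables (P : probability Omega R) (T : R) (F : R -> set_system Omega) (p : R).
Variable rho : R -> R -> (Omega -> R) -> Omega -> R.
Hypotheses (hT : 0 < T) (hF : complete_filtration P T F)
  (hF0 : trivial_sigma_algebra P (F 0)) (hp : 1 <= p)
  (hrho : fully_dynamic_crm P T F p rho)
  (htc : strong_time_consistent P T F p rho).
Implicit Types X Y Z : Omega -> R.
Local Notation D t := (Lp_space P p (F t)).
Local Notation QQ := (calQ P T F p rho).
Local Notation phi Z := (\int[P]_x rho 0 T Z x).

Let T0 : 0 <= T. Proof. exact: ltW. Qed.
Let TT := lexx T.
Let FTs := filtration_sigmaW hF T0 TT.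
Let FTm := filtration_subW hF T0 TT.
Let F0s := filtration_sigmaW hF (lexx 0) T0.
Let F0m := filtration_subW hF (lexx 0) T0.

(** One of the events V <= n has probability 1: otherwise all of them would be null, and V would be
    +oo almost surely. *)
Lemma trivial_bounded (V : Omega -> \bar R) : erv_measurable (F 0) V ->
  (\forall x \ae P, (V x < +oo)%E) -> exists C : R, \forall x \ae P, (V x <= C%:E)%E.
Proof.
move=> mV Voo; pose A (n : nat) := [set x | (V x <= n%:R%:E)%E].
have FA n : F 0 (A n).
  apply: (@g_measurableP _ _ (F 0)) => //; rewrite -[X in measurable X]setTI.
  exact: measurable_lee.
have [[n An]|H] := pselect (exists n, P (A n) = 1%E).
  exists n%:R; exists (~` A n); split => //.
    by apply: measurableC; exact: F0m.
  by rewrite probability_setC ?An ?subee//; exact: F0m.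
have PA n : P (A n) = 0%E.
  by case: (hF0 (FA n)) => // An; exfalso; apply: H; exists n.
have nA : P.-negligible (\bigcup_n A n).
  by apply: negligible_bigcup => n; apply/(negligibleP _ (F0m (FA n))); exact: PA.
have : P.-negligible setT.
  apply: (negligibleS _ (negligibleU nA Voo)) => x _ /=.
  have [Vx|_] := ltP (V x) +oo%E; last by right.
  left; exists (Num.truncn (fine (V x))).+1 => //=; rewrite /A /=.
  case: (V x) Vx => [r _| |_] //=; last exact: leNye.
  by rewrite lee_fin ltW// truncnS_gt.
move=> /(negligibleP _ measurableT) PT0.
have : 1%E = 0%E :> \bar R by rewrite -(probability_setT P); exact: PT0.
by move=> /eqP; rewrite eqe oner_eq0.
Qed.

(** C bounds the penalty of Q, which is almost surely constant as F_0 is trivial; this is the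
    penalized bound at s = 0, and it places L_p inside L_1(Q). *)
Lemma calQ_bound Q : QQ Q -> exists C : R, forall Z, D T Z ->
  Q.-integrable setT (EFin \o Z) /\ \int[Q]_x (- Z x) <= C + phi Z.
Proof.
move=> [PQ aoo].
have [ma _ _] := min_penaltyP hF hrho (lexx 0) T0 TT Q.
have [C CP] := trivial_bounded ma aoo.
have QP := equivalent_agree0 hF hF0 T0 TT PQ.
have ub Z : D T Z -> \forall x \ae P,
    (cond_exp Q (F 0) (\- Z)%R x - (rho 0 T Z x)%:E <= (cst C x)%:E)%E.
  move=> DZ; have := min_penalty_ge hF hrho (lexx 0) T0 TT Q DZ.
  by move=> h; apply: (aeS2 h CP) => x; exact: le_trans.
have mC : rv_measurable (F 0) (cst C : Omega -> R) by exact: measurable_cst.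
have iC : P.-integrable setT (EFin \o (cst C : Omega -> R)).
  by apply: finite_measure_integrable_cst.
exists C => Z DZ; split.
  exact: (penalized_integrable hF hp hrho (lexx 0) T0 TT QP mC iC ub DZ).
have := penalized_le hF hp hrho (lexx 0) T0 TT QP mC iC ub DZ.
by rewrite Rintegral_probability_cst.
Qed.

(** * Domination and the seminorm c on L_p *)

Section domination.
Variable rhobar : (Omega -> R) -> R.
Hypothesis hbar : coherent_risk_measure P p (F T) rhobar.
Hypothesis hdom : forall X, D T X ->
  \forall x \ae P, rho 0 T X x - rho 0 T (cst 0) x <= rhobar X.

Let irho X : D T X -> P.-integrable setT (EFin \o rho 0 T X).
Proof.
by move=> DX; apply: (Lp_space_integrable hp F0s F0m); exact: (crm_maps hrho).
Qed.

Let D0 : D T (cst 0). Proof. exact: Lp_space_cst. Qed.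

Lemma phi_le X : D T X -> phi X <= phi (cst 0) + rhobar X.
Proof.
move=> DX; have iC : P.-integrable setT (EFin \o (cst (rhobar X) : Omega -> R)).
  by apply: finite_measure_integrable_cst.
have -> : rhobar X = \int[P]_x (cst (rhobar X) x).
  by rewrite Rintegral_probability_cst.
rewrite -RintegralD//; last exact: irho.
apply: ae_le_Rintegral; [exact: irho|exact: (integrableD measurableT (irho D0) iC)|].
by apply: (aeS (hdom DX)) => x /=; lra.
Qed.

Lemma cnorm_ge Q X : QQ Q -> (\int[Q]_x (`|X x|)%:E <= cnorm QQ X)%E.
Proof. by move=> QQ_Q; apply: ereal_sup_ubound; exists Q. Qed.

(** [calQ_bound] at the positions - n |Z|, divided by n: homogeneity of rhobar makes the constant,
    which depends on Q, disappear in the limit. *)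
Lemma cnorm_le_rhobar Z : D T Z ->
  (cnorm QQ Z <= (rhobar (\- (Num.norm \o Z)))%:E)%E.
Proof.
move=> DZ; apply: ge_ereal_sup => _ [Q QQ_Q <-].
have DN : D T (Num.norm \o Z) by exact: Lp_space_norm.
have DM : D T (\- (Num.norm \o Z)) by exact: Lp_spaceN.
have [C CP] := calQ_bound QQ_Q.
have [iN _] := CP _ DN.
rewrite -EFin_Rintegral// lee_fin.
set a := \int[Q]_x _; set b := rhobar _.
have ab (n : nat) : n%:R * a <= C + phi (cst 0) + n%:R * b.
  have DnM : D T (fun x => n%:R * (\- (Num.norm \o Z)) x) by exact: Lp_spaceZ.
  have [_] := CP _ DnM; have -> : \int[Q]_x - (n%:R * (\- (Num.norm \o Z)) x) = n%:R * a.
    rewrite -RintegralZl//; congr fine; apply: eq_integral => x _ /=.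
    by rewrite mulrN opprK.
  move=> h; apply: le_trans h _; rewrite -addrA lerD2l.
  by apply: le_trans (phi_le DnM) _; rewrite (coh_homogeneous hbar).
rewrite leNgt; apply/negP => ba.
have ab0 : 0 < a - b by rewrite subr_gt0.
pose k := Num.truncn (`|C + phi (cst 0)| / (a - b)).
have : `|C + phi (cst 0)| < k.+1%:R * (a - b) by rewrite -ltr_pdivrMr//; exact: truncnS_gt.
have := ab k.+1; have := ler_norm (C + phi (cst 0)); rewrite mulrBr; lra.
Qed.

(** Automatic continuity for the monotone and homogeneous X |-> rhobar(-X), which dominates c on
    nonnegative variables. *)
Lemma cnorm_small (Z : nat -> Omega -> R) :
  (forall n, D T (Z n)) -> (forall n x, 0 <= Z n x) ->
  (forall e, 0 < e -> exists n, (\int[P]_x (Z n x `^ p)%:E <= e%:E)%E) ->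
  forall e, 0 < e -> exists n, (cnorm QQ (Z n) <= e%:E)%E.
Proof.
move=> DZ Z0 Zlim e e0.
have [n nP] : exists n, rhobar (\- Z n) <= e.
  apply: (@Lp_positive_functional_small _ _ _ P p hp (F T) FTs FTm
    (fun X => rhobar (\- X)) Z _ _ DZ Z0 Zlim e e0).
    move=> X Y DX DY _ XY; apply: (coh_monotone hbar); [exact: Lp_spaceN|exact: Lp_spaceN|].
    by apply: (aeS XY) => x; rewrite lerN2.
  move=> k X DX; rewrite -(coh_homogeneous hbar)//; last exact: Lp_spaceN.
  by congr rhobar; apply/funext => x /=; rewrite mulrN.
exists n; apply: le_trans (cnorm_le_rhobar (DZ n)) _; rewrite lee_fin.
suff -> : Num.norm \o Z n = Z n by [].
by apply/funext => x /=; rewrite ger0_norm.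
Qed.

End domination.

(** * Finiteness of the conditional penalty *)

Section conditional_penalty.
Variables (s t : R).
Hypotheses (s0 : 0 <= s) (st : s <= t) (tT : t <= T).
Let t0 : 0 <= t. Proof. exact: le_trans st. Qed.
Let sT : s <= T. Proof. exact: le_trans tT. Qed.
Let sF := filtration_sigmaW hF s0 sT.
Let tF := filtration_sigmaW hF t0 tT.
Let sm := filtration_subW hF s0 sT.
Let tm := filtration_subW hF t0 tT.
Let stF : F s `<=` F t. Proof. exact: (filtration_mono hF). Qed.
Let sTF : F s `<=` F T. Proof. exact: (filtration_mono hF). Qed.
Variable Q : probability (g_sigma_algebraType (F T)) R.
Hypothesis QQ_Q : QQ Q.

Let DtT X : D t X -> D T X. Proof. exact: (Lp_space_mono hF). Qed.
Let DsT X : D s X -> D T X. Proof. exact: (Lp_space_mono hF). Qed.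
Let rho_maps X : D t X -> D s (rho s t X). Proof. exact: (crm_maps hrho). Qed.
Let iQ X : D T X -> Q.-integrable setT (EFin \o X).
Proof. by have [C CP] := calQ_bound QQ_Q; move=> DX; have [] := CP X DX. Qed.
Let ae_QP (B : Omega -> Prop) : (\forall x \ae Q, B x) -> \forall x \ae P, B x.
Proof. by apply: (ae_equiv_from hF T0 TT); case: QQ_Q. Qed.
Let ae_PQ (B : Omega -> Prop) : (\forall x \ae P, B x) -> \forall x \ae Q, B x.
Proof. by apply: (ae_equiv_to hF T0 TT); case: QQ_Q. Qed.

(* Shifting X by rho_st X and by the cost rho_tT 0 makes rho_0T equal to the
   constant rho_0s 0, so the bound of calQ_bound no longer depends on X. *)
Lemma acceptable_bound : exists C : R, forall X, D t X ->
  \int[Q]_x (- X x) - \int[Q]_x rho s t X x <= C.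
Proof.
have [C CP] := calQ_bound QQ_Q.
have D0 : D T (cst 0) by exact: Lp_space_cst.
have Dk : D t (rho t T (cst 0)) by exact: (crm_maps hrho).
exists (C + (\int[P]_x rho 0 s (cst 0) x) + \int[Q]_x rho t T (cst 0) x) => X DX.
have Dr := rho_maps DX; have Drt : D t (rho s t X) by exact: (Lp_space_mono hF s0 st tT).
pose Z := X \+ rho s t X \+ rho t T (cst 0).
have DZ : D t Z by apply: Lp_spaceD => //; exact: Lp_spaceD.
have [_ ZC] := CP Z (DtT DZ).
have D0s : D s (cst 0) by exact: Lp_space_cst.
have E : \forall x \ae P, rho 0 T Z x = rho 0 s (cst 0) x.
  have h1 := htc (lexx 0) s0 sT TT (DtT DZ).
  have h2 := crm_horizon hF hp hrho htc s0 st tT DZ.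
  have h3 := crm_translation hrho s0 st tT DX Dr.
  have ZE : Z \- rho t T (cst 0) = X \+ rho s t X by apply/funext => x; rewrite /Z /= addrK.
  rewrite ZE in h2.
  have DsZ : D s (\- rho s T Z) by apply: Lp_spaceN => //; apply: (crm_maps hrho) => //; exact: DtT.
  have h4 : \forall x \ae P, (\- rho s T Z) x = cst 0 x.
    by apply: (aeS2 h2 h3) => x /= -> ->; rewrite subrr oppr0.
  have h5 := crm_congr hrho (lexx 0) s0 sT DsZ D0s h4.
  by apply: (aeS2 h1 h5) => x -> ->.
have phiE : phi Z = \int[P]_x rho 0 s (cst 0) x.
  have i1 : P.-integrable setT (EFin \o rho 0 T Z).
    by apply: (Lp_space_integrable hp F0s F0m); apply: (crm_maps hrho) => //; exact: DtT.
  have i2 : P.-integrable setT (EFin \o rho 0 s (cst 0)).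
    by apply: (Lp_space_integrable hp F0s F0m); apply: (crm_maps hrho).
  by apply/eqP; rewrite eq_le; apply/andP; split; apply: ae_le_Rintegral => //;
    apply: (aeS E) => x ->.
have iX : Q.-integrable setT (EFin \o (fun x => - X x)) by apply: iQ; apply: DtT; exact: Lp_spaceN.
have ir : Q.-integrable setT (EFin \o rho s t X) by apply: iQ; exact: DsT.
have ik : Q.-integrable setT (EFin \o rho t T (cst 0)) by apply: iQ; exact: DtT.
have ixr := integrableB measurableT iX ir.
have : \int[Q]_x (- Z x) = \int[Q]_x (- X x) - \int[Q]_x rho s t X x - \int[Q]_x rho t T (cst 0) x.
  rewrite -RintegralB// -RintegralB//.
  by congr fine; apply: eq_integral => x _; rewrite /Z /= !opprD.
by move: ZC; rewrite phiE; lra.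
Qed.

(* Locality makes the family E_Q(-Z | F_s) - rho_st Z directed upwards, and by
   acceptable_bound its expectations are bounded. *)
Lemma conditional_penalty_finite : exists2 U : Omega -> R, rv_measurable (F s) U &
  forall Z, D t Z -> \forall x \ae P,
    (cond_exp Q (F s) (\- Z)%R x - (rho s t Z x)%:E <= (U x)%:E)%E.
Proof.
have [C CP] := acceptable_bound.
pose g X x := fine (cond_exp Q (F s) (\- X)%R x) - rho s t X x.
have mH X : D t X -> rv_measurable (F T) (\- X).
  by move=> DX; have /(@Lp_spaceN _ _ _ P p hp _ FTs FTm)[] := DtT DX.
have iN X : D t X -> Q.-integrable setT (EFin \o (\- X)%R).
  by move=> DX; apply: iQ; apply: DtT; exact: Lp_spaceN.
have gprop X : D t X -> [/\ rv_measurable (F s) (g X),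
    Q.-integrable setT (EFin \o g X), \int[Q]_x g X x <= C &
    \forall x \ae P, (cond_exp Q (F s) (\- X)%R x - (rho s t X x)%:E = (g X x)%:E)%E].
  move=> DX; have [mr _] := rho_maps DX.
  have ir : Q.-integrable setT (EFin \o rho s t X) by apply: iQ; exact: DsT (rho_maps DX).
  have [mf i_f fE] := integral_fine_cond_exp FTs sF sTF (mH X DX) (iN X DX).
  have fin := cond_exp_fin FTs sF sTF (mH X DX)
    (cond_integrable_integrable FTs sF sTF (mH X DX) (iN X DX)).
  split.
  - exact: rv_measurableB.
  - exact: (integrableB measurableT i_f ir).
  - have -> : \int[Q]_x g X x = \int[Q]_x (- X x) - \int[Q]_x rho s t X x.
      rewrite /g RintegralB//; congr (_ - _); rewrite /Rintegral fE//.
      exact: (g_measurableP sF measurableT).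
    exact: CP.
  - by apply: (aeS (ae_QP fin)) => x h; rewrite /g EFinB fineK.
pose UU := [set (fun x => (cond_exp Q (F s) (\- X)%R x - (rho s t X x)%:E)%E) | X in D t].
have UU0 : UU !=set0.
  by eexists; exists (cst 0); [exact: Lp_space_cst|reflexivity].
have mUU V : UU V -> erv_measurable (F s) V.
  move=> [X DX <-]; have [mr _] := rho_maps DX.
  apply: emeasurable_funB; last exact: erv_measurable_EFin.
  by apply: (erv_measurable_ce FTs sF sTF); exact: mH.
have [V [UV [mV Vub _]]] := is_ess_sup_csup P sF sm UU0 mUU.
have /choice[X XP] : forall n, exists X, D t X /\
    (fun x => (cond_exp Q (F s) (\- X)%R x - (rho s t X x)%:E)%E) = V n.
  by move=> n; have [X DX XV] := UV n; exists X.
have DX n : D t (X n) by have [] := XP n.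
have [W WP] : exists W : nat -> Omega -> R, forall n, D t (W n) /\
    \forall x \ae P, forall i, (i <= n)%N -> g (X i) x <= g (W n) x.
  suff H n : exists W, D t W /\ \forall x \ae P, forall i, (i <= n)%N -> g (X i) x <= g W x.
    by have [W WP] := choice H; exists W.
  elim: n => [|n [W [DW WP]]].
    by exists (X 0%N); split => //; apply: aeW => x i; rewrite leqn0 => /eqP ->.
  (* Pasting along the event where [X n.+1] does better gives, by locality, a position at least as
     good as both. *)
  pose A := [set x | g W x <= g (X n.+1) x].
  have [mgW _ _ gWE] := gprop W DW; have [mgX _ _ gXE] := gprop _ (DX n.+1).
  have sA : F s A.
    apply: (@g_measurableP _ _ (F s)) => //; rewrite -[X in measurable X]setTI.
    exact: measurable_fun_le.
  have tA := stF sA.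
  have DP : D t (patch W A (X n.+1)) by exact: Lp_space_patch.
  exists (patch W A (X n.+1)); split => //.
  have [_ _ _ gPE] := gprop _ DP.
  have h1 := crm_patch hF hp hrho s0 st tT sA (DX n.+1) DW.
  have h2 := cond_exp_patch FTs sF sTF Q (mH _ (DX n.+1)) (mH _ DW) sA.
  have EP : patch (\- W) A (\- X n.+1) = \- patch W A (X n.+1).
    by apply/funext => x; rewrite /patch /=; case: ifP.
  rewrite EP in h2.
  have h3 : \forall x \ae P, Num.max (g W x) (g (X n.+1) x) <= g (patch W A (X n.+1)) x.
    apply: (aeS2 h1 (ae_QP h2)) => x a b.
    rewrite [leRHS]/g b; move: a; rewrite /patch; case: ifPn => [/set_mem Ax|/negP].
      by rewrite max_r// => a; rewrite /g lerB.
    rewrite inE => /negP; rewrite -ltNge => nA a; rewrite max_l ?(ltW nA)//.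
    by rewrite /g lerB.
  apply: (aeS2 WP h3) => x a b i; rewrite leq_eqVlt => /predU1P[->|].
    by apply: le_trans b; rewrite le_max lexx orbT.
  by rewrite ltnS => /a c; apply: le_trans b; rewrite le_max c.
(* The running maxima increase in n everywhere, so monotone convergence applies to them; [g (W n)]
   dominates them almost surely and bounds their expectations. *)
pose M := fix M (n : nat) (x : Omega) : R :=
  if n is n'.+1 then Num.max (M n' x) (g (X n) x) else g (X 0%N) x.
have mM n : rv_measurable (F s) (M n).
  elim: n => [|n IH] /=; first by have [] := gprop _ (DX 0%N).
  by apply: measurable_maxr => //; have [] := gprop _ (DX n.+1).
have Mg n x : g (X n) x <= M n x by case: n => [|n] //=; rewrite le_max lexx orbT.
have Mnd x m n : (m <= n)%N -> M m x <= M n x.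
  elim: n => [|n IH]; first by rewrite leqn0 => /eqP ->.
  rewrite leq_eqVlt => /predU1P[->//|]; rewrite ltnS => /IH h.
  by apply: le_trans h _; rewrite /= le_max lexx.
have MW n : \forall x \ae P, M n x <= g (W n) x.
  have [_ h] := WP n; apply: (aeS h) => x {}h.
  suff : forall m, (m <= n)%N -> M m x <= g (W n) x by apply.
  elim=> [|m IH] mn /=; first exact: h.
  by rewrite ge_max IH ?(ltnW mn)//= h.
pose h n x := (M n x - M 0%N x)%:E.
have h0 n x : (0 <= h n x)%E by rewrite lee_fin subr_ge0; exact: Mnd.
have mh n : erv_measurable (F s) (h n).
  by apply: erv_measurable_EFin; apply: rv_measurableB.
have mhT n : erv_measurable (F T) (h n) := erv_measurableS sTF (mh n).
have [mM0 iM0 _ _] := gprop _ (DX 0%N).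
have hC n : (\int[Q]_x h n x <= (C - \int[Q]_x M 0%N x)%:E)%E.
  have [DW _] := WP n; have [mgW igW gWC _] := gprop _ DW.
  have iB : Q.-integrable setT (EFin \o (fun x => g (W n) x - M 0%N x)).
    exact: (integrableB measurableT igW iM0).
  have hle : \forall x \ae Q, M n x <= g (W n) x by exact: ae_PQ.
  apply: (@le_trans _ _ (\int[Q]_x `|(g (W n) x - M 0%N x)%:E|)%E).
    apply: ae_ge0_le_integral => //.
    - exact: mhT.
    - by apply: measurableT_comp => //; exact: (measurable_int _ iB).
    - apply: (aeS hle) => x a _; rewrite lee_fin; apply: le_trans (ler_norm _).
      by rewrite lerD2r.
  have -> : (\int[Q]_x `|(g (W n) x - M 0%N x)%:E| = \int[Q]_x (g (W n) x - M 0%N x)%:E)%E.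
    apply: ae_eq_integral => //.
    - by apply: measurableT_comp => //; exact: (measurable_int _ iB).
    - exact: (measurable_int _ iB).
    - apply: (aeS hle) => x a _; rewrite gee0_abs// lee_fin subr_ge0.
      by apply: le_trans a; exact: Mnd.
  by rewrite -EFin_Rintegral// lee_fin RintegralB// lerD2r.
have mch : erv_measurable (F s) (csup h).
  exact: (@measurable_csup _ (g_sigma_algebraType (F s))).
have ch0 x : (0 <= csup h x)%E by apply: le_trans (h0 0%N x) (csup_ubound h 0%N x).
have choo : (\int[Q]_x csup h x < +oo)%E.
  apply: le_lt_trans (ltry (C - \int[Q]_x M 0%N x)).
  have -> : (\int[Q]_x csup h x = \int[Q]_x limn (h^~ x))%E.
    apply: eq_integral => x _; apply/esym/cvg_lim => //.
    by apply: ereal_nondecreasing_cvgn => m n mn; rewrite lee_fin lerD2r; exact: Mnd.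
  rewrite monotone_convergence//.
    apply: lime_le; last exact: nearW.
    apply: ereal_nondecreasing_is_cvgn => m n mn; apply: ge0_le_integral => //.
    - exact: mhT.
    - exact: mhT.
    - by move=> x _; rewrite lee_fin lerD2r; exact: Mnd.
  by move=> x _ m n mn; rewrite lee_fin lerD2r; exact: Mnd.
have chfin : \forall x \ae Q, csup h x \is a fin_num.
  have ich : Q.-integrable setT (csup h).
    apply/integrableP; split; first exact: erv_measurableS sTF mch.
    by under eq_integral do rewrite gee0_abs//.
  by apply: (aeS (integrable_ae measurableT ich)) => x; exact.
exists (fun x => M 0%N x + fine (csup h x)).
  apply: rv_measurableD => //.
  by apply: measurableT_comp => //; exact: mch.
move=> Z DZ.
have hZ : \forall x \ae P, (cond_exp Q (F s) (\- Z)%R x - (rho s t Z x)%:E <= csup V x)%E.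
  by apply: (Vub (fun x => _)); exists Z.
have hX : \forall x \ae P, forall n, V n x = (g (X n) x)%:E.
  apply: ae_foralln => n; have [_ <-] := XP n.
  by have [_ _ _] := gprop _ (DX n).
apply: (aeS3 hZ hX (ae_QP chfin)) => x a b c; apply: le_trans a _.
apply: csup_le => n; rewrite b [leRHS]EFinD [X in (_ + X)%E]fineK//.
apply: (@le_trans _ _ ((M 0%N x)%:E + h n x)%E); last first.
  by apply: leeD2l; exact: csup_ubound.
by rewrite -EFinD lee_fin addrC subrK; exact: Mg.
Qed.

End conditional_penalty.
End risk_measure.

(** * Mixtures of measures *)

Section mixture.
Context {d} {Omega : measurableType d} {R : realType} {H G : set_system Omega}.
Hypotheses (sH : sigma_algebra setT H) (sG : sigma_algebra setT G) (GH : G `<=` H).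
Local Open Scope ereal_scope.

(** Both measures admit the same set of versions, so the choice made by [xget] is the same and the
    equality holds everywhere. *)
Lemma cond_exp_restrict (K : set_system Omega) (sK : sigma_algebra setT K) (HK : H `<=` K)
    (Q : probability (g_sigma_algebraType K) R)
    (Q' : probability (g_sigma_algebraType H) R) :
  (forall A, H A -> Q' A = Q A) ->
  (forall f A, erv_measurable H f -> (forall x, 0 <= f x) -> H A ->
      \int[Q']_(x in A) f x = \int[Q]_(x in A) f x) ->
  forall X, rv_measurable H X -> cond_exp Q' G X = cond_exp Q G X.
Proof.
move=> QE QI X mX.
have nneg (f : Omega -> R) : rv_measurable H f -> (forall x, 0 <= f x)%R ->
    cond_exp_nneg Q' G (EFin \o f) = cond_exp_nneg Q G (EFin \o f).
  move=> mf f0; rewrite /cond_exp_nneg; congr xget.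
  apply/seteqP; split => g [mg g0 gE]; split => // A GA; have := gE A GA.
    by rewrite (QI _ _ (erv_measurableS GH mg) g0 (GH GA))
      (QI _ _ (erv_measurable_EFin mf) (fun x => f0 x) (GH GA)).
  by rewrite (QI _ _ (erv_measurableS GH mg) g0 (GH GA))
      (QI _ _ (erv_measurable_EFin mf) (fun x => f0 x) (GH GA)).
by rewrite !cond_expE !nneg //; [exact: rv_measurable_neg|exact: rv_measurable_pos].
Qed.

Lemma integral_indicr d0 (T : measurableType d0) (mu : {measure set T -> \bar R})
    (A : set T) (f : T -> \bar R) :
  \int[mu]_(x in A) f x = \int[mu]_x ((\1_A x)%:E * f x).
Proof.
rewrite integral_mkcond; apply: eq_integral => x _.
by rewrite /patch indicE; case: ifPn => xA; rewrite ?mul1e ?mul0e.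
Qed.

Variables (R0 Q : probability (g_sigma_algebraType H) R) (e : Omega -> R).
Hypotheses (me : rv_measurable G e) (e0 : forall x, (0 < e x)%R)
  (e1 : forall x, (e x < 1)%R)
  (R0Q : forall A, G A -> Q A = 0 <-> R0 A = 0).

(* W is the density of R0 with respect to Q on G, so e W Q has the G-marginal
   e R0 and the mixture (1 - e) R0 + e W Q agrees with R0 on G. *)
Lemma mixture : exists S : probability (g_sigma_algebraType H) R,
  [/\ forall A, G A -> S A = R0 A,
      forall A, H A -> S A = 0 -> Q A = 0 &
      forall f, rv_measurable H f -> (forall x, 0 <= f x)%R ->
        \int[R0]_x (f x)%:E < +oo -> \int[Q]_x (f x)%:E < +oo ->
        is_cond_exp_nneg S G (EFin \o f) (fun x =>
          (1 - e x)%:E * cond_exp_nneg R0 G (EFin \o f) x +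
          (e x)%:E * cond_exp_nneg Q G (EFin \o f) x)].
Proof.
have [r [rE rI]] := ex_restrict_measure R0 sG sH GH.
have [q [qE qI]] := ex_restrict_measure Q sG sH GH.
have roo : r setT < +oo.
  suff -> : r setT = 1 by exact: ltry.
  by rewrite rE; exact: (probability_setT R0).
have qoo : q setT < +oo.
  suff -> : q setT = 1 by exact: ltry.
  by rewrite qE; exact: (probability_setT Q).
have GT : G setT by exact: (g_measurableP sG measurableT).
have [W [mW W0 WE]] : exists f : Omega -> R, [/\ rv_measurable G f,
    (forall x, 0 <= f x)%R & forall A, G A -> r A = \int[q]_(x in A) (f x)%:E].
  have [A mA|f [mf f0 fE]] := ex_radon_nikodym qoo roo.
    by rewrite qE rE => /(R0Q (g_measurableP sG mA)).
  by exists f; split => // A GA; apply: fE; exact: g_measurableE.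
have dens h : erv_measurable G h -> (forall x, 0 <= h x) ->
    \int[R0]_x h x = \int[Q]_x (h x * (W x)%:E).
  move=> mh h0; rewrite -rI// -qI//; last 2 first.
    by apply: emeasurable_funM => //; exact: erv_measurable_EFin.
    by move=> x; rewrite mule_ge0 ?lee_fin.
  apply: (integral_density qoo roo) => //.
  - exact: erv_measurable_EFin.
  - by move=> A mA; apply: WE; exact: g_measurableP mA.
pose a x : R := (1 - e x)%R; pose b x : R := (e x * W x)%R.
have a0 x : (0 <= a x)%R by rewrite subr_ge0 ltW.
have b0 x : (0 <= b x)%R by rewrite mulr_ge0 ?W0// ltW.
have ma : rv_measurable G a by apply: measurable_funB => //; exact: measurable_cst.
have mb : rv_measurable G b by exact: measurable_funM.
have maH := erv_measurable_EFin (rv_measurableS GH ma).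
have mbH := erv_measurable_EFin (rv_measurableS GH mb).
have [nu0 nu0E] := ex_density_measure R0 maH (fun x => a0 x).
have [nu1 nu1E] := ex_density_measure Q mbH (fun x => b0 x).
have ib : \int[Q]_x (b x)%:E = \int[R0]_x (e x)%:E.
  rewrite (dens (EFin \o e)) => [//||x]; first exact: erv_measurable_EFin.
  by rewrite lee_fin ltW.
have le1 (S : probability (g_sigma_algebraType H) R) (h : Omega -> R) :
    rv_measurable G h -> (forall x, 0 <= h x <= 1)%R -> \int[S]_x (h x)%:E < +oo.
  move=> mh h01; apply: (@le_lt_trans _ _ (\int[S]_x 1)).
    apply: ge0_le_integral => //.
    - by move=> x _; rewrite lee_fin; case/andP: (h01 x).
    - exact: erv_measurable_EFin (rv_measurableS GH mh).
    - by move=> x _; rewrite lee_fin; case/andP: (h01 x).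
  by rewrite integral_probability_cst ltry.
have R0oo (S : probability (g_sigma_algebraType H) R) : S setT < +oo.
  suff -> : S setT = 1 by exact: ltry.
  exact: (probability_setT S).
have nu0oo : nu0 setT < +oo.
  by rewrite nu0E; apply: le1 => // x; rewrite a0 gerBl ltW.
have nu1oo : nu1 setT < +oo.
  by rewrite nu1E ib; apply: le1 => // x; rewrite !ltW.
pose m : {measure set (g_sigma_algebraType H) -> \bar R} := measure_add nu0 nu1.
have mI h : erv_measurable H h -> (forall x, 0 <= h x) ->
    \int[m]_x h x = \int[R0]_x (h x * (a x)%:E) + \int[Q]_x (h x * (b x)%:E).
  move=> mh h0; rewrite /m ge0_integral_measure_add//; congr (_ + _).
    apply: (integral_density (R0oo R0) nu0oo) => //.
  apply: (integral_density (R0oo Q) nu1oo) => //.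
have mG k : erv_measurable G k -> (forall x, 0 <= k x) -> \int[m]_x k x = \int[R0]_x k x.
  move=> mk k0; have mkH := erv_measurableS GH mk.
  rewrite mI//; have -> : \int[Q]_x (k x * (b x)%:E) = \int[R0]_x (k x * (e x)%:E).
    rewrite (dens (fun x => k x * (e x)%:E)).
    - by apply: eq_integral => x _; rewrite EFinM muleA.
    - by apply: emeasurable_funM => //; exact: erv_measurable_EFin.
    - by move=> x; rewrite mule_ge0// lee_fin ltW.
  rewrite -ge0_integralD//.
  - apply: eq_integral => x _; rewrite -ge0_muleDr ?lee_fin ?a0 ?ltW//.
    by rewrite -EFinD subrK mule1.
  - by move=> x _; rewrite mule_ge0// lee_fin.
  - exact: emeasurable_funM.
  - by move=> x _; rewrite mule_ge0// lee_fin ltW.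
  - apply: emeasurable_funM => //.
    exact: erv_measurable_EFin (rv_measurableS GH me).
have mind (K : set_system Omega) A : sigma_algebra setT K -> K A ->
    rv_measurable K (\1_A : Omega -> R).
  by move=> sK KA; apply: measurable_indic; exact: g_measurableE.
have mset (mu : {measure set (g_sigma_algebraType H) -> \bar R}) A : H A ->
    mu A = \int[mu]_x (\1_A x : R)%:E.
  by move=> HA; rewrite integral_indic// ?setIT//; exact: g_measurableE.
have mE A : G A -> m A = R0 A.
  move=> GA; rewrite (mset m) ?(mset R0)//; [|exact: GH..].
  apply: (mG (EFin \o (\1_A : Omega -> R))) => [|x]; last by rewrite lee_fin.
  by apply: erv_measurable_EFin; exact: mind.
have m1 : m setT = 1 by rewrite mE//; exact: (probability_setT R0).
have [S SE] := ex_probability m1.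
have SI h : \int[S]_x h x = \int[m]_x h x by apply: eq_measure_integral => A _ _; exact: SE.
exists S; split => [A GA|A HA|f mf f0 fR fQ].
- by rewrite SE mE.
- move=> SA; have : nu1 A = 0.
    move: SA; rewrite SE [m A]measure_addE => /eqP.
    by rewrite padde_eq0// => /andP[_ /eqP].
  have mA := g_measurableE sH HA.
  (* R0 gives mass 0 to the set W = 0, since W is its density on G; by equality of null sets so does
     Q. Hence the density b = e W is positive Q-a.s. *)
  have GZ : G [set x | W x = 0%R].
    have /(_ measurableT _ (measurable_set1 0%R)) := mW.
    by rewrite setTI => /(g_measurableP sG).
  have QZ : Q [set x | W x = 0%R] = 0.
    apply/(R0Q GZ); rewrite -rE WE//.
    by apply: integral0_eq => x /= ->.
  rewrite nu1E => bA.
  have : \int[Q]_(x in A) `|(b x)%:E| = 0.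
    by rewrite -[RHS]bA; apply: eq_integral => x _; rewrite gee0_abs ?lee_fin.
  have mbA : measurable_fun (A : set (g_sigma_algebraType H)) (EFin \o b).
    exact: measurable_funTS mbH.
  move=> /(ae_eq_integral_abs Q mA mbA) bA0.
  apply: (measure_negligible mA).
  have [N [mN N0 sN]] := bA0.
  exists (N `|` [set x | W x = 0%R]); split.
  + by apply: measurableU => //; exact: g_measurableE sH (GH GZ).
  + by apply: null_set_setU => //; exact: g_measurableE sH (GH GZ).
  + move=> x Ax; have [Wx|Wx] := pselect (W x = 0%R); [by right|left].
    apply: sN => /= /(_ Ax) [] /eqP; rewrite mulf_eq0 => /orP[|/eqP//].
    by rewrite (gt_eqF (e0 x)).
- have [mR gR0 gRE] := cond_exp_nnegP sH sG GH R0 mf f0.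
  have [mQ gQ0 gQE] := cond_exp_nnegP sH sG GH Q mf f0.
  have mfH := erv_measurable_EFin mf.
  split => [|x|A GA].
  + by apply: emeasurable_funD; apply: emeasurable_funM => //; exact: erv_measurable_EFin.
  + by rewrite adde_ge0// mule_ge0// lee_fin ?a0// ltW.
  have mI1 := mind G A sG GA; have mI1E := erv_measurable_EFin mI1.
  have mI1H := erv_measurable_EFin (rv_measurableS GH mI1).
  have mea := erv_measurable_EFin ma.
  have mee := erv_measurable_EFin me.
  have t1 : \int[R0]_x ((\1_A x : R)%:E * ((a x)%:E * cond_exp_nneg R0 G (EFin \o f) x))
      = \int[R0]_x ((\1_A x : R)%:E * (f x)%:E * (a x)%:E).
    have mh : rv_measurable G (\1_A \* a)%R by exact: measurable_funM.
    have h0 x : (0 <= (\1_A \* a)%R x)%R by rewrite mulr_ge0.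
    transitivity (\int[R0]_x (((\1_A \* a)%R x)%:E * cond_exp_nneg R0 G (EFin \o f) x)).
      by apply: eq_integral => x _; rewrite /= EFinM muleA.
    rewrite (cond_exp_nneg_pull sH sG GH mf f0 fR mh h0).
    by apply: eq_integral => x _; rewrite /= EFinM muleAC.
  (* [dens] turns an R0-integral of a G-measurable function into a Q-integral weighted by W; then
     E_Q(f | G) is replaced by f against the G-measurable weight. *)
  have t2 : \int[R0]_x ((\1_A x : R)%:E * ((e x)%:E * cond_exp_nneg Q G (EFin \o f) x))
      = \int[Q]_x ((\1_A x : R)%:E * (f x)%:E * (b x)%:E).
    rewrite (dens (fun x => (\1_A x : R)%:E * ((e x)%:E * cond_exp_nneg Q G (EFin \o f) x))).
    + have mh : rv_measurable G (\1_A \* b)%R by exact: measurable_funM.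
      have h0 x : (0 <= (\1_A \* b)%R x)%R by rewrite mulr_ge0.
      transitivity (\int[Q]_x (((\1_A \* b)%R x)%:E * cond_exp_nneg Q G (EFin \o f) x)).
        apply: eq_integral => x _; rewrite /= /b !EFinM -!muleA.
        by congr (_ * (_ * _)); exact: muleC.
      rewrite (cond_exp_nneg_pull sH sG GH mf f0 fQ mh h0).
      by apply: eq_integral => x _; rewrite /= EFinM muleAC.
    + by apply: emeasurable_funM => //; apply: emeasurable_funM.
    + by move=> x; rewrite !mule_ge0// lee_fin ?ltW.
  rewrite integral_indicr [RHS]integral_indicr !SI.
  rewrite (mG (fun x => (\1_A x : R)%:E * ((1 - e x)%:E * cond_exp_nneg R0 G (EFin \o f) x +
          (e x)%:E * cond_exp_nneg Q G (EFin \o f) x))).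
  + rewrite mI; last 2 first.
      by apply: emeasurable_funM.
      by move=> x; rewrite mule_ge0// lee_fin.
    rewrite -t1 -t2 -ge0_integralD//.
    * apply: eq_integral => x _; rewrite ge0_muleDr// mule_ge0// lee_fin ?a0//.
      exact: ltW.
    * by move=> x _; rewrite !mule_ge0// lee_fin ?a0.
    * apply: emeasurable_funM => //; apply: emeasurable_funM => //.
      exact: erv_measurableS GH mR.
    * by move=> x _; rewrite !mule_ge0// lee_fin ?ltW.
    * apply: emeasurable_funM => //; apply: emeasurable_funM => //.
        exact: erv_measurableS GH mee.
      exact: erv_measurableS GH mQ.
  + apply: emeasurable_funM => //.
    by apply: emeasurable_funD; exact: emeasurable_funM.
  + move=> x; rewrite mule_ge0 ?lee_fin// adde_ge0// mule_ge0// lee_fin ?a0//.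
    exact: ltW.
Qed.
End mixture.

Section signed_mixture.
Context {d} {Omega : measurableType d} {R : realType} {H G : set_system Omega}.
Hypotheses (sH : sigma_algebra setT H) (sG : sigma_algebra setT G) (GH : G `<=` H).
Local Open Scope ereal_scope.

(** The exceptional set of an inequality between G-measurable functions lies in G, so comparing null
    sets within G suffices. The map i is there to change the measurable structure. *)
Lemma ae_le_sub d' (T' : measurableType d')
    (mu : {measure set (g_sigma_algebraType H) -> \bar R})
    (nu : {measure set T' -> \bar R}) (i : T' -> Omega) (f g : Omega -> \bar R) :
  erv_measurable G f -> erv_measurable G g ->
  (forall A, G A -> measurable (i @^-1` A)) ->
  (forall A, G A -> mu A = 0 -> nu (i @^-1` A) = 0) ->
  (\forall x \ae mu, f x <= g x) -> \forall x \ae nu, f (i x) <= g (i x).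
Proof.
move=> mf mg mi munu fg; pose A := [set x | g x < f x].
have GA : G A.
  apply: (@g_measurableP _ _ G) => //; rewrite -[X in measurable X]setTI.
  exact: measurable_lte.
exists (i @^-1` A); split; first exact: mi.
- apply: munu => //; apply: measure_negligible; first exact: g_measurableE sH (GH GA).
  apply: negligibleS fg => x /= xA fgx.
  by move: xA; rewrite /A/= ltNge fgx.
- by move=> x /= /negP; rewrite -ltNge.
Qed.

(** Finiteness is the inequality |f| <= fine |f|, since [fine] sends +oo to 0; this brings it under
    [ae_le_sub]. *)
Lemma ae_fin_sub d' (T' : measurableType d')
    (mu : {measure set (g_sigma_algebraType H) -> \bar R})
    (nu : {measure set T' -> \bar R}) (i : T' -> Omega) (f : Omega -> \bar R) :
  erv_measurable G f ->
  (forall A, G A -> measurable (i @^-1` A)) ->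
  (forall A, G A -> mu A = 0 -> nu (i @^-1` A) = 0) ->
  (\forall x \ae mu, f x \is a fin_num) -> \forall x \ae nu, f (i x) \is a fin_num.
Proof.
move=> mf mi munu ff.
have mf' : erv_measurable G (fun x => `|f x|) by exact: measurableT_comp.
pose g (x : Omega) : \bar R := (fine `|f x|)%:E.
have mg : erv_measurable G g.
  by apply: erv_measurable_EFin; exact: measurableT_comp.
have fg : \forall x \ae mu, `|f x| <= g x.
  by apply: (aeS ff) => x h; rewrite /g fineK// abse_fin_num.
apply: (aeS (ae_le_sub mf' mg mi munu fg)) => x h.
by rewrite -abse_fin_num ge0_fin_numE// (le_lt_trans h)// ltry.
Qed.

Variables (R0 Q : probability (g_sigma_algebraType H) R) (e : Omega -> R).
Hypotheses (me : rv_measurable G e) (e0 : forall x, (0 < e x)%R)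
  (e1 : forall x, (e x < 1)%R)
  (R0Q : forall A, G A -> Q A = 0 <-> R0 A = 0).

Lemma mixture_cond_exp : exists S : probability (g_sigma_algebraType H) R,
  [/\ forall A, G A -> S A = R0 A,
      forall A, H A -> S A = 0 -> Q A = 0 &
      forall X, rv_measurable H X -> R0.-integrable setT (EFin \o X) ->
        Q.-integrable setT (EFin \o X) ->
        \forall x \ae S, [/\ cond_exp R0 G X x \is a fin_num,
          cond_exp Q G X x \is a fin_num &
          cond_exp S G X x = (1 - e x)%:E * cond_exp R0 G X x + (e x)%:E * cond_exp Q G X x]].
Proof.
have [S [SR SQ SE]] := mixture sH sG GH me e0 e1 R0Q.
exists S; split => // X mX iR iQ.
have GHm A : G A -> measurable (A : set (g_sigma_algebraType H)).
  by move=> GA; exact: g_measurableE sH (GH GA).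
have RS A : G A -> R0 A = 0 -> S A = 0 by move=> GA; rewrite SR.
have QS A : G A -> Q A = 0 -> S A = 0 by move=> GA QA; apply: RS => //; exact/R0Q.
have pos (M : probability (g_sigma_algebraType H) R) : M.-integrable setT (EFin \o X) ->
    (\int[M]_x (X^\+ x)%:E < +oo) /\ (\int[M]_x (X^\- x)%:E < +oo).
  move=> iM; have /integrableP[_ ip] := integrable_funrpos measurableT iM.
  have /integrableP[_ im] := integrable_funrneg measurableT iM; split.
    by under eq_integral do rewrite -[X in X%:E](ger0_norm (funrpos_ge0 X _)).
  by under eq_integral do rewrite -[X in X%:E](ger0_norm (funrneg_ge0 X _)).
have [iRp iRn] := pos _ iR; have [iQp iQn] := pos _ iQ.
have mp := rv_measurable_pos mX; have mn := rv_measurable_neg mX.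
have fin (M : probability (g_sigma_algebraType H) R) (f : Omega -> R) :
    (forall A, G A -> M A = 0 -> S A = 0) ->
    rv_measurable H f -> (forall x, 0 <= f x)%R -> \int[M]_x (f x)%:E < +oo ->
    \forall x \ae S, cond_exp_nneg M G (EFin \o f) x \is a fin_num.
  move=> MS mf f0 foo; have [mc c0 _] := cond_exp_nnegP sH sG GH M mf f0.
  apply: (@ae_fin_sub _ (g_sigma_algebraType H) M S id _ mc GHm MS).
  apply: (aeS (cond_exp_nneg_lty sH sG GH mf f0 foo)) => x h.
  by rewrite ge0_fin_numE.
have up := is_cond_exp_nneg_unique sH sG GH (cond_exp_nnegP sH sG GH S mp (funrpos_ge0 X))
  (SE _ mp (funrpos_ge0 X) iRp iQp).
have un := is_cond_exp_nneg_unique sH sG GH (cond_exp_nnegP sH sG GH S mn (funrneg_ge0 X))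
  (SE _ mn (funrneg_ge0 X) iRn iQn).
have f1 := fin R0 _ RS mp (funrpos_ge0 X) iRp.
have f2 := fin R0 _ RS mn (funrneg_ge0 X) iRn.
have f3 := fin Q _ QS mp (funrpos_ge0 X) iQp.
have f4 := fin Q _ QS mn (funrneg_ge0 X) iQn.
rewrite !cond_expE.
have f12 := aeS2 f1 f2 (fun x => @conj _ _).
have f34 := aeS2 f3 f4 (fun x => @conj _ _).
apply: (aeS4 up un f12 f34) => x -> -> [/fineK <- /fineK <-] [/fineK <- /fineK <-].
split => //; rewrite -!(EFinM, EFinD, EFinN); congr (_%:E); ring.
Qed.
End signed_mixture.

(** * Nearly optimal equivalent measures *)

Section near_optimal.
Context {d} {Omega : measurableType d} {R : realType}.
Variables (P : probability Omega R) (T : R) (F : R -> set_system Omega) (p : R).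
Variable rho : R -> R -> (Omega -> R) -> Omega -> R.
Hypotheses (hT : 0 < T) (hF : complete_filtration P T F)
  (hF0 : trivial_sigma_algebra P (F 0)) (hp : 1 <= p)
  (hrho : fully_dynamic_crm P T F p rho)
  (htc : strong_time_consistent P T F p rho).
Implicit Types X Y Z : Omega -> R.
Local Notation D t := (Lp_space P p (F t)).
Local Notation QQ := (calQ P T F p rho).
Variables (s t : R).
Hypotheses (s0 : 0 <= s) (st : s <= t) (tT : t <= T).
Let T0 : 0 <= T. Proof. exact: ltW. Qed.
Let TT := lexx T.
Let t0 : 0 <= t. Proof. exact: le_trans st. Qed.
Let sT : s <= T. Proof. exact: le_trans tT. Qed.
Let sF := filtration_sigmaW hF s0 sT.
Let tF := filtration_sigmaW hF t0 tT.
Let TF := filtration_sigmaW hF T0 TT.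
Let sm := filtration_subW hF s0 sT.
Let tm := filtration_subW hF t0 tT.
Let stF : F s `<=` F t. Proof. exact: (filtration_mono hF). Qed.
Let tTF : F t `<=` F T. Proof. exact: (filtration_mono hF). Qed.
Let DtT X : D t X -> D T X. Proof. exact: (Lp_space_mono hF). Qed.
Let rho_maps X : D t X -> D s (rho s t X). Proof. exact: (crm_maps hrho). Qed.

Lemma probability_restrict (Q : probability (g_sigma_algebraType (F T)) R) :
  exists Q' : probability (g_sigma_algebraType (F t)) R,
  [/\ forall A, Q' A = Q A,
      forall X, rv_measurable (F t) X -> Q.-integrable setT (EFin \o X) ->
        Q'.-integrable setT (EFin \o X) &
      forall X, rv_measurable (F t) X -> cond_exp Q' (F s) X = cond_exp Q (F s) X].
Proof.
have [nu [nuE nuI]] := ex_restrict_measure Q tF TF tTF.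
have [Q' Q'E] : exists Q' : probability (g_sigma_algebraType (F t)) R, forall A, Q' A = nu A.
  by apply: ex_probability; rewrite nuE; exact: (probability_setT Q).
have Q'I f A : erv_measurable (F t) f -> (forall x, 0 <= f x)%E -> F t A ->
    (\int[Q']_(x in A) f x = \int[Q]_(x in A) f x)%E.
  move=> mf f0 FA; rewrite -nuI//.
  by apply: eq_measure_integral => B mB _; exact: Q'E.
exists Q'; split => [A|X mX iX|X mX].
- by rewrite Q'E nuE.
- apply/integrableP; split; first exact: erv_measurable_EFin.
  have /integrableP[_] := iX; rewrite Q'I//.
  + by apply: measurableT_comp => //; exact: erv_measurable_EFin.
  + exact: (g_measurableP tF measurableT).
- apply: (cond_exp_restrict stF TF tTF) => // A FA.
  by rewrite Q'E nuE.
Qed.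

Let GHm A : F s A -> measurable (A : set Omega). Proof. exact: sm. Qed.

(** Holding on every A in F_s, the subgradient inequality says E_R0(X - Z | F_s) <= rho_st Z -
    rho_st X; adding E_R0(-X | F_s) to both sides makes X optimal. *)
Lemma ex_dominated_subgradient X : D t X ->
  exists R0 : probability (g_sigma_algebraType (F t)) R,
  [/\ forall A, F s A -> R0 A = P A,
      forall Z, D t Z -> R0.-integrable setT (EFin \o Z) &
      forall Z, D t Z -> \forall x \ae P,
        (cond_exp R0 (F s) (\- Z)%R x - (rho s t Z x)%:E
         <= cond_exp R0 (F s) (\- X)%R x - (rho s t X x)%:E)%E].
Proof.
move=> DX; have [R0 [RP iR Rsub]] := crm_subgradient hF hp hrho s0 st tT DX.
exists R0; split => // Z DZ.
pose V x := rho s t Z x - rho s t X x.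
have DV : D s V by apply: (Lp_spaceB hp sF sm); exact: rho_maps.
have iV A : F s A -> R0.-integrable setT (EFin \o patch (cst 0) A V) /\
    (\int[R0]_(x in A) (V x)%:E = \int[P]_(x in A) (V x)%:E)%E.
  move=> FA; have DVA : D s (patch (cst 0) A V).
    by apply: (Lp_space_patch hp sF sm) => //; exact: (Lp_space_cst P p sF sm).
  have iP := Lp_space_integrable hp sF sm DVA.
  have [iA iE] := integral_agree sF tF stF tm RP (proj1 DVA) iP.
  split => //; rewrite integral_mkcond [RHS]integral_mkcond.
  have -> : ((fun x => (V x)%:E) \_ A)%E = EFin \o patch (cst 0) A V.
    by apply/funext => x; rewrite /= /patch; case: ifP.
  by rewrite -!EFin_Rintegral// iE.
have sT' : F s setT by exact: (g_measurableP sF measurableT).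
have iVT : R0.-integrable setT (EFin \o V).
  have [+ _] := iV _ sT'; congr (_.-integrable _ (EFin \o _)).
  by apply/funext => x; rewrite /patch in_setT.
have DXZ : D t (X \- Z) by exact: (Lp_spaceB hp tF tm).
have DNX : D t (\- X) by exact: (Lp_spaceN hp tF tm).
have ci Y : D t Y -> cond_integrable (G:=F s) R0 Y.
  move=> DY; apply: (cond_integrable_integrable tF sF stF); first by case: DY.
  exact: iR.
have h1 : \forall x \ae R0, (cond_exp R0 (F s) (X \- Z)%R x <= (V x)%:E)%E.
  apply: (cond_exp_le_of_integral tF sF stF) => //.
  - by case: DXZ.
  - by case: DV.
  - exact: iR.
  - by move=> A FA; have [_ ->] := iV _ FA; exact: Rsub.
have h2 := cond_expD tF sF stF (proj1 DNX) (proj1 DXZ) (ci _ DNX) (ci _ DXZ).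
have h3 := cond_exp_fin tF sF stF (proj1 DNX) (ci _ DNX).
have e2 : ((\- X) \+ (X \- Z))%R = (\- Z)%R.
  by apply/funext => x; rewrite /= addKr.
rewrite e2 in h2.
have mr Y : D t Y -> erv_measurable (F s) (fun x => cond_exp R0 (F s) (\- Y)%R x - (rho s t Y x)%:E)%E.
  move=> DY; apply: emeasurable_funB.
    by apply: (erv_measurable_ce tF sF stF); case: (Lp_spaceN hp tF tm DY).
  by apply: erv_measurable_EFin; case: (rho_maps DY).
have RP0 A : F s A -> R0 A = 0%E -> P A = 0%E by move=> FA; rewrite RP.
apply: (@ae_le_sub _ Omega R (F t) (F s) tF sF stF _ Omega R0 P id _ _
  (mr Z DZ) (mr X DX) GHm RP0).
apply: (aeS3 h1 h2 h3) => x a b; rewrite b => /fineK <-.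
apply: (@le_trans _ _ ((fine (cond_exp R0 (F s) (\- X)%R x))%:E + (V x)%:E - (rho s t Z x)%:E)%E).
  by apply: leeB => //; exact: leeD2l.
by rewrite -!(EFinD, EFinN) lee_fin /V lerBlDr; lra.
Qed.

(* R0 is made equivalent to P by mixing in Q with an F_s-measurable weight e,
   chosen so small that optimality at X is lost by at most del. *)
Lemma near_optimal_measure Q X (del : R) : QQ Q -> D t X -> 0 < del ->
  exists S : probability (g_sigma_algebraType (F t)) R,
  exists U : Omega -> R,
  [/\ equivalent_on P S, forall A, F s A -> S A = P A, rv_measurable (F s) U,
      forall Z, D t Z -> \forall x \ae P,
        (cond_exp S (F s) (\- Z)%R x - (rho s t Z x)%:E <= (U x)%:E)%E &
      \forall x \ae P,
        ((rho s t X x + U x - del)%:E <= cond_exp S (F s) (\- X)%R x)%E].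
Proof.
move=> QQ_Q DX del0; have [QP _] := QQ_Q.
have [C CP] := calQ_bound hT hF hF0 hp hrho QQ_Q.
have [U1 mU1 U1P] := conditional_penalty_finite hT hF hF0 hp hrho htc s0 st tT QQ_Q.
have [Qt [QtE iQt ceQt]] := probability_restrict Q.
have [R0 [RP iR RU]] := ex_dominated_subgradient DX.
have iQ Z : D t Z -> Qt.-integrable setT (EFin \o Z).
  by move=> DZ; apply: iQt; [case: DZ|have [] := CP _ (DtT DZ)].
have DN Z : D t Z -> D t (\- Z) by exact: (Lp_spaceN hp tF tm).
pose cR := cond_exp R0 (F s) (\- X)%R; pose cQ := cond_exp Qt (F s) (\- X)%R.
have mcR : erv_measurable (F s) cR by apply: (erv_measurable_ce tF sF stF); case: (DN _ DX).
have mcQ : erv_measurable (F s) cQ by apply: (erv_measurable_ce tF sF stF); case: (DN _ DX).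
pose U0 x := fine (cR x) - rho s t X x.
have mrX : rv_measurable (F s) (rho s t X) by case: (rho_maps DX).
have mU0 : rv_measurable (F s) U0.
  by apply: rv_measurableB => //; exact: measurableT_comp.
pose K x := `|U1 x| + `|fine (cQ x)| + `|rho s t X x|.
have K0 x : 0 <= K x by rewrite !addr_ge0.
have mK : rv_measurable (F s) K.
  apply: rv_measurableD; last exact: rv_measurable_norm.
  apply: rv_measurableD; first exact: rv_measurable_norm.
  apply: (rv_measurable_norm (X := fine \o cQ)); exact: measurableT_comp.
(* The denominator exceeds both del and K, so that e < 1 and e K <= del. *)
pose e x := del * (del + 1 + K x)^-1.
have den0 x : 0 < del + 1 + K x by rewrite ltr_wpDr// addr_gt0.
have e0 x : 0 < e x by rewrite mulr_gt0// invr_gt0.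
have e1 x : e x < 1.
  by rewrite /e ltr_pdivrMr// mul1r -addrA ltrDl ltr_wpDr.
have me : rv_measurable (F s) e.
  apply: measurable_funM; first exact: measurable_cst.
  apply: measurable_fun_inv_ge0; last by move=> x; exact: ltW.
  by apply: measurable_funD => //; exact: measurable_cst.
have R0Q A : F s A -> Qt A = 0%E <-> R0 A = 0%E.
  by move=> FA; rewrite QtE RP//; apply: QP; exact/tTF/stF.
have [S [SR SQ SE]] := mixture_cond_exp tF sF stF me e0 e1 R0Q.
(* The mixture of the optimal value U0 for R0 and of the bound U1 for Q. *)
pose U x := (1 - e x) * U0 x + e x * U1 x.
have SP A : F s A -> S A = P A by move=> FA; rewrite SR// RP.
have PS : equivalent_on P S.
  move=> A FA; split => [SA|PA].
    by apply/(QP _ (tTF FA)); rewrite -QtE; exact: SQ.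
  have [FsA _] := negligible_F hF s0 sT ((negligibleP P (tm FA)).2 PA).
  by rewrite SP.
have ae_SP (B : Omega -> Prop) : (\forall x \ae S, B x) -> \forall x \ae P, B x.
  exact: (ae_equiv_from hF t0 tT PS).
have SEZ Z (DZ : D t Z) := ae_SP _ (SE _ (proj1 (DN _ DZ)) (iR _ (DN _ DZ)) (iQ _ (DN _ DZ))).
exists S, U; split => //.
- apply: rv_measurableD; apply: measurable_funM => //.
  by apply: measurable_funB => //; exact: measurable_cst.
- move=> Z DZ; have := U1P _ DZ.
  rewrite -ceQt; last by case: (DN _ DZ).
  move=> hq; apply: (aeS4 (SEZ _ DZ) (SEZ _ DX) (RU _ DZ) hq) => x.
  move=> [/fineK <- /fineK <- ->] [/fineK cRx _ _].
  rewrite /U /U0 -/cR in cRx *; rewrite -{}cRx -!(EFinM, EFinD, EFinN) !lee_fin.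
  set a := fine _; set b := fine _ => /= h1 h2.
  have := ler_wpM2l (ltW (e0 x)) h2.
  have := ler_wpM2l (_ : 0 <= 1 - e x) h1.
  by rewrite subr_ge0 (ltW (e1 x)) => /(_ isT); lra.
- apply: (aeS (SEZ _ DX)) => x [/fineK hR /fineK hQ ->].
  rewrite -/cR -/cQ in hR hQ *; rewrite -hR -hQ -!(EFinM, EFinD, EFinN) lee_fin.
  rewrite /U /U0.
  (* The left-hand side is exactly the loss U - (E_S(-X | F_s) - rho_st X) of optimality at X. *)
  have : e x * (U1 x + rho s t X x - fine (cQ x)) <= del.
    apply: (@le_trans _ _ (e x * K x)).
      rewrite ler_wpM2l ?(ltW (e0 x))// /K.
      have := ler_norm (U1 x); have := ler_norm (rho s t X x).
      have := ler_norm (- fine (cQ x)); rewrite normrN; lra.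
    rewrite /e -mulrA ler_piMr ?(ltW del0)// mulrC ler_pdivrMr// mul1r.
    by rewrite lerDr ltW// addr_gt0.
  lra.
Qed.

End near_optimal.

(** * Contraction for c *)

Section contraction.
Context {d} {Omega : measurableType d} {R : realType}.
Variables (P : probability Omega R) (T : R) (F : R -> set_system Omega) (p : R).
Variable rho : R -> R -> (Omega -> R) -> Omega -> R.
Hypotheses (hT : 0 < T) (hF : complete_filtration P T F)
  (hF0 : trivial_sigma_algebra P (F 0)) (hp : 1 <= p)
  (hrho : fully_dynamic_crm P T F p rho)
  (htc : strong_time_consistent P T F p rho).
Implicit Types X Y Z : Omega -> R.
Local Notation D t := (Lp_space P p (F t)).
Local Notation QQ := (calQ P T F p rho).
Local Notation phi Z := (\int[P]_x rho 0 T Z x).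
Variable rhobar : (Omega -> R) -> R.
Hypotheses (hbar : coherent_risk_measure P p (F T) rhobar)
  (hdom : forall X, D T X ->
     \forall x \ae P, rho 0 T X x - rho 0 T (cst 0) x <= rhobar X).
Hypothesis hsens : QQ !=set0.
Let T0 : 0 <= T. Proof. exact: ltW. Qed.
Let TT := lexx T.
Let TF := filtration_sigmaW hF T0 TT.
Let Tm := filtration_subW hF T0 TT.
Let F0s := filtration_sigmaW hF (lexx 0) T0.
Let F0m := filtration_subW hF (lexx 0) T0.
Let F0T : F 0 `<=` F T. Proof. exact: (filtration_mono hF). Qed.

Lemma cnorm_fin_num Z : D T Z -> cnorm QQ Z \is a fin_num.
Proof.
move=> DZ; rewrite ge0_fin_numE.
  by apply: le_lt_trans (cnorm_le_rhobar hT hF hF0 hp hrho hbar hdom DZ) _; rewrite ltry.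
have [Q QQ_Q] := hsens; apply: le_trans (cnorm_ge Z QQ_Q).
by apply: integral_ge0 => x _; rewrite lee_fin.
Qed.

Lemma Rintegral_le_cnorm Q Z : QQ Q -> D T Z ->
  Q.-integrable setT (EFin \o Z) /\ \int[Q]_x `|Z x| <= fine (cnorm QQ Z).
Proof.
move=> QQ_Q DZ; have [C CP] := calQ_bound hT hF hF0 hp hrho QQ_Q.
have [iZ _] := CP _ DZ; have [iN _] := CP _ (Lp_space_norm hp TF Tm DZ).
split => //; rewrite -lee_fin EFin_Rintegral// fineK ?cnorm_fin_num//.
exact: cnorm_ge.
Qed.

(* A measure S nearly optimal for Y - l E lies in calQ, so that c controls both
   E_S(-Y) and E_S(E). *)
Lemma phi_le_cnorm Y E (l : R) : D T Y -> D T E -> (forall x, 0 <= E x) -> 0 <= l ->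
  phi (fun x => Y x - l * E x) <= phi (cst 0) + fine (cnorm QQ Y) + l * fine (cnorm QQ E).
Proof.
move=> DY DE E0 l0; apply/ler_addgt0Pr => del del0.
have DlE := Lp_spaceZ hp TF Tm l DE.
have DX : D T (fun x => Y x - l * E x) by exact: (Lp_spaceB hp TF Tm DY DlE).
have Dc : D T (cst 0) by exact: (Lp_space_cst P p TF Tm).
have [Q QQ_Q] := hsens.
have [S [U [PS SP mU UP XP]]] := near_optimal_measure hT hF hF0 hp hrho htc
  (lexx 0) T0 TT QQ_Q DX del0.
set X := (fun x : Omega => _) in DX XP *.
have QQ_S : QQ S.
  split => //.
  have := min_penalty_le hF hrho (lexx 0) T0 TT (erv_measurable_EFin mU) UP.
  by move=> h; apply: (aeS h) => x; move=> /le_lt_trans; apply; rewrite /= ltry.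
have irho Z : D T Z -> P.-integrable setT (EFin \o rho 0 T Z).
  by move=> DZ; apply: (Lp_space_integrable hp F0s F0m); exact: (crm_maps hrho).
have mrho Z : D T Z -> rv_measurable (F 0) (rho 0 T Z).
  by move=> DZ; have [] := crm_maps hrho (lexx 0) T0 TT DZ.
(* Testing the penalty bound at the zero position; this is the source of the term [phi (cst 0)]. *)
have U0 : \forall x \ae P, - rho 0 T (cst 0) x <= U x.
  have e0 : (\- cst 0)%R = cst 0%R :> (Omega -> R) by apply/funext => x; rewrite /= oppr0.
  have := UP _ Dc; rewrite e0 => h.
  have h1 := ae_equiv_from hF T0 TT PS (cond_exp_ge0E TF F0s F0T S (X := cst 0) (fun x => lexx 0)).
  have h2 := ae_equiv_from hF T0 TT PS (cond_exp_nneg_cst TF F0s F0T S (lexx 0)).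
  by apply: (aeS3 h h1 h2) => x a b c; move: a; rewrite b c sub0e -EFinN lee_fin.
have [iNX XE] : S.-integrable setT (EFin \o (\- X)%R) /\
    \int[S]_x (- X x) <= fine (cnorm QQ Y) + l * fine (cnorm QQ E).
  have [iY Yc] := Rintegral_le_cnorm QQ_S DY; have [iE Ec] := Rintegral_le_cnorm QQ_S DE.
  have [iNX _] := Rintegral_le_cnorm QQ_S (Lp_spaceN hp TF Tm DX).
  split => //; have [iNY _] := Rintegral_le_cnorm QQ_S (Lp_space_norm hp TF Tm DY).
  apply: (@le_trans _ _ (\int[S]_x (`|Y x| + l * E x))).
    apply: ae_le_Rintegral => //.
      have DS := Lp_spaceD hp TF Tm (Lp_space_norm hp TF Tm DY) DlE.
      by have [i _] := Rintegral_le_cnorm QQ_S DS; exact: i.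
    apply: aeW => x; rewrite /X opprB addrC lerD2r.
    by rewrite -normrN; exact: ler_norm.
  rewrite RintegralD//; last by have [] := Rintegral_le_cnorm QQ_S DlE.
  rewrite lerD//= RintegralZl// ler_wpM2l//.
  apply: le_trans Ec; apply: ae_le_Rintegral => //.
    by have [] := Rintegral_le_cnorm QQ_S (Lp_space_norm hp TF Tm DE).
  by apply: aeW => x; exact: ler_norm.
pose V x := rho 0 T X x - rho 0 T (cst 0) x - del.
have mV : rv_measurable (F 0) V.
  by apply: measurable_funB; [apply: measurable_funB; exact: mrho|exact: measurable_cst].
have icst : P.-integrable setT (EFin \o (cst del : Omega -> R)).
  exact: finite_measure_integrable_cst.
have iB : P.-integrable setT (EFin \o (rho 0 T X \- rho 0 T (cst 0))).
  exact: (integrableB measurableT (irho _ DX) (irho _ Dc)).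
have iV : P.-integrable setT (EFin \o V).
  exact: (integrableB measurableT iB icst).
have [iSV VE] := integral_agree F0s TF F0T Tm SP mV iV.
have [mc ic cE] := integral_fine_cond_exp TF F0s F0T (proj1 (Lp_spaceN hp TF Tm DX)) iNX.
have fin := ae_equiv_from hF T0 TT PS (cond_exp_fin TF F0s F0T (proj1 (Lp_spaceN hp TF Tm DX))
  (cond_integrable_integrable TF F0s F0T (proj1 (Lp_spaceN hp TF Tm DX)) iNX)).
have Vc : \forall x \ae S, V x <= fine (cond_exp S (F 0) (\- X)%R x).
  apply: (ae_equiv_to hF T0 TT PS); apply: (aeS3 XP U0 fin) => x a b /fineK c.
  by move: a; rewrite -c lee_fin /V; lra.
have := ae_le_Rintegral iSV ic Vc.
have -> : \int[S]_x fine (cond_exp S (F 0) (\- X)%R x) = \int[S]_x (- X x).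
  by congr fine; apply: cE; exact: (g_measurableP F0s measurableT).
rewrite VE RintegralB// RintegralB//; [|exact: irho..].
by rewrite Rintegral_probability_cst => h; lra.
Qed.

(** Only l >= 1 is asked for, because the convexity argument uses the weight 1/l. *)
Lemma le_of_scaled (a b C : R) : (forall l, 1 <= l -> l * a <= C + l * b) -> a <= b.
Proof.
move=> h; rewrite leNgt; apply/negP => ba.
have ab0 : 0 < a - b by rewrite subr_gt0.
have := h (1 + `|C| / (a - b)); rewrite lerDl divr_ge0 ?(ltW ab0)// => /(_ isT).
have := ler_norm C => h1; rewrite -lerBlDr -mulrBr mulrDl mul1r divfK ?gt_eqF//.
lra.
Qed.

Variables (s t : R).
Hypotheses (s0 : 0 <= s) (st : s <= t) (tT : t <= T).
Let t0 : 0 <= t. Proof. exact: le_trans st. Qed.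
Let sT : s <= T. Proof. exact: le_trans tT. Qed.
Let sF := filtration_sigmaW hF s0 sT.
Let tF := filtration_sigmaW hF t0 tT.
Let sm := filtration_subW hF s0 sT.
Let tm := filtration_subW hF t0 tT.
Let DtT X : D t X -> D T X. Proof. exact: (Lp_space_mono hF). Qed.
Let DsT X : D s X -> D T X. Proof. exact: (Lp_space_mono hF). Qed.
Let rho_maps X : D t X -> D s (rho s t X). Proof. exact: (crm_maps hrho). Qed.

(* Time consistency moves rho_sT 0 - rho_st(Y - l E) to Y + rho_tT 0 - l E
   without changing E_P rho_0T, and phi_le_cnorm applies to the latter. *)
Lemma integral_rho_le Q Y : QQ Q -> D t Y -> exists C : R, forall E l,
  D t E -> (forall x, 0 <= E x) -> 0 <= l ->
  \int[Q]_x rho s t (fun x => Y x - l * E x) x <= C + l * fine (cnorm QQ E).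
Proof.
move=> QQ_Q DY; have [C CP] := calQ_bound hT hF hF0 hp hrho QQ_Q.
have Dc : D T (cst 0) by exact: (Lp_space_cst P p TF Tm).
pose rs := rho s T (cst 0); pose rt := rho t T (cst 0).
have Drs : D s rs by exact: (crm_maps hrho).
have Drt : D t rt by exact: (crm_maps hrho).
exists (C + (phi (cst 0) + fine (cnorm QQ (Y \+ rt))) + \int[Q]_x rs x) => E l DE E0 l0.
pose X x := Y x - l * E x.
have DX : D t X by exact: (Lp_spaceB hp tF tm DY (Lp_spaceZ hp tF tm l DE)).
pose Z := (rs \- rho s t X)%R.
have DZ : D s Z by apply: (Lp_spaceB hp sF sm) => //; exact: rho_maps.
pose X' := (fun x => (Y \+ rt)%R x - l * E x).
have DYr : D t (Y \+ rt)%R by exact: (Lp_spaceD hp tF tm).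
have DX' : D t X'.
  exact: (Lp_spaceB hp tF tm DYr (Lp_spaceZ hp tF tm l DE)).
have ZX' : phi Z = phi X'.
  have e1 : (Z \- rs)%R = (\- rho s t X)%R by apply/funext => x; rewrite /Z/= addrAC subrr sub0r.
  have e2 : (X' \- rt)%R = X by apply/funext => x; rewrite /X' /X /=; ring.
  have h1 := crm_horizon hF hp hrho htc (lexx 0) s0 sT DZ.
  have h2 := crm_horizon hF hp hrho htc (lexx 0) t0 tT DX'.
  have h3 := htc (lexx 0) s0 st tT DX.
  rewrite -/rs e1 in h1; rewrite -/rt e2 in h2.
  have irho W : D T W -> P.-integrable setT (EFin \o rho 0 T W).
    by move=> DW; apply: (Lp_space_integrable hp F0s F0m); exact: (crm_maps hrho).
  apply/eqP; rewrite eq_le; apply/andP; split; apply: ae_le_Rintegral.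
  - exact/irho/DsT. - exact/irho/DtT.
  - by apply: (aeS3 h1 h2 h3) => x -> -> ->.
  - exact/irho/DtT. - exact/irho/DsT.
  - by apply: (aeS3 h1 h2 h3) => x -> -> ->.
have := phi_le_cnorm (DtT DYr) (DtT DE) E0 l0; rewrite -/X' -ZX'.
have [_ +] := CP _ (DsT DZ).
have -> : \int[Q]_x (- Z x) = \int[Q]_x rho s t X x - \int[Q]_x rs x.
  have [i1 _] := CP _ (DsT (rho_maps DX)); have [i2 _] := CP _ (DsT Drs).
  rewrite -RintegralB//; congr fine; apply: eq_integral => x _.
  by rewrite /Z /= opprB.
lra.
Qed.

(* With M = max(X, Y) and E = |X - Y|, convexity gives
   l (rho_st(M - E) - rho_st M) <= rho_st(M - l E) - rho_st M; let l -> oo. *)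
Lemma cnorm_rho_le X Y : D t X -> D t Y ->
  (cnorm QQ (rho s t X \- rho s t Y)%R <= cnorm QQ (X \- Y)%R)%E.
Proof.
move=> DX DY; apply: ge_ereal_sup => _ [Q QQ_Q <-].
pose M x := Num.max (X x) (Y x); pose E := Num.norm \o (X \- Y)%R.
have DM : D t M by exact: (Lp_space_max hp tF tm).
have DXY : D t (X \- Y)%R by exact: (Lp_spaceB hp tF tm).
have DE : D t E by exact: (Lp_space_norm hp tF tm).
have DME l : D t (fun x => M x - l * E x).
  exact: (Lp_spaceB hp tF tm DM (Lp_spaceZ hp tF tm l DE)).
have D1 : D t (M \- E)%R by exact: (Lp_spaceB hp tF tm).
(* M - E is the minimum of X and Y, so rho_st X and rho_st Y both lie between rho_st M and rho_st(M
   - E), and W bounds the distance between them. *)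
pose W := (rho s t (M \- E)%R \- rho s t M)%R.
have DW : D s W by apply: (Lp_spaceB hp sF sm); exact: rho_maps.
have DrXY : D s (rho s t X \- rho s t Y)%R by apply: (Lp_spaceB hp sF sm); exact: rho_maps.
have bd Z : D t Z -> (forall x, M x - E x <= Z x <= M x) ->
    \forall x \ae P, rho s t M x <= rho s t Z x <= rho s t (M \- E)%R x.
  move=> DZ b.
  have h1 := crm_monotone hrho s0 st tT DM DZ (aeW P (fun x => (andP (b x)).2)).
  have h2 := crm_monotone hrho s0 st tT DZ D1 (aeW P (fun x => (andP (b x)).1)).
  by apply: (aeS2 h1 h2) => x -> ->.
have bX := bd _ DX; have bY := bd _ DY.
have {}bX : \forall x \ae P, rho s t M x <= rho s t X x <= rho s t (M \- E)%R x.
  apply: bX => x; rewrite /M /E /= le_max lexx andbT.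
  have := ler_norm (X x - Y x); have := ler_norm (Y x - X x); rewrite distrC.
  by have := normr_ge0 (X x - Y x); case: (leP (X x) (Y x)); lra.
have {}bY : \forall x \ae P, rho s t M x <= rho s t Y x <= rho s t (M \- E)%R x.
  apply: bY => x; rewrite /M /E /= le_max lexx orbT andbT.
  have := ler_norm (X x - Y x); have := ler_norm (Y x - X x); rewrite distrC.
  by have := normr_ge0 (X x - Y x); case: (leP (X x) (Y x)); lra.
have toQ (B : Omega -> Prop) : (\forall x \ae P, B x) -> \forall x \ae Q, B x.
  by apply: (ae_equiv_to hF T0 TT); case: QQ_Q.
have [iW _] := Rintegral_le_cnorm QQ_Q (DsT DW).
have [iN _] := Rintegral_le_cnorm QQ_Q (Lp_space_norm hp TF Tm (DsT DrXY)).
apply: (@le_trans _ _ (\int[Q]_x W x)%:E).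
  rewrite -EFin_Rintegral// lee_fin; apply: ae_le_Rintegral => //; apply: toQ.
  apply: (aeS2 bX bY) => x /andP[a b] /andP[a' b'] /=.
  by rewrite ler_norml /W/=; apply/andP; split; lra.
rewrite -(fineK (cnorm_fin_num (DtT DXY))) lee_fin.
have -> : cnorm QQ (X \- Y)%R = cnorm QQ E.
  congr ereal_sup; apply: eq_imagel => Q' _.
  by apply: eq_integral => x _; rewrite /E /= normr_id.
have [C CP] := integral_rho_le QQ_Q DM.
apply: (@le_of_scaled _ _ (C - \int[Q]_x rho s t M x)) => l l1.
have l0 : 0 < l by lra.
have := CP E l DE (fun x => normr_ge0 _) (ltW l0).
set Yl := (fun x : Omega => _) => h.
have [iM _] := Rintegral_le_cnorm QQ_Q (DsT (rho_maps DM)).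
have [iY _] := Rintegral_le_cnorm QQ_Q (DsT (rho_maps (DME l))).
have : l * \int[Q]_x W x <= \int[Q]_x rho s t Yl x - \int[Q]_x rho s t M x.
  rewrite -RintegralZl// -RintegralB//; apply: ae_le_Rintegral.
  - have [i _] := Rintegral_le_cnorm QQ_Q (DsT (Lp_spaceZ hp sF sm l DW)).
    exact: i.
  - have [i _] := Rintegral_le_cnorm QQ_Q
      (DsT (Lp_spaceB hp sF sm (rho_maps (DME l)) (rho_maps DM))).
    exact: i.
  - have l01 : 0 <= l^-1 <= 1 by rewrite invr_ge0 (ltW l0) invf_le1.
    have := crm_convex hrho s0 st tT (DME l) DM l01.
    have -> : (fun y => l^-1 * (M y - l * E y) + (1 - l^-1) * M y) = (M \- E)%R.
      by apply/funext => y /=; field; rewrite gt_eqF.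
    move=> hc; apply: toQ; apply: (aeS hc) => x; rewrite -/Yl /W /= => /(ler_wpM2l (ltW l0)).
    rewrite mulrDr mulrA divff ?gt_eqF// mul1r mulrA mulrBr mulr1 divff ?gt_eqF//.
    by rewrite mulrBr; lra.
lra.
Qed.

End contraction.

(** * Extension *)

Section extension.
Context {d} {Omega : measurableType d} {R : realType}.
Variables (P : probability Omega R) (T : R) (F : R -> set_system Omega) (p : R).
Variable rho : R -> R -> (Omega -> R) -> Omega -> R.
Hypotheses (hT : 0 < T) (hF : complete_filtration P T F)
  (hF0 : trivial_sigma_algebra P (F 0)) (hp : 1 <= p)
  (hrho : fully_dynamic_crm P T F p rho)
  (htc : strong_time_consistent P T F p rho).
Implicit Types X Y Z : Omega -> R.
Local Notation D t := (Lp_space P p (F t)).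
Local Notation QQ := (calQ P T F p rho).
Local Notation c := (cnorm QQ).
Variable rhobar : (Omega -> R) -> R.
Hypotheses (hbar : coherent_risk_measure P p (F T) rhobar)
  (hdom : forall X, D T X ->
     \forall x \ae P, rho 0 T X x - rho 0 T (cst 0) x <= rhobar X).
Hypothesis hsens : QQ !=set0.
Let T0 : 0 <= T. Proof. exact: ltW. Qed.
Let TT := lexx T.
Local Open Scope ereal_scope.

Lemma cvge0_small (u : nat -> \bar R) : u n @[n --> \oo] --> 0 ->
  forall e : R, (0 < e)%R -> \forall n \near \oo, u n <= e%:E.
Proof.
move=> /fine_cvgP[ufin /cvgrPdist_le uc] e e0.
apply: filterS2 ufin (uc e e0) => n un; rewrite sub0r normrN => h.
by rewrite -(fineK un) lee_fin; apply: le_trans h; exact: ler_norm.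
Qed.

Lemma cnorm_ge0 X : 0 <= c X.
Proof.
have [Q QQ_Q] := hsens; apply: le_trans (cnorm_ge X QQ_Q).
by apply: integral_ge0 => x _; rewrite lee_fin.
Qed.

Lemma cnorm_eq0P Z : rv_measurable (F T) Z ->
  c Z = 0 <-> \forall x \ae P, Z x = 0%R.
Proof.
move=> mZ; have mE := erv_measurable_EFin mZ.
split => [cZ|Z0].
- have [Q QQ_Q] := hsens; have QP : equivalent_on P Q by case: QQ_Q.
  have : \int[Q]_x `|(Z x)%:E| = 0.
    apply/eqP; rewrite eq_le integral_ge0// andbT -cZ; exact: cnorm_ge.
  move=> /(ae_eq_integral_abs Q measurableT mE) h.
  apply: (ae_equiv_from hF T0 TT QP); apply: (aeS h) => x /(_ I) [].
  exact.
- apply/eqP; rewrite eq_le cnorm_ge0 andbT; apply: ge_ereal_sup => _ [Q QQ_Q <-].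
  have QP : equivalent_on P Q by case: QQ_Q.
  suff : \int[Q]_x `|(Z x)%:E| = 0 by move=> <-.
  apply/(ae_eq_integral_abs Q measurableT mE).
  by apply: (aeS (ae_equiv_to hF T0 TT QP Z0)) => x /= ->.
Qed.

Lemma cnorm_le X Y : rv_measurable (F T) X -> rv_measurable (F T) Y ->
  (\forall x \ae P, (`|X x| <= `|Y x|)%R) -> c X <= c Y.
Proof.
move=> mX mY XY; apply: ge_ereal_sup => _ [Q QQ_Q <-].
have QP : equivalent_on P Q by case: QQ_Q.
apply: (@le_trans _ _ (\int[Q]_x (`|Y x|)%:E)); last exact: cnorm_ge.
apply: ae_ge0_le_integral => //.
- by apply: erv_measurable_EFin; exact: rv_measurable_norm.
- by apply: erv_measurable_EFin; exact: rv_measurable_norm.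
- by apply: (aeS (ae_equiv_to hF T0 TT QP XY)) => x h _; rewrite lee_fin.
Qed.

Section fixed_time.
Variables (t : R).
Hypotheses (t0 : (0 <= t)%R) (tT : (t <= T)%R).
Let tF := filtration_sigmaW hF t0 tT.
Let tm := filtration_subW hF t0 tT.
Let tTF : F t `<=` F T. Proof. exact: (filtration_mono hF). Qed.

Lemma Lc_measurable X : Lc P QQ (F t) X -> rv_measurable (F T) X.
Proof. by move=> [mX _]; exact: rv_measurableS mX. Qed.

(** The truncation errors are [excess X n]. They decrease in n, so the smallness that [cnorm_small]
    gives at one level persists at all later ones. *)
Lemma Lp_space_Lc X : D t X -> Lc P QQ (F t) X.
Proof.
move=> DX; have [mX _] := DX; split => //.
pose B n x : R := (Num.max (- n%:R) (Num.min (X x) n%:R))%R.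
have mB n : rv_measurable (F t) (B n).
  apply: measurable_maxr; first exact: measurable_cst.
  exact: rv_measurable_min.
exists B; split.
  move=> n; split => //; exists (n%:R)%R; apply: aeW => x.
  have n0 : (0 <= n%:R :> R)%R by exact: ler0n.
  by rewrite ler_norml /B le_max lexx/= ge_max ge_min lexx orbT andbT; lra.
have XB n x : (`|X x - B n x| = excess X n x)%R.
  have n0 : (0 <= n%:R :> R)%R by exact: ler0n.
  rewrite /excess /B; have [X0|X0] := leP 0%R (X x).
  - rewrite (ger0_norm X0); case: (leP (X x) (n%:R)%R) => h1.
      have -> : Num.max (- n%:R)%R (X x) = X x by apply: max_r; lra.
      by rewrite subrr normr0 max_r; lra.
    have -> : Num.max (- n%:R)%R (n%:R)%R = (n%:R)%R :> R by apply: max_r; lra.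
    by rewrite max_l ?ger0_norm//; lra.
  - rewrite (ltr0_norm X0).
    have -> : Num.min (X x) (n%:R)%R = X x by apply: min_l; lra.
    case: (leP (- n%:R)%R (X x)) => h1; first by rewrite subrr normr0 max_r//; lra.
    by rewrite max_l ?ltr0_norm; lra.
have DtT Y : D t Y -> D T Y by exact: (Lp_space_mono hF).
apply: cvge0_le => e e0.
have [N NP] := cnorm_small hT hF hF0 hp hrho hbar hdom
  (fun n => DtT _ (Lp_space_excess hp tF tm n DX)) (fun n x => excess_ge0 X n x)
  (excess_small hp tF tm DX) e0.
exists N => // n /= Nn; rewrite cnorm_ge0/=.
apply: le_trans NP; apply: cnorm_le.
- by apply: rv_measurableB; exact: rv_measurableS tTF _.
- by have [] := DtT _ (Lp_space_excess hp tF tm N DX).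
- apply: aeW => x; rewrite XB (ger0_norm (excess_ge0 _ _ _)) /excess.
  by rewrite ge_max !le_max lexx orbT andbT lerB// ler_nat Nn.
Qed.

Lemma Lc_approx X (e : R) : Lc P QQ (F t) X -> (0 < e)%R ->
  exists B, [/\ D t B, exists K : R, \forall x \ae P, (`|B x| <= K)%R &
    c (X \- B)%R <= e%:E].
Proof.
move=> [mX [B [BP Blim]]] e0.
have [n _ nP] := cvge0_small Blim e0; exists (B n).
have [mB [K BK]] := BP n; split.
- exact: (Lp_space_bounded hp tF tm mB BK).
- by exists K.
- exact: (nP n (leqnn n)).
Qed.
End fixed_time.

Lemma cnorm_triangle3 X Y Z (a b : R) :
  rv_measurable (F T) X -> rv_measurable (F T) Y -> rv_measurable (F T) Z ->
  c (X \- Y)%R <= a%:E -> c (Y \- Z)%R <= b%:E -> c (X \- Z)%R <= (a + b)%:E.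
Proof.
move=> mX mY mZ ha hb; apply: le_trans (cnorm_triangle QQ mX mY mZ) _.
by rewrite EFinD leeD.
Qed.

Variables (s t : R).
Hypotheses (s0 : (0 <= s)%R) (st : (s <= t)%R) (tT : (t <= T)%R).
Let t0 : (0 <= t)%R. Proof. exact: le_trans st. Qed.
Let sT : (s <= T)%R. Proof. exact: le_trans tT. Qed.
Let sTF : F s `<=` F T. Proof. exact: (filtration_mono hF). Qed.
Let tTF : F t `<=` F T. Proof. exact: (filtration_mono hF). Qed.
Let tF := filtration_sigmaW hF t0 tT.
Let tm := filtration_subW hF t0 tT.
Let rho_maps X : D t X -> D s (rho s t X). Proof. exact: (crm_maps hrho). Qed.
Let mD X : D t X -> rv_measurable (F T) X.
Proof. by move=> [mX _]; exact: rv_measurableS mX. Qed.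
Let mrho X : D t X -> rv_measurable (F T) (rho s t X).
Proof. by move=> /rho_maps[mX _]; exact: rv_measurableS mX. Qed.
Let contr X Y : D t X -> D t Y -> c (rho s t X \- rho s t Y)%R <= c (X \- Y)%R.
Proof. exact: (cnorm_rho_le hT hF hF0 hp hrho htc hbar hdom hsens s0 st tT). Qed.

(** By contraction, rho_st of bounded approximations of X is Cauchy for c, and L^c_s is complete.
    The epsilon form makes limits along unrelated sequences comparable. *)
Lemma Lc_limit X : Lc P QQ (F t) X -> exists Y, Lc P QQ (F s) Y /\
  forall e : R, (0 < e)%R -> exists B, [/\ D t B, c (X \- B)%R <= e%:E &
    c (rho s t B \- Y)%R <= e%:E].
Proof.
move=> LX; have mX := Lc_measurable t0 tT LX.
have [_ [B [BP Blim]]] := LX.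
have DB n : D t (B n).
  by have [mB [K BK]] := BP n; exact: (Lp_space_bounded hp tF tm mB BK).
have [Y LY Ylim] : exists2 Y, Lc P QQ (F s) Y & c (rho s t (B n) \- Y)%R @[n --> \oo] --> 0.
  apply: Lc_complete hsens sTF _ _ => [n|e e0].
    exact/(Lp_space_Lc s0 sT)/rho_maps.
  have [N _ NP] := cvge0_small Blim (divr_gt0 e0 (ltr0n R 2)).
  exists N => m n Nm Nn; apply: le_trans (contr (DB m) (DB n)) _.
  rewrite (splitr e); apply: (@cnorm_triangle3 _ X); [exact: mD|exact: mX|exact: mD|..].
    by rewrite cnorm_sym; exact: NP.
  exact: NP.
exists Y; split => // e e0.
have h1 := cvge0_small Blim e0; have h2 := cvge0_small Ylim e0.
have [n _ nP] : \forall n \near \oo, c (X \- B n)%R <= e%:E /\ c (rho s t (B n) \- Y)%R <= e%:E.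
  by apply: filterS2 h1 h2 => n.
by have [a b] := nP n (leqnn n); exists (B n).
Qed.

Lemma Lc_extension_exists : exists rt, Lc_extension P T F p rho s t rt.
Proof.
have /choice[rt rtP] : forall X, exists Y, Lc P QQ (F t) X -> Lc P QQ (F s) Y /\
    forall e : R, (0 < e)%R -> exists B, [/\ D t B, c (X \- B)%R <= e%:E &
      c (rho s t B \- Y)%R <= e%:E].
  (* Outside L^c_t the value is arbitrary, and X serves. *)
  move=> X; have [LX|nLX] := pselect (Lc P QQ (F t) X); last by exists X.
  by have [Y YP] := Lc_limit LX; exists Y.
have mrt X : Lc P QQ (F t) X -> rv_measurable (F T) (rt X).
  by move=> LX; have [L _] := rtP X LX; exact: (Lc_measurable s0 sT L).
exists rt; split.
- by move=> X LX; have [] := rtP X LX.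
- move=> X DX; have LX := Lp_space_Lc t0 tT DX; have [_ ap] := rtP X LX.
  suff : c (rt X \- rho s t X)%R = 0.
    move=> /(cnorm_eq0P (rv_measurableB (mrt _ LX) (mrho DX))) h.
    by apply: (aeS h) => x /= /eqP; rewrite subr_eq0 => /eqP.
  apply/eqP; rewrite eq_le cnorm_ge0 andbT; apply/lee_addgt0Pr => e e0; rewrite add0e.
  have [B [DB XB rB]] := ap _ (divr_gt0 e0 (ltr0n R 2)).
  rewrite (splitr e); apply: (@cnorm_triangle3 _ (rho s t B)).
  + exact: mrt. + exact: mrho. + exact: mrho.
  + by rewrite cnorm_sym.
  + by apply: le_trans (contr DB DX) _; rewrite cnorm_sym.
- move=> X Y LX LY; apply/lee_addgt0Pr => e e0.
  have mX := Lc_measurable t0 tT LX; have mY := Lc_measurable t0 tT LY.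
  have [_ apX] := rtP X LX; have [_ apY] := rtP Y LY.
  (* Each of the two approximants costs e/4 in its argument and e/4 in its value. *)
  have e4 : (0 < e / 4)%R by rewrite divr_gt0.
  have [B [DB XB rB]] := apX _ e4; have [B' [DB' YB rB']] := apY _ e4.
  case cXY : (c (X \- Y)%R) => [r| |]; last 2 first.
  + by rewrite addye// leey.
  + by have := cnorm_ge0 (X \- Y)%R; rewrite cXY.
  rewrite -EFinD (_ : (r + e = e / 4 + (e / 4 + r + e / 4) + e / 4)%R); last by field.
  apply: (@cnorm_triangle3 _ (rho s t B')); [exact: mrt|exact: mrho|exact: mrt| |exact: rB'].
  apply: (@cnorm_triangle3 _ (rho s t B)); [exact: mrt|exact: mrho|exact: mrho| |].
    by rewrite cnorm_sym.
  apply: le_trans (contr DB DB') _.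
  apply: (@cnorm_triangle3 _ Y); [exact: mD|exact: mY|exact: mD| |exact: YB].
  apply: (@cnorm_triangle3 _ X); [exact: mD|exact: mX|exact: mY| |by rewrite cXY].
  by rewrite cnorm_sym.
Qed.

(** This holds for every extension, not just the constructed one, as uniqueness requires.
    Boundedness of B is what later puts nearly optimal measures into [calPtilde]. *)
Lemma Lc_extension_approx rt X (e : R) : Lc_extension P T F p rho s t rt ->
  Lc P QQ (F t) X -> (0 < e)%R ->
  exists B, [/\ D t B, exists K : R, \forall x \ae P, (`|B x| <= K)%R,
    c (X \- B)%R <= e%:E & c (rt X \- rho s t B)%R <= e%:E].
Proof.
move=> [rtL rtD rtc] LX e0; have [B [DB BK XB]] := Lc_approx t0 tT LX e0.
exists B; split => //; have LB := Lp_space_Lc t0 tT DB.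
have mrt Y : Lc P QQ (F t) Y -> rv_measurable (F T) (rt Y).
  by move=> LY; exact: (Lc_measurable s0 sT (rtL _ LY)).
rewrite -[e]addr0; apply: (@cnorm_triangle3 _ (rt B)); [exact: mrt|exact: mrt|exact: mrho| |].
  exact: le_trans (rtc _ _ LX LB) XB.
suff -> : c (rt B \- rho s t B)%R = 0 by [].
apply/(cnorm_eq0P (rv_measurableB (mrt _ LB) (mrho DB))).
by apply: (aeS (rtD _ DB)) => x /= ->; rewrite subrr.
Qed.

Lemma Lc_extension_unique rt rt' X : Lc_extension P T F p rho s t rt ->
  Lc_extension P T F p rho s t rt' -> Lc P QQ (F t) X ->
  \forall x \ae P, rt X x = rt' X x.
Proof.
move=> hrt hrt' LX; have [rtL rtD rtc] := hrt; have [rtL' rtD' rtc'] := hrt'.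
have m1 := Lc_measurable s0 sT (rtL _ LX); have m2 := Lc_measurable s0 sT (rtL' _ LX).
suff : c (rt X \- rt' X)%R = 0.
  move=> /(cnorm_eq0P (rv_measurableB m1 m2)) h.
  by apply: (aeS h) => x /= /eqP; rewrite subr_eq0 => /eqP.
apply/eqP; rewrite eq_le cnorm_ge0 andbT; apply/lee_addgt0Pr => e e0; rewrite add0e.
have e4 : (0 < e / 4)%R by rewrite divr_gt0.
have [B [DB _ XB rB]] := Lc_extension_approx hrt LX e4.
have [B' [DB' _ XB' rB']] := Lc_extension_approx hrt' LX e4.
have mX := Lc_measurable t0 tT LX.
rewrite (_ : (e = e / 4 + (e / 4 + e / 4) + e / 4)%R); last by field.
apply: (@cnorm_triangle3 _ (rho s t B')); [exact: m1|exact: mrho|exact: m2| |].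
  apply: (@cnorm_triangle3 _ (rho s t B)); [exact: m1|exact: mrho|exact: mrho|exact: rB|].
  apply: le_trans (contr DB DB') _.
  apply: (@cnorm_triangle3 _ X); [exact: mD|exact: mX|exact: mD| |exact: XB'].
  by rewrite cnorm_sym.
by rewrite cnorm_sym.
Qed.

End extension.

(** * Representation *)

Section representation.
Context {d} {Omega : measurableType d} {R : realType}.
Variables (P : probability Omega R) (T : R) (F : R -> set_system Omega) (p : R).
Variable rho : R -> R -> (Omega -> R) -> Omega -> R.
Hypotheses (hT : 0 < T) (hF : complete_filtration P T F)
  (hF0 : trivial_sigma_algebra P (F 0)) (hp : 1 <= p)
  (hrho : fully_dynamic_crm P T F p rho)
  (htc : strong_time_consistent P T F p rho).
Implicit Types X Y Z : Omega -> R.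
Local Notation D t := (Lp_space P p (F t)).
Local Notation QQ := (calQ P T F p rho).
Local Notation c := (cnorm QQ).
Variable rhobar : (Omega -> R) -> R.
Hypotheses (hbar : coherent_risk_measure P p (F T) rhobar)
  (hdom : forall X, D T X ->
     \forall x \ae P, rho 0 T X x - rho 0 T (cst 0) x <= rhobar X).
Hypothesis hsens : QQ !=set0.
Let T0 : 0 <= T. Proof. exact: ltW. Qed.
Let TT := lexx T.
Let TF := filtration_sigmaW hF T0 TT.
Let Tm := filtration_subW hF T0 TT.
Variables (s t : R).
Hypotheses (s0 : 0 <= s) (st : s <= t) (tT : t <= T).
Let t0 : 0 <= t. Proof. exact: le_trans st. Qed.
Let sT : s <= T. Proof. exact: le_trans tT. Qed.
Let stF : F s `<=` F t. Proof. exact: (filtration_mono hF). Qed.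
Let sTF : F s `<=` F T. Proof. exact: (filtration_mono hF). Qed.
Let tTF : F t `<=` F T. Proof. exact: (filtration_mono hF). Qed.
Let sF := filtration_sigmaW hF s0 sT.
Let tF := filtration_sigmaW hF t0 tT.
Let tm := filtration_subW hF t0 tT.
Let rho_maps X : D t X -> D s (rho s t X). Proof. exact: (crm_maps hrho). Qed.
Let mrho X : D t X -> rv_measurable (F s) (rho s t X).
Proof. by move=> /rho_maps[]. Qed.
Let DsT X : D s X -> D T X. Proof. exact: (Lp_space_mono hF). Qed.
Local Open Scope ereal_scope.

(** * Conditional expectations under measures of [calPtilde] *)

Section penalized_measure.
Variable S : probability (g_sigma_algebraType (F t)) R.
Hypothesis hS : calPtilde P T F p rho s t S.
Local Notation alpha := (min_penalty P F p rho s t S).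
Local Notation cen := (cond_exp_nneg S (F s)).

Let PS : equivalent_on P S. Proof. by case: hS. Qed.
Let ae_SP (B : Omega -> Prop) : (\forall x \ae S, B x) -> \forall x \ae P, B x.
Proof. exact: (ae_equiv_from hF t0 tT PS). Qed.

Variable Q : probability (g_sigma_algebraType (F T)) R.
Hypothesis QQ_Q : QQ Q.
Let ae_PQ (B : Omega -> Prop) : (\forall x \ae P, B x) -> \forall x \ae Q, B x.
Proof. by apply: (ae_equiv_to hF T0 TT); case: QQ_Q. Qed.

Let ma : erv_measurable (F T) alpha.
Proof.
by have [m _ _] := min_penaltyP hF hrho s0 st tT S; exact: erv_measurableS sTF m.
Qed.

(** Membership in [calPtilde] bounds the integral from above only; from below alpha >= - rho_st 0,
    by testing the zero position, and rho_st 0 is Q-integrable. *)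
Lemma penalty_integrable : Q.-integrable setT alpha.
Proof.
have D0 : D t (cst 0%R) by exact: (Lp_space_cst P p tF tm).
have ge : \forall x \ae P, (- rho s t (cst 0%R) x)%:E <= alpha x.
  have e0 : (\- cst 0)%R = cst 0%R :> (Omega -> R) by apply/funext => x; rewrite /= oppr0.
  have := min_penalty_ge hF hrho s0 st tT S D0; rewrite e0 => h.
  have h1 := ae_SP (cond_exp_ge0E tF sF stF S (X := cst 0%R) (fun x => lexx 0%R)).
  have h2 := ae_SP (cond_exp_nneg_cst tF sF stF S (lexx 0%R)).
  by apply: (aeS3 h h1 h2) => x a b c'; move: a; rewrite b c' sub0e EFinN.
have [ir _] := Rintegral_le_cnorm hT hF hF0 hp hrho hbar hdom hsens QQ_Q (DsT (rho_maps D0)).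
have mp : erv_measurable (F T) (alpha^\+) by exact: measurable_funepos.
have mn : erv_measurable (F T) (alpha^\-) by exact: measurable_funeneg.
have ineg : \int[Q]_x alpha^\- x < +oo.
  have /integrableP[_] := ir; apply: le_lt_trans; apply: ae_ge0_le_integral => //.
  - by apply: measurableT_comp => //; exact: (measurable_int _ ir).
  - apply: (aeS (ae_PQ ge)) => x; rewrite /= funenegE => h _.
    rewrite ge_max; apply/andP; split; last by rewrite lee_fin.
    apply: (@le_trans _ _ (rho s t (cst 0%R) x)%:E).
      by rewrite leeNl -EFinN.
    by rewrite lee_fin; exact: ler_norm.
have ipos : \int[Q]_x alpha^\+ x < +oo.
  have : \int[Q]_x alpha x < +oo.
    have [_ _] := hS; apply: le_lt_trans; apply: ereal_sup_ubound; by exists Q.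
  have nfin : \int[Q]_x alpha^\- x \is a fin_num.
    by rewrite ge0_fin_numE//; exact: integral_ge0.
  rewrite integralE -(fineK nfin) -EFinN !ltey => h.
  by apply/eqP => e; move: h; rewrite e.
apply/integrableP; split => //.
under eq_integral do rewrite -/((abse \o alpha) _) fune_abse.
rewrite ge0_integralD//.
exact: lte_add_pinfty.
Qed.

(* l E_S(Z | F_s) <= rho_st(- l Z) + alpha_st(S); let l -> oo. *)
Lemma integral_cond_exp_le_Lp Z : D t Z -> (forall x, 0 <= Z x)%R ->
  \int[Q]_x cen (EFin \o Z) x <= c Z.
Proof.
move=> DZ Z0; have [mZ _] := DZ.
have D0 : D t (cst 0%R) by exact: (Lp_space_cst P p tF tm).
have [mc c0 _] := cond_exp_nnegP tF sF stF S mZ Z0.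
(* The summand [cst 0] makes the position match [integral_rho_le] at Y = 0. *)
have DlZ l : D t (fun x => cst 0 x - l * Z x)%R.
  exact: (Lp_spaceB hp tF tm D0 (Lp_spaceZ hp tF tm l DZ)).
have key l : (0 <= l)%R -> \forall x \ae P,
    l%:E * cen (EFin \o Z) x <= (rho s t (fun x => cst 0 x - l * Z x)%R x)%:E + alpha x.
  move=> l0; pose W x := (cst 0 x - l * Z x)%R.
  have := min_penalty_ge hF hrho s0 st tT S (DlZ l : D t W).
  have -> : (\- W)%R = (fun x => l * Z x)%R.
    by apply/funext => x; rewrite /W /= sub0r opprK.
  have lZ0 x : (0 <= l * Z x)%R by rewrite mulr_ge0.
  have h1 := ae_SP (cond_exp_ge0E tF sF stF S lZ0).
  have h2 := ae_SP (cond_exp_nnegZ tF sF stF S l0 mZ Z0).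
  move=> h; apply: (aeS3 h h1 h2) => x a b c'; move: a; rewrite b c' -/W.
  by rewrite leeBlDr// addeC.
have ia := penalty_integrable.
have [C CP] := integral_rho_le hT hF hF0 hp hrho htc hbar hdom hsens s0 st tT QQ_Q D0.
have cfin : c Z \is a fin_num.
  apply: (cnorm_fin_num hT hF hF0 hp hrho hbar hdom hsens).
  exact: (Lp_space_mono hF t0 tT TT DZ).
have Afin : \int[Q]_x alpha x \is a fin_num by exact: integrable_fin_num.
have mcT : erv_measurable (F T) (cen (EFin \o Z)) by exact: erv_measurableS sTF mc.
have bd l : (0 <= l)%R -> l%:E * \int[Q]_x cen (EFin \o Z) x <=
    (C + fine (\int[Q]_x alpha x) + l * fine (c Z))%:E.
  move=> l0; rewrite -ge0_integralZl//.
  have [ir _] := Rintegral_le_cnorm hT hF hF0 hp hrho hbar hdom hsens QQ_Q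
    (DsT (rho_maps (DlZ l))).
  set W := rho s t (fun x => cst 0 x - l * Z x)%R in ir.
  have kl := ae_PQ (key l l0).
  have ig : Q.-integrable setT (fun x => (W x)%:E + alpha x) by exact: integrableD.
  apply: (@le_trans _ _ (\int[Q]_x `|(W x)%:E + alpha x|)).
    apply: ae_ge0_le_integral => //.
    - by move=> x _; rewrite mule_ge0.
    - exact: emeasurable_funM.
    - by apply: measurableT_comp => //; exact: (measurable_int _ ig).
    - by apply: (aeS kl) => x h _; apply: le_trans h _; exact: lee_abs.
  have -> : \int[Q]_x `|(W x)%:E + alpha x| = \int[Q]_x ((W x)%:E + alpha x).
    apply: ae_eq_integral => //.
    - by apply: measurableT_comp => //; exact: (measurable_int _ ig).
    - exact: (measurable_int _ ig).
    - apply: (aeS kl) => x h _; rewrite gee0_abs//; apply: le_trans h.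
      by rewrite mule_ge0.
  rewrite integralD// -EFin_Rintegral// -{1}(fineK Afin) -EFinD lee_fin.
  have := CP Z l DZ Z0 l0; rewrite -/W; lra.
have ifin : \int[Q]_x cen (EFin \o Z) x \is a fin_num.
  rewrite ge0_fin_numE; last by exact: integral_ge0.
  by rewrite -[ltLHS]mul1e; apply: le_lt_trans (bd 1%R ler01) _; rewrite ltry.
rewrite -(fineK ifin) -(fineK cfin) lee_fin.
apply: (@le_of_scaled _ _ _ (C + fine (\int[Q]_x alpha x))) => l l1.
by have := bd l (le_trans ler01 l1); rewrite -{1}(fineK ifin) -EFinM lee_fin.
Qed.

(** For X in L^c_t the error |X - B| need not be in L_p. Partial sums over the slices of Z are
    conditional expectations of the bounded truncations of Z, to which the L_p case applies. *)
Lemma integral_cond_exp_le Z : rv_measurable (F t) Z -> (forall x, 0 <= Z x)%R ->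
  \int[Q]_x cen (EFin \o Z) x <= c Z.
Proof.
move=> mZ Z0.
have sl := ae_PQ (ae_SP (cond_exp_nneg_slice tF sF stF S mZ Z0)).
have mcen f : rv_measurable (F t) f -> (forall x, 0 <= f x)%R ->
    erv_measurable (F T) (cen (EFin \o f)) /\ (forall x, 0 <= cen (EFin \o f) x).
  move=> mf f0; have [mc c0 _] := cond_exp_nnegP tF sF stF S mf f0.
  by split => //; exact: erv_measurableS sTF mc.
have ms n : rv_measurable (F t) (slice Z n) by exact: rv_measurable_slice.
have s0' n x : (0 <= slice Z n x)%R by exact: slice_ge0.
have -> : \int[Q]_x cen (EFin \o Z) x = \int[Q]_x \sum_(n <oo) cen (EFin \o slice Z n) x.
  apply: ae_eq_integral => //.
  - by have [] := mcen _ mZ Z0.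
  - apply: ge0_emeasurable_sum => [n x _ _|n _]; have [m0 c0] := mcen _ (ms n) (s0' n).
      exact: c0.
    exact: m0.
  - by apply: (aeS sl) => x h _.
rewrite integral_nneseries//; last 2 first.
- by move=> n; have [] := mcen _ (ms n) (s0' n).
- by move=> n x _; have [_ c0] := mcen _ (ms n) (s0' n); exact: c0.
apply: lime_le.
  apply: is_cvg_nneseries => n _ _; apply: integral_ge0 => x _.
  by have [_ c0] := mcen _ (ms n) (s0' n); exact: c0.
apply: nearW => n.
pose Zn x := Num.min (Z x) n%:R.
have mZn : rv_measurable (F t) Zn by exact: rv_measurable_min.
have Zn0 x : (0 <= Zn x)%R by rewrite /Zn le_min Z0/=.
have bZn : \forall x \ae P, (`|Zn x| <= n%:R)%R.
  by apply: aeW => x; rewrite ger0_norm// /Zn ge_min lexx orbT.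
have DZn := Lp_space_bounded hp tF tm mZn bZn.
apply: (@le_trans _ _ (c Zn)); last first.
  apply: (cnorm_le p rho hT hF); [exact: rv_measurableS tTF mZn|exact: rv_measurableS tTF mZ|].
  by apply: aeW => x; rewrite !ger0_norm// /Zn ge_min lexx.
apply: le_trans (integral_cond_exp_le_Lp DZn Zn0).
rewrite -ge0_integral_sum//; last 2 first.
- by move=> k; have [] := mcen _ (ms k) (s0' k).
- by move=> k x _; have [_ c0] := mcen _ (ms k) (s0' k); exact: c0.
apply: ae_ge0_le_integral => //.
- move=> x _; apply: sume_ge0 => k _.
  by have [_ c0] := mcen _ (ms k) (s0' k); exact: c0.
- apply: emeasurable_sum => k; by have [] := mcen _ (ms k) (s0' k).
- by move=> x _; have [_ c0] := mcen _ mZn Zn0; exact: c0.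
- by have [] := mcen _ mZn Zn0.
- have h := ae_PQ (ae_SP (cond_exp_nneg_sum_slice tF sF stF S n mZ Z0)).
  by apply: (aeS h) => x e _; rewrite e.
Qed.

End penalized_measure.
(** The positive part of g has zero expectation under one Q in [calQ], which is equivalent to P. *)
Lemma ae_le0_of_small (g : Omega -> \bar R) : erv_measurable (F T) g ->
  (forall e : R, (0 < e)%R -> exists h : Omega -> \bar R,
    [/\ erv_measurable (F T) h, forall x, 0 <= h x,
       \forall x \ae P, g x <= h x &
       forall Q, QQ Q -> \int[Q]_x h x <= e%:E]) ->
  \forall x \ae P, g x <= 0.
Proof.
move=> mg H; have [Q QQ_Q] := hsens; have PQ : equivalent_on P Q by case: QQ_Q.
pose f x := maxe (g x) 0.
have mf : erv_measurable (F T) f by exact: measurable_maxe.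
have f0 x : 0 <= f x by rewrite /f le_max lexx orbT.
have : \int[Q]_x `|f x| = 0.
  under eq_integral do rewrite gee0_abs//.
  apply/eqP; rewrite eq_le integral_ge0// andbT; apply/lee_addgt0Pr => e e0; rewrite add0e.
  have [h [mh h0 gh hQ]] := H e e0; apply: le_trans (hQ _ QQ_Q).
  apply: ae_ge0_le_integral => //.
  apply: (aeS (ae_equiv_to hF T0 TT PQ gh)) => x gx _.
  by rewrite /f ge_max gx h0.
move=> /(ae_eq_integral_abs Q measurableT mf) h.
apply: (ae_equiv_from hF T0 TT PQ); apply: (aeS h) => x /(_ I) e.
by have : g x <= f x; [rewrite /f le_max lexx|rewrite e].
Qed.

Let mQ (G : set_system Omega) X : G `<=` F T -> rv_measurable G X ->
  erv_measurable (F T) (EFin \o X).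
Proof. by move=> GT mX; apply: erv_measurable_EFin; exact: rv_measurableS mX. Qed.

(** h collects the errors of replacing X by B in the value and under E_S( . | F_s). Each has
    Q-expectation at most e, the second by [integral_cond_exp_le]; that bound also makes X and B
    conditionally integrable. *)
Lemma calPtilde_error S rt X B (e : R) : calPtilde P T F p rho s t S ->
  Lc_extension P T F p rho s t rt -> Lc P QQ (F t) X -> D t B ->
  c (X \- B)%R <= e%:E -> c (rt X \- rho s t B)%R <= e%:E ->
  let h := fun x => (`|rt X x - rho s t B x|)%:E +
    cond_exp_nneg S (F s) (EFin \o (Num.norm \o (X \- B)%R)) x in
  [/\ erv_measurable (F T) h, forall x, 0 <= h x,
      forall Q, QQ Q -> \int[Q]_x h x <= (e + e)%:E,
      (\forall x \ae P, cond_exp S (F s) (\- X)%R x <= cond_exp S (F s) (\- B)%R x +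
         cond_exp_nneg S (F s) (EFin \o (Num.norm \o (X \- B)%R)) x) &
      (\forall x \ae P, cond_exp S (F s) (\- B)%R x <= cond_exp S (F s) (\- X)%R x +
         cond_exp_nneg S (F s) (EFin \o (Num.norm \o (X \- B)%R)) x)].
Proof.
move=> hS [rtL _ _] LX DB XB rB h; have PS : equivalent_on P S by case: hS.
have mX : rv_measurable (F t) X by case: LX.
have mB : rv_measurable (F t) B by case: DB.
have mXB := rv_measurable_norm (rv_measurableB mX mB).
have nXB x : (0 <= (Num.norm \o (X \- B)%R) x)%R by exact: normr_ge0.
have [mc c0 _] := cond_exp_nnegP tF sF stF S mXB nXB.
have mcT := erv_measurableS sTF mc.
have [mrX _] := rtL _ LX.
have mN : erv_measurable (F T) (EFin \o (Num.norm \o (rt X \- rho s t B)%R)).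
  by apply: (mQ sTF); apply: rv_measurable_norm; apply: rv_measurableB => //; exact: mrho.
have [Q0 QQ_Q0] := hsens.
have cint Y : rv_measurable (F t) Y -> c Y < +oo -> cond_integrable (G:=F s) S Y.
  move=> mY cY; have mY' := rv_measurable_norm mY.
  have n0 x : (0 <= (Num.norm \o Y) x)%R by exact: normr_ge0.
  have [mY1 Y10 _] := cond_exp_nnegP tF sF stF S mY' n0.
  have iY : Q0.-integrable setT (cond_exp_nneg S (F s) (EFin \o (Num.norm \o Y))).
    apply/integrableP; split; first exact: erv_measurableS sTF mY1.
    under eq_integral do rewrite gee0_abs//.
    apply: le_lt_trans (integral_cond_exp_le hS QQ_Q0 mY' n0) _.
    rewrite (_ : c (Num.norm \o Y) = c Y)//.
    congr ereal_sup; apply: eq_imagel => Q _.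
    by apply: eq_integral => x _; rewrite /= normr_id.
  apply: (ae_equiv_to hF t0 tT PS).
  apply: (ae_equiv_from hF T0 TT (proj1 QQ_Q0)).
  apply: (aeS (integrable_ae measurableT iY)) => x /(_ I).
  by rewrite fin_numElt => /andP[].
have cfin Y : D t Y -> c Y < +oo.
  move=> DY; rewrite ltey_eq (cnorm_fin_num hT hF hF0 hp hrho hbar hdom hsens)//.
  exact: (Lp_space_mono hF t0 tT TT DY).
have mXT := rv_measurableS tTF mX; have mBT := rv_measurableS tTF mB.
have cX : c X < +oo.
  have e0 Y : (Y \- cst 0)%R = Y by apply/funext => x; rewrite /= subr0.
  have := @cnorm_triangle _ _ _ _ QQ X B (cst 0%R) mXT mBT (measurable_cst _).
  rewrite !e0 => /le_lt_trans; apply.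
  by apply: lte_add_pinfty; [exact: le_lt_trans XB (ltry _)|exact: cfin].
have cN Y : c (\- Y)%R = c Y.
  congr ereal_sup; apply: eq_imagel => Q _.
  by apply: eq_integral => x _; rewrite /= normrN.
have mN' Y : rv_measurable (F t) Y -> rv_measurable (F t) (\- Y)%R.
  by move=> mY; exact: measurableT_comp.
have iX : cond_integrable (G:=F s) S (\- X)%R by apply: cint; [exact: mN'|rewrite cN].
have iB : cond_integrable (G:=F s) S (\- B)%R.
  by apply: cint; [exact: mN'|rewrite cN; exact: cfin].
have h1 := cond_exp_lip tF sF stF (mN' _ mX) (mN' _ mB) iX iB.
have h2 := cond_exp_lip tF sF stF (mN' _ mB) (mN' _ mX) iB iX.
have e1 : Num.norm \o ((\- X) \- (\- B))%R = Num.norm \o (X \- B)%R.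
  by apply/funext => x /=; rewrite opprK addrC distrC.
have e2 : Num.norm \o ((\- B) \- (\- X))%R = Num.norm \o (X \- B)%R.
  by apply/funext => x /=; rewrite opprK addrC.
rewrite e1 in h1; rewrite e2 in h2.
split.
- exact: emeasurable_funD.
- by move=> x; rewrite adde_ge0// lee_fin.
- move=> Q QQ_Q; rewrite ge0_integralD// EFinD; apply: leeD.
    apply: le_trans rB; exact: cnorm_ge.
  apply: le_trans (integral_cond_exp_le hS QQ_Q mXB nXB) _.
  rewrite (_ : c _ = c (X \- B)%R)//.
  congr ereal_sup; apply: eq_imagel => Q' _.
  by apply: eq_integral => x _; rewrite /= normr_id.
- exact: (ae_equiv_from hF t0 tT PS).
- exact: (ae_equiv_from hF t0 tT PS).
Qed.

(** Here y and b stand for E_S(-X | F_s) and E_S(-B | F_s), u for their distance bound, a for the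
    penalty, r for rho_st B and q for the extension at X. *)
Lemma lee_sub_penalty (y b u : \bar R) (a r q : R) :
  y <= b + u -> b - r%:E <= a%:E -> y - a%:E - q%:E <= `|q - r|%:E + u.
Proof.
move=> ub; rewrite !leeBlDr// -EFinD => ba.
apply: (le_trans ub); apply: (le_trans (leeD ba (lexx u))).
rewrite [leRHS]addeAC [X in _ <= X + _]addeAC -!EFinD [leRHS]addeAC -EFinD.
by apply: leeD => //; rewrite lee_fin; have := ler_norm (- (q - r)); rewrite normrN; lra.
Qed.

(** Letters as in [lee_sub_penalty]; Y is the candidate upper bound, w the bound U on the penalty
    and e the slack of near optimality. *)
Lemma lee_sub_near_optimal (y b u Y : \bar R) (a w r q e : R) : 0 <= u ->
  b <= y + u -> y - a%:E <= Y -> (r + w - e)%:E <= b -> a%:E <= w%:E ->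
  q%:E - Y <= `|q - r|%:E + u + e%:E.
Proof.
case: u => [v| |]//; last by move=> *; rewrite addey// addye// leey.
move=> _ byv yY rb; have {byv rb} := le_trans rb byv.
case: y yY => [y| |]//=; case: Y => [Y| |]//= yY ry aw; rewrite ?leNye//.
move: yY ry aw; rewrite !lee_fin; have := ler_norm (q - r); lra.
Qed.

(** For B in L_p this is the definition of the penalty; passing from B to X costs an error whose
    expectations under all Q in [calQ] are arbitrarily small. *)
Lemma cond_exp_penalty_le S rt X : calPtilde P T F p rho s t S ->
  Lc_extension P T F p rho s t rt -> Lc P QQ (F t) X ->
  \forall x \ae P, cond_exp S (F s) (\- X)%R x - min_penalty P F p rho s t S x <= (rt X x)%:E.
Proof.
move=> hS hrt LX; have PS : equivalent_on P S by case: hS.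
have [Q0 QQ_Q0] := hsens; have [rtL _ _] := hrt; have [mrX _] := rtL _ LX.
have mX : rv_measurable (F t) X by case: LX.
pose alpha := min_penalty P F p rho s t S.
have ma : erv_measurable (F s) alpha by have [] := min_penaltyP hF hrho s0 st tT S.
have afin : \forall x \ae P, alpha x \is a fin_num.
  apply: (ae_equiv_from hF T0 TT (proj1 QQ_Q0)).
  by apply: (aeS (integrable_ae measurableT (penalty_integrable hS QQ_Q0))) => x; exact.
pose g x := cond_exp S (F s) (\- X)%R x - alpha x - (rt X x)%:E.
have mg : erv_measurable (F T) g.
  apply: (erv_measurableS sTF); apply: emeasurable_funB; last exact: erv_measurable_EFin.
  apply: emeasurable_funB => //; apply: (erv_measurable_ce tF sF stF).
  exact: measurableT_comp.
suff : \forall x \ae P, g x <= 0.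
  by move=> h; apply: (aeS h) => x; rewrite /g leeBlDr// add0e.
apply: ae_le0_of_small => // e e0; have e2 := divr_gt0 e0 (ltr0n R 2).
have [B [DB _ XB rB]] := Lc_extension_approx hT hF hF0 hp hrho hbar hdom hsens s0 st tT hrt LX e2.
have [mh h0 hQ h1 _] := calPtilde_error hS hrt LX DB XB rB.
set h := (fun x => _) in mh h0 hQ; exists h; split => //; last first.
  by move=> Q QQ_Q; rewrite (splitr e); exact: hQ.
have h2 := min_penalty_ge hF hrho s0 st tT S DB.
apply: (aeS3 h1 h2 afin) => x ub ba /fineK ax.
rewrite /g -ax; apply: lee_sub_penalty ub _.
by rewrite ax.
Qed.

(** A measure S nearly optimal at a bounded B near X gives rho_st B <= E_S(-B | F_s) - alpha_st(S) +
    e/3. Once S is in [calPtilde], B may be replaced by X on both sides and the hypothesis on Y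
    applies. *)
Lemma le_of_cond_exp_penalty_le rt X (Y : Omega -> \bar R) :
  Lc_extension P T F p rho s t rt -> Lc P QQ (F t) X -> erv_measurable (F s) Y ->
  (forall S, calPtilde P T F p rho s t S -> \forall x \ae P,
    cond_exp S (F s) (\- X)%R x - min_penalty P F p rho s t S x <= Y x) ->
  \forall x \ae P, (rt X x)%:E <= Y x.
Proof.
move=> hrt LX mY ubY.
have [Q0 QQ_Q0] := hsens; have [rtL _ _] := hrt; have [mrX _] := rtL _ LX.
pose g x := (rt X x)%:E - Y x.
have mg : erv_measurable (F T) g.
  apply: (erv_measurableS sTF); apply: emeasurable_funB => //; exact: erv_measurable_EFin.
suff : \forall x \ae P, g x <= 0.
  by move=> h; apply: (aeS h) => x; rewrite /g sube_le0.
(* Two thirds of e go to the error of replacing X by B, one third to near optimality. *)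
apply: ae_le0_of_small => // e e0; have e3 : (0 < e / 3)%R by rewrite divr_gt0.
have [B [DB [K BK] XB rB]] :=
  Lc_extension_approx hT hF hF0 hp hrho hbar hdom hsens s0 st tT hrt LX e3.
have [S [U [PS SP mU UP BP]]] := near_optimal_measure hT hF hF0 hp hrho htc s0 st tT QQ_Q0 DB e3.
have aU := min_penalty_le hF hrho s0 st tT (erv_measurable_EFin mU) UP.
have mB : rv_measurable (F t) B by case: DB.
have K0 : (0 <= `|K|)%R by exact: normr_ge0.
have cK : \forall x \ae P, cond_exp S (F s) (\- B)%R x <= `|K|%:E.
  apply: (ae_equiv_from hF t0 tT PS); apply: (cond_exp_le_cst tF sF stF K0).
    exact: measurableT_comp.
  apply: (aeS (ae_equiv_to hF t0 tT PS BK)) => x h.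
  by have := ler_norm (- B x); have := ler_norm K; rewrite normrN /=; lra.
(* Boundedness of B bounds the penalty of S by |K| + e / 3 - rho_st B. *)
have hS : calPtilde P T F p rho s t S.
  split => //; pose C := (fine (c (rho s t B)) + (`|K| + e / 3))%R.
  apply: (@le_lt_trans _ _ C%:E); last exact: ltry.
  apply: ge_ereal_sup => _ [Q QQ_Q <-].
  have PQ : equivalent_on P Q by case: QQ_Q.
  have ma : erv_measurable (F T) (min_penalty P F p rho s t S).
    by have [m _ _] := min_penaltyP hF hrho s0 st tT S; exact: erv_measurableS sTF m.
  have [irN rN] := Rintegral_le_cnorm hT hF hF0 hp hrho hbar hdom hsens QQ_Q
    (Lp_space_norm hp TF Tm (DsT (rho_maps DB))).
  have [_ rN'] := Rintegral_le_cnorm hT hF hF0 hp hrho hbar hdom hsens QQ_Q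
    (DsT (rho_maps DB)).
  have C0 : (0 <= `|K| + e / 3)%R by rewrite addr_ge0// ltW.
  have mN : erv_measurable (F T) (EFin \o (Num.norm \o rho s t B)).
    by apply: (mQ sTF); apply: rv_measurable_norm; exact: mrho.
  (* The sign of the penalty is unknown, so its integral is bounded through the positive part. *)
  apply: (@le_trans _ _ (\int[Q]_x (min_penalty P F p rho s t S)^\+ x)).
    rewrite integralE -[leRHS]sube0; apply: leeB => //; exact: integral_ge0.
  apply: (@le_trans _ _ (\int[Q]_x ((`|rho s t B x|)%:E + (`|K| + e / 3)%:E))).
    apply: ae_ge0_le_integral => //.
    - exact: measurable_funepos.
    - by move=> x _; rewrite -EFinD lee_fin addr_ge0.
    - exact: emeasurable_funD.
    - have h := aeS3 aU cK BP (fun x a b c' => conj a (conj b c')).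
      apply: (aeS (ae_equiv_to hF T0 TT PQ h)) => x [a [b c']] _.
      rewrite funeposE ge_max -EFinD lee_fin addr_ge0// andbT.
      apply: (le_trans a); rewrite lee_fin.
      have := le_trans c' b; rewrite lee_fin.
      by have := ler_norm (- rho s t B x); rewrite normrN; lra.
  rewrite ge0_integralD//.
  rewrite integral_probability_cst /C [leRHS]EFinD; apply: leeD => //.
  by rewrite -EFin_Rintegral.
have [mh h0 hQ _ h2] := calPtilde_error hS hrt LX DB XB rB.
set h := (fun x => _) in mh h0 hQ; exists (fun x => h x + (e / 3)%:E); split => //.
- by apply: emeasurable_funD => //; exact: measurable_cst.
- by move=> x; apply: adde_ge0; [exact: h0|rewrite lee_fin ltW].
- have afin : \forall x \ae P, min_penalty P F p rho s t S x \is a fin_num.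
    apply: (ae_equiv_from hF T0 TT (proj1 QQ_Q0)).
    by apply: (aeS (integrable_ae measurableT (penalty_integrable hS QQ_Q0))) => x; exact.
  have all := aeS4 h2 afin aU (ubY _ hS) (fun x a b c' d' => conj (conj a b) (conj c' d')).
  apply: (aeS2 all BP) => x [[h2x /fineK ax] [aUx Yx]] bx.
  have [_ u0 _] := cond_exp_nnegP tF sF stF S
    (rv_measurable_norm (rv_measurableB (proj1 LX) mB)) (fun x => normr_ge0 _).
  rewrite -ax in Yx aUx.
  exact: lee_sub_near_optimal (u0 x) h2x Yx bx aUx.
- move=> Q QQ_Q; rewrite ge0_integralD//.
  + have -> : e%:E = (e / 3 + e / 3)%:E + (e / 3)%:E.
      by rewrite -EFinD; congr EFin; field.
    by rewrite integral_probability_cst; apply: leeD => //; exact: hQ.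
  + by move=> x _; exact: h0.
  + by move=> x _; rewrite lee_fin ltW.
Qed.

End representation.

Theorem theorem2p51 (d : measure_display) (Omega : measurableType d)
    (R : realType) (P : probability Omega R) (T : R) (hT : 0 < T)
    (F : R -> set_system Omega) (hF : complete_filtration P T F)
    (hF0 : trivial_sigma_algebra P (F 0)) (p : R) (hp : 1 <= p)
    (rho : R -> R -> (Omega -> R) -> Omega -> R)
    (hrho : fully_dynamic_crm P T F p rho)
    (htc : strong_time_consistent P T F p rho)
    (hdom : dominated P T F p rho) (hsens : sensitive P T F p rho) :
  forall s t : R, 0 <= s -> s <= t -> t <= T ->
  [/\ exists rt : (Omega -> R) -> Omega -> R,
        Lc_extension P T F p rho s t rt,
      (forall rt rt' : (Omega -> R) -> Omega -> R,
        Lc_extension P T F p rho s t rt -> Lc_extension P T F p rho s t rt' ->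
        forall X, Lc P (calQ P T F p rho) (F t) X ->
        \forall x \ae P, rt X x = rt' X x) &
      (forall rt : (Omega -> R) -> Omega -> R,
        Lc_extension P T F p rho s t rt ->
        forall X, Lc P (calQ P T F p rho) (F t) X ->
        is_ess_sup P (F s)
          [set (fun x => (cond_exp S (F s) (\- X)%R x
                          - min_penalty P F p rho s t S x)%E)
            | S in calPtilde P T F p rho s t]
          (EFin \o rt X))].

Proof.
move=> s t s0 st tT; have [rhobar hbar hd] := hdom.
have hQ : calQ P T F p rho !=set0 by [].
split.
- exact: (Lc_extension_exists hT hF hF0 hp hrho htc hbar hd hQ s0 st tT).
- move=> rt rt' hrt hrt' X LX.
  exact: (Lc_extension_unique hT hF hF0 hp hrho htc hbar hd hQ s0 st tT hrt hrt' LX).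
- move=> rt hrt X LX; split.
  + by apply: erv_measurable_EFin; have [rtL _ _] := hrt; have [] := rtL _ LX.
  + move=> _ [S hS <-].
    exact: (cond_exp_penalty_le hT hF hF0 hp hrho htc hbar hd hQ s0 st tT hS hrt LX).
  + move=> Y mY ubY.
    apply: (le_of_cond_exp_penalty_le hT hF hF0 hp hrho htc hbar hd hQ s0 st tT hrt LX mY).
    by move=> S hS; apply: (ubY _ (ex_intro2 _ _ S hS erefl)).
Qed.
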